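(* Let $f:\mathcal{D}\to\mathbb{R}$ be real-analytic and $\tau(f)$-strongly convex on the open set $\mathcal{D}\subseteq\mathbb{R}^n$, satisfying the holomorphic extension assumption for some $\bar\delta\in(0,1)$, and let $\mathcal{K}\subset\mathcal{D}$ be compact and convex. Suppose $f$ has Lipschitz Hessian on $\mathcal{K}$ with a nonzero constant $L_2(f)$. Let $\{x_k\}_{k\ge1}$ be generated by Algorithm (b) (projected, onto $\mathcal{K}$, with $x_1\in\mathcal{K}$) with stepsizes $\mu_k=2/(\tau(f)k)$ and smoothing parameters $\delta_k=\delta k^{-1/6}$, where $\delta\in(0,\kappa\bar\delta]$ for some $\kappa\in(0,1)$, and suppose the oracle is the stochastic complex oracle with noise second moment bound $\sigma_\xi$ and independent noise. Let $x^\star$ be the minimizer of $f$ over $\mathcal{K}$ and $\bar x_K=K^{-1}\sum_{k=1}^K x_k$. Then $$\mathbb{E}[f(\bar x_K)-f(x^\star)]\le\widetilde O\!\left(\frac{n^2}{\tau(f)}\,\delta^{-1/3}\sigma_\xi\,K^{-2/3}\right),$$ where $\widetilde O$ hides factors polylogarithmic in $K$ and constants independent of $K$.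
   Context: Standing setup. $\mathcal{D}\subseteq\mathbb{R}^n$ open, $f:\mathcal{D}\to\mathbb{R}$ real-analytic. Holomorphic extension assumption: $f$ admits a holomorphic extension to $\{x+iy: x\in\mathcal{D}, y\in(-\bar\delta,\bar\delta)^n\}\subset\mathbb{C}^n$ for some $\bar\delta\in(0,1)$. Stochastic complex oracle: on query $z$ in that set it returns $\Im(f(z))+\xi$, where $\xi$ is a real random variable with $\mathbb{E}[\xi]=0$, $\mathbb{E}[\xi^2]\le\sigma_\xi$ ($\sigma_\xi>0$); the noise is drawn independently of the random directions $u_k$ (fresh noise at each query). Algorithm 1: given $x_1\in\mathcal{X}$, stepsizes $\{\mu_k\}$ and smoothing parameters $\{\delta_k\}$, for $k=1,\dots,K$: draw $u_k$ uniformly on $\mathbb{S}^{n-1}$ (independently), set $g_{\delta_k}(x_k)=\frac{n}{\delta_k}\Im(f(x_k+i\delta_ku_k))u_k+\frac{n}{\delta_k}\xi_ku_k$ (the oracle output times $\frac{n}{\delta_k}u_k$), and $x_{k+1}=\Pi_{\mathcal{X}}(x_k-\mu_kg_{\delta_k}(x_k))$. Variant (a): $\mathcal{X}=\mathcal{D}$ (no projection); variant (b): $\mathcal{X}=\mathcal{K}\subset\mathcal{D}$ with $\Pi_{\mathcal{K}}$ the Euclidean projection onto $\mathcal{K}$. $f$ is $\tau(f)$-strongly convex if $f(y)\ge f(x)+\langle\nabla f(x),y-x\rangle+\tfrac12\tau(f)\|y-x\|_2^2$ for all $x,y\in\mathcal{D}$. Lipschitz Hessian with constant $L_2(f)$: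 $\|\nabla^2f(x)-\nabla^2f(y)\|_2\le L_2(f)\|x-y\|_2$. Expectations are over all randomness (directions and noise). *)

(* Defs.v *)
From HB Require Import structures.
From mathcomp Require Import all_boot all_order all_algebra.
From mathcomp Require Import all_classical all_reals all_analysis.
From mathcomp Require Import finmap.
From mathcomp.real_closed Require Import complex.
Import Order.TTheory GRing.Theory Num.Theory.
Import numFieldNormedType.Exports.

Set Implicit Arguments.
Unset Strict Implicit.
Unset Printing Implicit Defensive.

Local Open Scope ring_scope.
Local Open Scope classical_set_scope.

Section Defs.
Variable R : realType.

Definition dotv {n} (u v : 'rV[R]_n) : R := \sum_(i < n) u 0 i * v 0 i.
Definition enorm {n} (u : 'rV[R]_n) : R := Num.sqrt (dotv u u).

Definition sphere n : set 'rV[R]_n := [set v | enorm v = 1].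

Definition evec {n} (i : 'I_n) : 'rV[R]_n := \row_j (i == j)%:R.

Definition dderiv {n} (f : 'rV[R]_n -> R) (x v : 'rV[R]_n) : R :=
  derive1 (fun t : R => f (x + t *: v)) 0.

Definition grad {n} (f : 'rV[R]_n -> R) (x : 'rV[R]_n) : 'rV[R]_n :=
  \row_i dderiv f x (evec i).
Definition hessian {n} (f : 'rV[R]_n -> R) (x : 'rV[R]_n) : 'M[R]_n :=
  \matrix_(i, j) dderiv (fun y => dderiv f y (evec j)) x (evec i).

Definition opnorm2 {n} (A : 'M[R]_n) : R :=
  sup [set enorm (v *m A^T) | v in @sphere n].

Definition strongly_convex_on {n} (D : set 'rV[R]_n) (f : 'rV[R]_n -> R)
  (tau : R) : Prop :=
  forall x y, D x -> D y ->
    f x + dotv (grad f x) (y - x) + tau / 2 * enorm (y - x) ^+ 2 <= f y.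

Definition hessian_lipschitz_on {n} (K : set 'rV[R]_n) (f : 'rV[R]_n -> R)
  (L : R) : Prop :=
  forall x y, K x -> K y ->
    opnorm2 (hessian f x - hessian f y) <= L * enorm (x - y).

Definition ps_term {n} (c : ('I_n -> nat) -> R) (x y : 'rV[R]_n)
  (a : 'I_n -> nat) : R :=
  c a * \prod_(i < n) (y 0 i - x 0 i) ^+ a i.

Definition ps_partial {n} (c : ('I_n -> nat) -> R) (x y : 'rV[R]_n)
  (N : nat) : R :=
  \sum_(a : {ffun 'I_n -> 'I_N.+1} | (\sum_(i < n) (a i : nat) <= N)%N)
     ps_term c x y (fun i => (a i : nat)).

Definition ps_abs_partial {n} (c : ('I_n -> nat) -> R) (x y : 'rV[R]_n)
  (N : nat) : R :=
  \sum_(a : {ffun 'I_n -> 'I_N.+1} | (\sum_(i < n) (a i : nat) <= N)%N)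
     `| ps_term c x y (fun i => (a i : nat)) |.

Definition real_analytic_on {n} (D : set 'rV[R]_n) (f : 'rV[R]_n -> R)
  : Prop :=
  forall x, D x -> exists r : R, 0 < r /\
    exists c : ('I_n -> nat) -> R,
      forall y, enorm (y - x) < r ->
        cvg (ps_abs_partial c x y @ \oo) /\
        ps_partial c x y @ \oo --> f y.

Local Open Scope complex_scope.

Definition cpt {n} (x y : 'rV[R]_n) : 'rV[R[i]]_n :=
  \row_j (x 0 j +i* y 0 j).

Definition cabs (z : R[i]) : R :=
  Num.sqrt (complex.Re z ^+ 2 + complex.Im z ^+ 2).

Definition cnorm {n} (h : 'rV[R[i]]_n) : R :=
  Num.sqrt (\sum_(j < n) cabs (h 0 j) ^+ 2).

Definition cdifferentiable_at {n} (F : 'rV[R[i]]_n -> R[i])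
  (z : 'rV[R[i]]_n) : Prop :=
  exists a : 'rV[R[i]]_n, forall eps : R, 0 < eps ->
    exists d : R, 0 < d /\ forall h : 'rV[R[i]]_n, cnorm h < d ->
      cabs (F (z + h) - F z - \sum_(j < n) a 0 j * h 0 j) <= eps * cnorm h.

Definition holomorphic_on {n} (U : set 'rV[R[i]]_n) (F : 'rV[R[i]]_n -> R[i])
  : Prop := forall z, U z -> cdifferentiable_at F z.

Definition cstrip {n} (D : set 'rV[R]_n) (dbar : R) : set 'rV[R[i]]_n :=
  [set z | D (\row_j complex.Re (z 0 j)) /\
           forall j, `|complex.Im (z 0 j)| < dbar].

Definition holomorphic_extension {n} (D : set 'rV[R]_n) (f : 'rV[R]_n -> R)
  (dbar : R) (F : 'rV[R[i]]_n -> R[i]) : Prop :=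
  holomorphic_on (cstrip D dbar) F /\
  forall x, D x -> F (cpt x 0) = (f x)%:C.

Local Close Scope complex_scope.

(* Euclidean projection onto K (a minimiser of the distance, chosen by
   classical choice; it is unique for K nonempty closed convex). *)
Definition proj {n} (K : set 'rV[R]_n) (x : 'rV[R]_n) : 'rV[R]_n :=
  xget x [set p | K p /\ forall q, K q -> enorm (x - p) <= enorm (x - q)].

Definition zo_step {n} (F : 'rV[R[i]]_n -> R[i]) (K : set 'rV[R]_n)
  (mu delta : R) (x u : 'rV[R]_n) (xi : R) : 'rV[R]_n :=
  proj K (x - mu *: ((n%:R / delta) * (complex.Im (F (cpt x (delta *: u))) + xi)
                      *: u)).

(* iterates k w = x_{k+1}(w); step k (k >= 1) uses mu k, delta k, u k, xi k *)
Fixpoint zo_iterates {n} {T : Type} (F : 'rV[R[i]]_n -> R[i])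
  (K : set 'rV[R]_n) (x1 : 'rV[R]_n) (mu delta : nat -> R)
  (u : nat -> T -> 'rV[R]_n) (xi : nat -> T -> R) (k : nat) (w : T)
  : 'rV[R]_n :=
  match k with
  | 0 => x1
  | k'.+1 => zo_step F K (mu k) (delta k)
               (zo_iterates F K x1 mu delta u xi k' w) (u k w) (xi k w)
  end.

Definition zo_average {n} {T : Type} (F : 'rV[R[i]]_n -> R[i])
  (K : set 'rV[R]_n) (x1 : 'rV[R]_n) (mu delta : nat -> R)
  (u : nat -> T -> 'rV[R]_n) (xi : nat -> T -> R) (N : nat) (w : T)
  : 'rV[R]_n :=
  (N%:R)^-1 *: \sum_(k < N) zo_iterates F K x1 mu delta u xi k w.

Definition vecB n := g_sigma_algebraType (fun A : set 'rV[R]_n => open A).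

Definition orthogonal_mx {n} (Q : 'M[R]_n) : Prop := Q *m Q^T = 1%:M.

(* X is uniformly distributed on S^{n-1}: X takes values in S^{n-1} and its
   law is invariant under every orthogonal transformation (the normalised
   surface measure is the unique such law). *)
Definition uniform_on_sphere {d} {T : measurableType d} (P : probability T R)
  {n} (X : T -> 'rV[R]_n) : Prop :=
  (forall w, @sphere n (X w)) /\
  forall Q : 'M[R]_n, orthogonal_mx Q ->
    forall A : set (vecB n), measurable A ->
      P (X @^-1` A) = P ((fun w => X w *m Q^T) @^-1` A).

Definition mutually_independent {d} {T : measurableType d}
  (P : probability T R) {I : choiceType} (E : I -> set (set T)) : Prop :=
  forall (J : {fset I}) (A : I -> set T),
    (forall j, j \in J -> E j (A j)) ->
    P (\bigcap_(j in [set` J]) A j) = (\prod_(j <- J) P (A j))%E.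

Definition dir_noise_events {d} {T : measurableType d} {n}
  (u : nat -> T -> 'rV[R]_n) (xi : nat -> T -> R) (i : nat + nat)
  : set (set T) :=
  match i with
  | inl k => [set (u k : T -> vecB n) @^-1` A | A in @measurable _ (vecB n)]
  | inr k => [set xi k @^-1` B | B in @measurable _ R]
  end.

End Defs.

(* Main.v *)
Require Import Defs.
From HB Require Import structures.
From mathcomp Require Import all_boot all_order all_algebra.
From mathcomp Require Import fingroup perm.
From mathcomp Require Import all_classical all_reals all_analysis.
From mathcomp Require Import finmap.
From mathcomp Require Import measurable_realfun.
From mathcomp Require Import ring lra.
From mathcomp.real_closed Require Import complex.
Import Order.TTheory GRing.Theory Num.Theory.
Import numFieldNormedType.Exports.

(** For a unit vector [u] the function [phi w = F (x + w u)] is holomorphic near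
    [0] and real on the real axis. Cauchy's formula on a square gives a Taylor
    expansion of order two with an [O(|w|^3)] remainder, uniform over the compact
    set [K]; its coefficients are real, so [Im phi (i t) = t <grad f x, u> + O(t^3)]:
    the one-point estimator has bias [O(delta_k^2)]. By strong convexity and the
    nonexpansiveness of the projection, the steps [2 / (tau k)] make the weighted
    squared distances [(k - 1) |x_k - x*|^2] telescope, which leaves in round [k]
    the terms [delta_k^4] and [(1 + xi_k^2 / delta_k^2) / k], both of order
    [k^(-2/3)], and two terms of mean zero: [u_k] and [xi_k] are independent of
    [x_k], and [E[u_i u_j] = 1/n] if [i = j], [0] otherwise, by invariance of the
    law of [u] under sign changes and permutations of the coordinates. Summing and
    dividing by [K] gives the rate, without logarithms. *)

Set Implicit Arguments.
Unset Strict Implicit.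
Unset Printing Implicit Defensive.
Local Open Scope ring_scope.
Local Open Scope classical_set_scope.

(** * Complex modulus, derivative and integral on a segment *)

(** The obstacle is uniformity: one constant has to bound the bias for every [x] in [K], every unit
    [u] and every radius in use. Compactness of [K] times a cube of imaginary parts gives one bound
    on |F| and one radius, and the Taylor remainder depends on these two numbers only. Squares serve
    as contours because their sides are parallel to the axes: a contour integral is then a
    combination of real Lebesgue integrals on segments, and cutting a rectangle is additivity of
    these.

    In one round, strong convexity yields [tau / 2] times the squared distance to the minimizer.
    Half of it absorbs the product of bias and distance by Young's inequality; the other half lowers
    the weight tau k / 4, which the step 2 / (tau k) produces, to tau (k - 1) / 4, exactly what the
    previous round leaves over.

    The exponent 1/6 balances two orders: for radii k^(-a) the squared bias decays like k^(-4a) and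
    the noise term like k^(2a - 1), and these agree for a = 1/6. *)

Lemma cabsE (R : realType) (z : R[i]) : `|z| = real_complex R (cabs z).
Proof. by rewrite normc_def. Qed.

Lemma cabs_ge0 (R : realType) (z : R[i]) : 0 <= cabs z.
Proof. exact: sqrtr_ge0. Qed.

Lemma cabsM (R : realType) (z w : R[i]) : cabs (z * w) = cabs z * cabs w.
Proof. by apply: complexI; rewrite rmorphM /= -!cabsE normrM. Qed.

Lemma cabsD (R : realType) (z w : R[i]) : cabs (z + w) <= cabs z + cabs w.
Proof. by rewrite -lecR rmorphD /= -!cabsE ler_normD. Qed.

Lemma cabsN (R : realType) (z : R[i]) : cabs (- z) = cabs z.
Proof. by apply: complexI; rewrite -!cabsE normrN. Qed.

Lemma cabsB (R : realType) (z w : R[i]) : cabs (z - w) <= cabs z + cabs w.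
Proof. by rewrite -(cabsN w) cabsD. Qed.

Lemma cabs0 (R : realType) : cabs (0 : R[i]) = 0.
Proof. by apply: complexI; rewrite -!cabsE normr0. Qed.

Lemma cabs_eq0 (R : realType) (z : R[i]) : (cabs z == 0) = (z == 0).
Proof. by rewrite -[RHS]normr_eq0 cabsE -(inj_eq (@complexI R)). Qed.

Lemma cabsV (R : realType) (z : R[i]) : cabs (z^-1) = (cabs z)^-1.
Proof. by apply: complexI; rewrite fmorphV /= -!cabsE normfV. Qed.

Lemma cabsX (R : realType) (z : R[i]) k : cabs (z ^+ k) = cabs z ^+ k.
Proof. by apply: complexI; rewrite rmorphXn /= -!cabsE normrX. Qed.

Lemma cabs_real (R : realType) (a : R) : cabs (real_complex R a) = `|a|.
Proof. by rewrite /cabs /= expr0n /= addr0 sqrtr_sqr. Qed.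

Lemma cabs_i (R : realType) : cabs (Complex 0 1 : R[i]) = 1.
Proof. by rewrite /cabs /= expr0n expr1n add0r sqrtr1. Qed.

Lemma ler_normRe (R : realType) (z : R[i]) : `|complex.Re z| <= cabs z.
Proof. by rewrite -sqrtr_sqr ler_wsqrtr // lerDl sqr_ge0. Qed.

Lemma ler_normIm (R : realType) (z : R[i]) : `|complex.Im z| <= cabs z.
Proof. by rewrite -sqrtr_sqr ler_wsqrtr // lerDr sqr_ge0. Qed.

Lemma cabs_le_ReIm (R : realType) (z : R[i]) :
  cabs z <= `|complex.Re z| + `|complex.Im z|.
Proof.
rewrite {1}[z]complexE (le_trans (cabsD _ _)) // cabsM !cabs_real cabs_i.
by rewrite mul1r.
Qed.

Lemma cReD (R : realType) (z w : R[i]) :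
  complex.Re (z + w) = complex.Re z + complex.Re w.
Proof. by case: z; case: w. Qed.

Lemma cImD (R : realType) (z w : R[i]) :
  complex.Im (z + w) = complex.Im z + complex.Im w.
Proof. by case: z; case: w. Qed.

Lemma cReN (R : realType) (z : R[i]) : complex.Re (- z) = - complex.Re z.
Proof. by case: z. Qed.

Lemma cImN (R : realType) (z : R[i]) : complex.Im (- z) = - complex.Im z.
Proof. by case: z. Qed.

Lemma cReM (R : realType) (z w : R[i]) : complex.Re (z * w) =
  complex.Re z * complex.Re w - complex.Im z * complex.Im w.
Proof. by case: z; case: w. Qed.

Lemma cImM (R : realType) (z w : R[i]) : complex.Im (z * w) =
  complex.Re z * complex.Im w + complex.Im z * complex.Re w.
Proof. by case: z; case: w. Qed.

Lemma eq_ReIm (R : realType) (z w : R[i]) : complex.Re z = complex.Re w ->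
  complex.Im z = complex.Im w -> z = w.
Proof. by case: z; case: w => /= a b c d -> ->. Qed.

(** The one-variable form of [cdifferentiable_at], so that restricting [F] to a complex line needs
    no change of topology. *)
Definition cderivable (R : realType) (phi : R[i] -> R[i]) (z : R[i]) : Prop :=
  exists a : R[i], forall eps : R, 0 < eps -> exists d : R, 0 < d /\
    forall h, cabs h < d -> cabs (phi (z + h) - phi z - a * h) <= eps * cabs h.

Lemma cderivable_continuous (R : realType) (phi : R[i] -> R[i]) z :
  cderivable phi z -> forall eps, 0 < eps -> exists d, 0 < d /\
    forall h, cabs h < d -> cabs (phi (z + h) - phi z) <= eps.
Proof.
move=> [a /(_ 1 ltr01)[d [d0 dP]]] eps eps0.
have a1 : 0 < 1 + cabs a by rewrite ltr_pwDl // cabs_ge0.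
exists (Num.min d (eps / (1 + cabs a))); split.
  by rewrite lt_min d0 divr_gt0.
move=> h; rewrite lt_min => /andP[/dP hd]; rewrite ltr_pdivlMr // => /ltW he.
rewrite -(subrK (a * h) (_ - _)) (le_trans (cabsD _ _)) // (le_trans _ he) //.
by rewrite mulrDr mulr1 cabsM [cabs h * _]mulrC lerD2r -[leRHS]mul1r.
Qed.

Definition Cint (R : realType) (a b : R) (g : R -> R[i]) : R[i] :=
  Complex (\int[lebesgue_measure]_(x in `[a, b]) complex.Re (g x))
          (\int[lebesgue_measure]_(x in `[a, b]) complex.Im (g x)).

Definition Ccont (R : realType) (a b : R) (g : R -> R[i]) : Prop :=
  forall x, a <= x <= b -> forall eps, 0 < eps -> exists d, 0 < d /\
    forall y, `|y - x| < d -> a <= y <= b -> cabs (g y - g x) <= eps.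

Lemma Ccont_Re (R : realType) (a b : R) (g : R -> R[i]) : Ccont a b g ->
  {within `[a, b], continuous (fun x => complex.Re (g x))}.
Proof.
move=> gc; apply/subspace_continuousP => x /=; rewrite in_itv /= => xab.
apply/cvgrPdist_le => eps eps0; have [d [d0 dP]] := gc x xab eps eps0.
rewrite near_withinE; near=> y => /=; rewrite in_itv /= => yab.
rewrite distrC -cReN -cReD (le_trans (ler_normRe _)) // dP //.
Unshelve. all: by end_near. Qed.

Lemma Ccont_Im (R : realType) (a b : R) (g : R -> R[i]) : Ccont a b g ->
  {within `[a, b], continuous (fun x => complex.Im (g x))}.
Proof.
move=> gc; apply/subspace_continuousP => x /=; rewrite in_itv /= => xab.
apply/cvgrPdist_le => eps eps0; have [d [d0 dP]] := gc x xab eps eps0.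
rewrite near_withinE; near=> y => /=; rewrite in_itv /= => yab.
rewrite distrC -cImN -cImD (le_trans (ler_normIm _)) // dP //.
Unshelve. all: by end_near. Qed.

Lemma Ccont_intRe (R : realType) (a b : R) (g : R -> R[i]) : Ccont a b g ->
  lebesgue_measure.-integrable `[a, b] (EFin \o (fun x => complex.Re (g x))).
Proof.
move=> /Ccont_Re gc; apply: continuous_compact_integrable => //.
exact: segment_compact.
Qed.

Lemma Ccont_intIm (R : realType) (a b : R) (g : R -> R[i]) : Ccont a b g ->
  lebesgue_measure.-integrable `[a, b] (EFin \o (fun x => complex.Im (g x))).
Proof.
move=> /Ccont_Im gc; apply: continuous_compact_integrable => //.
exact: segment_compact.
Qed.

(** Error estimates come with a constant factor, removed here by rescaling [eps]. The restriction
    [eps <= 1] lets the product rule bound a product of two increments linearly in [eps]. *)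
Lemma cderivable_bound (R : realType) (phi : R[i] -> R[i]) z (a : R[i]) (C : R) :
  0 <= C ->
  (forall eps, 0 < eps -> eps <= 1 -> exists d : R, 0 < d /\
    forall h, cabs h < d ->
      cabs (phi (z + h) - phi z - a * h) <= C * eps * cabs h) ->
  cderivable phi z.
Proof.
move=> C0 H; exists a => eps eps0; have C1 : 0 < C + 1 by rewrite ltr_wpDl.
have e1 : 0 < Num.min 1 (eps / (C + 1)) by rewrite lt_min ltr01 divr_gt0.
have [|d [d0 dP]] := H _ e1; first by rewrite ge_min lexx.
exists d; split=> // h /dP /le_trans; apply.
rewrite ler_wpM2r ?cabs_ge0 // (@le_trans _ _ ((C + 1) * (eps / (C + 1)))) //.
  by rewrite ler_pM // ?(ltW e1) // ?lerDl // ge_min lexx orbT.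
by rewrite mulrC divfK // gt_eqF.
Qed.

Lemma cderivable_cst (R : realType) (k : R[i]) z : cderivable (fun=> k) z.
Proof.
exists 0 => eps eps0; exists 1; split=> // h _.
by rewrite mul0r !subr0 subrr cabs0 mulr_ge0 ?cabs_ge0 // ltW.
Qed.

Lemma cderivable_id (R : realType) (z : R[i]) : cderivable id z.
Proof.
exists 1 => eps eps0; exists 1; split=> // h _.
have -> : id (z + h) - id z - 1 * h = 0 by rewrite /=; ring.
by rewrite cabs0 mulr_ge0 ?cabs_ge0 // ltW.
Qed.

Lemma cderivableD (R : realType) (phi psi : R[i] -> R[i]) z :
  cderivable phi z -> cderivable psi z -> cderivable (fun w => phi w + psi w) z.
Proof.
move=> [a Ha] [b Hb]; apply: (@cderivable_bound _ _ _ (a + b) 2) => // eps e0 e1.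
have [d1 [d10 H1]] := Ha _ e0; have [d2 [d20 H2]] := Hb _ e0.
exists (Num.min d1 d2); split; first by rewrite lt_min d10.
move=> h; rewrite lt_min => /andP[/H1 h1 /H2 h2].
have -> : phi (z + h) + psi (z + h) - (phi z + psi z) - (a + b) * h =
  (phi (z + h) - phi z - a * h) + (psi (z + h) - psi z - b * h) by ring.
by rewrite (le_trans (cabsD _ _)) // mulrDl mul1r mulrDl lerD.
Qed.

Lemma cderivableM (R : realType) (phi psi : R[i] -> R[i]) z :
  cderivable phi z -> cderivable psi z -> cderivable (fun w => phi w * psi w) z.
Proof.
move=> pd qd; have pc := cderivable_continuous pd.
case: pd qd => [a Ha] [b Hb].
have cge := @cabs_ge0 R.
apply: (@cderivable_bound _ _ _ (a * psi z + phi z * b)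
  (cabs (psi z) + cabs (phi z) + (1 + cabs b))) => [|eps e0 e1].
  by rewrite !addr_ge0.
have [d1 [d10 H1]] := Ha _ e0; have [d2 [d20 H2]] := Hb _ e0.
have [d3 [d30 H3]] := pc _ e0.
exists (Num.min d1 (Num.min d2 d3)); split; first by rewrite !lt_min d10 d20.
move=> h; rewrite !lt_min => /and3P[/H1 h1 /H2 h2 /H3 h3].
have -> : phi (z + h) * psi (z + h) - phi z * psi z - (a * psi z + phi z * b) * h =
  (phi (z + h) - phi z - a * h) * psi z
   + phi z * (psi (z + h) - psi z - b * h)
   + (phi (z + h) - phi z) * (psi (z + h) - psi z) by ring.
have h4 : cabs (psi (z + h) - psi z) <= (1 + cabs b) * cabs h.
  rewrite -(subrK (b * h) (_ - _)) (le_trans (cabsD _ _)) // cabsM mulrDl lerD2r.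
  by rewrite (le_trans h2) // ler_wpM2r.
rewrite (le_trans (cabsD _ _)) //.
rewrite [leRHS](_ : _ = (cabs (psi z) + cabs (phi z)) * eps * cabs h + (1 + cabs b) * eps * cabs h); last by ring.
rewrite lerD //.
  rewrite (le_trans (cabsD _ _)) //.
  rewrite -mulrA [leRHS]mulrDl lerD // cabsM.
    by rewrite mulrC ler_wpM2l.
  by rewrite ler_wpM2l.
by rewrite cabsM [(1 + _) * eps]mulrC -mulrA ler_pM.
Qed.

Lemma cderivable_inv (R : realType) (w z : R[i]) : z != w ->
  cderivable (fun x => (x - w)^-1) z.
Proof.
move=> zw; have zw0 : z - w != 0 by rewrite subr_eq0.
have c0 : 0 < cabs (z - w) by rewrite lt_neqAle eq_sym cabs_eq0 zw0 cabs_ge0.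
exists (- (z - w) ^- 2) => eps eps0.
(* The first radius keeps |z + h - w| at least |z - w| / 2; the second then makes the exact
   remainder h^2 / ((z - w)^2 (z + h - w)) at most eps |h|. *)
exists (Num.min (cabs (z - w) / 2) (eps * (cabs (z - w)) ^+ 3 / 2)); split.
  by rewrite lt_min !divr_gt0 // mulr_gt0 // exprn_gt0.
move=> h; rewrite lt_min => /andP[h1 h2].
have h3 : cabs (z - w) / 2 <= cabs (z + h - w).
  have := cabsB (z + h - w) h; rewrite (_ : z + h - w - h = z - w); last by ring.
  by move: h1; lra.
have h4 : z + h - w != 0.
  by rewrite -cabs_eq0 gt_eqF // (lt_le_trans _ h3) // divr_gt0.
have -> : (z + h - w)^-1 - (z - w)^-1 - - (z - w) ^- 2 * h =
   h * h * (z - w) ^- 2 * (z + h - w) ^-1 by field; rewrite zw0 h4.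
rewrite !cabsM !cabsV cabsX -mulrA mulrAC ler_wpM2r ?cabs_ge0 //.
rewrite -ler_pdivlMr ?mulr_gt0 ?invr_gt0 ?exprn_gt0 //; last first.
  by rewrite (lt_le_trans _ h3) // divr_gt0.
apply: le_trans (ltW h2) _; rewrite invfM !invrK !exprS expr0 mulr1 -mulrA.
rewrite ler_wpM2l ?(ltW eps0) // -!mulrA ler_wpM2l ?(ltW c0) //.
by rewrite ler_wpM2l // ltW.
Qed.

(** * Linearity, additivity and size of integrals over a segment *)

Lemma CintD (R : realType) (a b : R) (f g : R -> R[i]) :
  Ccont a b f -> Ccont a b g ->
  Cint a b (fun x => f x + g x) = Cint a b f + Cint a b g.
Proof.
move=> fc gc; apply: eq_ReIm => /=.
  rewrite -RintegralD //; [|exact: Ccont_intRe|exact: Ccont_intRe].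
  by apply: eq_Rintegral => x _; exact: cReD.
rewrite -RintegralD //; [|exact: Ccont_intIm|exact: Ccont_intIm].
by apply: eq_Rintegral => x _; exact: cImD.
Qed.

Lemma Ccont_integrableZ (R : realType) (a b k : R) (f : R -> R) :
  lebesgue_measure.-integrable `[a, b] (EFin \o f) ->
  lebesgue_measure.-integrable `[a, b] (EFin \o (fun x => k * f x)).
Proof.
move=> fi; have := integrableZl _ k fi => /(_ (measurable_itv _)).
by apply: eq_integrable => // x _; rewrite /= EFinM.
Qed.

Lemma CintZ (R : realType) (a b : R) (k : R[i]) (f : R -> R[i]) :
  Ccont a b f -> Cint a b (fun x => k * f x) = k * Cint a b f.
Proof.
move=> fc; have [re im] := (Ccont_intRe fc, Ccont_intIm fc).
apply: eq_ReIm => /=.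
  rewrite cReM /= -!RintegralZl // -RintegralB //; try exact: Ccont_integrableZ.
  by apply: eq_Rintegral => x _; exact: cReM.
rewrite cImM /= -!RintegralZl // -RintegralD //; try exact: Ccont_integrableZ.
by apply: eq_Rintegral => x _; exact: cImM.
Qed.

Lemma Rintegral_split (R : realType) (a m b : R) (f : R -> R) :
  a <= m -> m <= b -> lebesgue_measure.-integrable `[a, b] (EFin \o f) ->
  \int[lebesgue_measure]_(x in `[a, b]) f x =
  \int[lebesgue_measure]_(x in `[a, m]) f x +
  \int[lebesgue_measure]_(x in `[m, b]) f x.
Proof.
move=> am mb fi; have := @Rintegral_itvB _ f (BLeft a) (BRight b) m fi.
rewrite !bnd_simp => /(_ am mb) => /eqP; rewrite subr_eq => /eqP ->.
rewrite addrC Rintegral_itv_obnd_cbnd //.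
apply: integrableS fi => //; apply: subset_itvr; by rewrite bnd_simp.
Qed.

Lemma Cint_split (R : realType) (a m b : R) (g : R -> R[i]) :
  a <= m -> m <= b -> Ccont a b g -> Cint a b g = Cint a m g + Cint m b g.
Proof.
move=> am mb gc; apply: eq_ReIm => /=.
  by apply: Rintegral_split => //; exact: Ccont_intRe.
by apply: Rintegral_split => //; exact: Ccont_intIm.
Qed.

Lemma integrable_itv_cst (R : realType) (a b k : R) :
  lebesgue_measure.-integrable `[a, b] (EFin \o (fun=> k)).
Proof.
apply: continuous_compact_integrable; first exact: segment_compact.
by apply: continuous_subspaceT => x; exact: cvg_cst.
Qed.

Lemma Rintegral_itv_cst (R : realType) (a b k : R) : a <= b ->
  \int[lebesgue_measure]_(x in `[a, b]) k = k * (b - a).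
Proof.
move=> ab; rewrite Rintegral_cst //= lebesgue_measure_itv /= lte_fin.
by case: ltgtP ab => // ->; rewrite subrr.
Qed.

Lemma Cint_cst (R : realType) (a b : R) (k : R[i]) : a <= b ->
  Cint a b (fun=> k) = k * real_complex R (b - a).
Proof.
move=> ab; apply: eq_ReIm; rewrite /= Rintegral_itv_cst // ?cReM ?cImM /=.
  by rewrite mulr0 subr0.
by rewrite mulr0 add0r.
Qed.

Lemma normr_Rintegral_bound (R : realType) (a b M : R) (f : R -> R) : a <= b ->
  lebesgue_measure.-integrable `[a, b] (EFin \o f) ->
  (forall x, a <= x <= b -> `|f x| <= M) ->
  `|\int[lebesgue_measure]_(x in `[a, b]) f x| <= M * (b - a).
Proof.
move=> ab fi fM; rewrite ler_norml -mulNr -!Rintegral_itv_cst //.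
apply/andP; split; apply: le_Rintegral => //; try exact: integrable_itv_cst.
  by move=> x /=; rewrite in_itv /= => /fM; rewrite ler_norml => /andP[].
by move=> x /=; rewrite in_itv /= => /fM; rewrite ler_norml => /andP[].
Qed.

(** The factor 2 comes from bounding the real and imaginary parts separately; the sharp constant
    would bring nothing to the rate. *)
Lemma cabs_Cint_le (R : realType) (a b M : R) (g : R -> R[i]) : a <= b ->
  Ccont a b g -> (forall x, a <= x <= b -> cabs (g x) <= M) ->
  cabs (Cint a b g) <= 2 * M * (b - a).
Proof.
move=> ab gc gM; apply: le_trans (cabs_le_ReIm _) _.
have -> : 2 * M * (b - a) = M * (b - a) + M * (b - a) by ring.
rewrite lerD //= normr_Rintegral_bound //.
- exact: Ccont_intRe.
- by move=> x /gM; apply: le_trans; exact: ler_normRe.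
- exact: Ccont_intIm.
- by move=> x /gM; apply: le_trans; exact: ler_normIm.
Qed.

Lemma Rintegral_shift (R : realType) (a b t : R) (f : R -> R) : a <= b ->
  {within `[a + t, b + t], continuous f} ->
  \int[lebesgue_measure]_(x in `[a + t, b + t]) f x =
  \int[lebesgue_measure]_(x in `[a, b]) f (x + t).
Proof.
move=> ab fc; rewrite /Rintegral; congr fine.
have der x : is_derive (x : R) (1 : R) (fun y : R => y + t) 1.
  by apply: is_derive_eq; rewrite addr0.
have d1 : (fun y : R => y + t)^`() = cst 1.
  by apply/funext => x; rewrite derive1E; apply: derive_val.
rewrite (@integration_by_substitution_increasing _ (fun y => y + t)) //.
- by apply: eq_integral => x _ /=; rewrite d1 fctE /= mulr1.
- by move=> x y _ _; rewrite ltrD2r.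
- by rewrite d1 => x _; exact: cvg_cst.
- by rewrite d1; exact: is_cvg_cst.
- by rewrite d1; exact: is_cvg_cst.
- split => [x _| |]; first exact: ex_derive.
  + by apply: cvg_at_right_filter; apply: cvgD; [exact: cvg_id|exact: cvg_cst].
  + by apply: cvg_at_left_filter; apply: cvgD; [exact: cvg_id|exact: cvg_cst].
Qed.

Lemma Cint_shift (R : realType) (a b t : R) (g : R -> R[i]) : a <= b ->
  Ccont (a + t) (b + t) g ->
  Cint (a + t) (b + t) g = Cint a b (fun x => g (x + t)).
Proof.
move=> ab gc; rewrite /Cint !Rintegral_shift //; first exact: Ccont_Im.
exact: Ccont_Re.
Qed.

(** * Integrals along the boundary of a rectangle *)

Definition cder_on (R : realType) (phi : R[i] -> R[i]) (a b c d : R) : Prop :=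
  forall x y, a <= x <= b -> c <= y <= d -> cderivable phi (Complex x y).

Definition cder_bd (R : realType) (phi : R[i] -> R[i]) (a b c d : R) : Prop :=
  forall x y, a <= x <= b -> c <= y <= d ->
    [\/ x = a, x = b, y = c | y = d] -> cderivable phi (Complex x y).

Lemma cder_on_bd (R : realType) (phi : R[i] -> R[i]) a b c d :
  cder_on phi a b c d -> cder_bd phi a b c d.
Proof. by move=> H x y xab ycd _; exact: H. Qed.

(* Counterclockwise contour integral along the boundary of [a, b] x [c, d]. *)
Definition rint (R : realType) (phi : R[i] -> R[i]) (a b c d : R) : R[i] :=
  Cint a b (fun x => phi (Complex x c)) - Cint a b (fun x => phi (Complex x d))
  + Complex 0 1 * (Cint c d (fun y => phi (Complex b y))
                   - Cint c d (fun y => phi (Complex a y))).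

Lemma Ccont_hor (R : realType) (phi : R[i] -> R[i]) a b c :
  (forall x, a <= x <= b -> cderivable phi (Complex x c)) ->
  Ccont a b (fun x => phi (Complex x c)).
Proof.
move=> H x /H /cderivable_continuous pc eps /pc[d [d0 dP]].
exists d; split=> // y yx _; have := dP (real_complex R (y - x)).
rewrite cabs_real => /(_ yx); congr (cabs (phi _ - _) <= _).
by apply: eq_ReIm; rewrite ?cReD ?cImD /= ?addr0 // addrC subrK.
Qed.

Lemma Ccont_ver (R : realType) (phi : R[i] -> R[i]) a c d :
  (forall y, c <= y <= d -> cderivable phi (Complex a y)) ->
  Ccont c d (fun y => phi (Complex a y)).
Proof.
move=> H x /H /cderivable_continuous pc eps /pc[e [e0 eP]].
exists e; split=> // y yx _; have := eP (Complex 0 1 * real_complex R (y - x)).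
rewrite cabsM cabs_i mul1r cabs_real => /(_ yx); congr (cabs (phi _ - _) <= _).
apply: eq_ReIm; rewrite ?cReD ?cImD ?cReM ?cImM /= ?(mul0r, mulr0, mul1r, add0r, addr0, subr0) //.
by rewrite addrC subrK.
Qed.

Lemma cder_bd_Ccont (R : realType) (phi : R[i] -> R[i]) a b c d :
  a <= b -> c <= d -> cder_bd phi a b c d ->
  [/\ Ccont a b (fun x => phi (Complex x c)), Ccont a b (fun x => phi (Complex x d)),
      Ccont c d (fun y => phi (Complex a y)) & Ccont c d (fun y => phi (Complex b y))].
Proof.
move=> ab cd H; split.
- apply: Ccont_hor => x xab; apply: H => //; last exact: Or43.
  by rewrite lexx cd.
- apply: Ccont_hor => x xab; apply: H => //; last exact: Or44.
  by rewrite lexx cd.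
- apply: Ccont_ver => x xab; apply: H => //; last exact: Or41.
  by rewrite lexx ab.
- apply: Ccont_ver => x xab; apply: H => //; last exact: Or42.
  by rewrite lexx ab.
Qed.

Lemma rintD (R : realType) (phi psi : R[i] -> R[i]) a b c d :
  a <= b -> c <= d -> cder_bd phi a b c d -> cder_bd psi a b c d ->
  rint (fun z => phi z + psi z) a b c d = rint phi a b c d + rint psi a b c d.
Proof.
move=> ab cd /cder_bd_Ccont[] // p1 p2 p3 p4 /cder_bd_Ccont[] // q1 q2 q3 q4.
by rewrite /rint !CintD //; ring.
Qed.

Lemma rintZ (R : realType) (phi : R[i] -> R[i]) (k : R[i]) a b c d :
  a <= b -> c <= d -> cder_bd phi a b c d ->
  rint (fun z => k * phi z) a b c d = k * rint phi a b c d.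
Proof.
move=> ab cd /cder_bd_Ccont[] // p1 p2 p3 p4.
by rewrite /rint !CintZ //; ring.
Qed.

Lemma eq_Cint (R : realType) (a b : R) (f g : R -> R[i]) :
  (forall x, a <= x <= b -> f x = g x) -> Cint a b f = Cint a b g.
Proof.
move=> E; congr Complex; apply: eq_Rintegral => x /set_mem /=;
  by rewrite in_itv /= => /E ->.
Qed.

Lemma eq_rint (R : realType) (phi psi : R[i] -> R[i]) a b c d :
  a <= b -> c <= d ->
  (forall x y, a <= x <= b -> c <= y <= d ->
    [\/ x = a, x = b, y = c | y = d] -> phi (Complex x y) = psi (Complex x y)) ->
  rint phi a b c d = rint psi a b c d.
Proof.
move=> ab cd E; rewrite /rint.
have aa : a <= a <= b by rewrite lexx.
have bb : a <= b <= b by rewrite lexx andbT.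
have cc : c <= c <= d by rewrite lexx.
have dd : c <= d <= d by rewrite lexx andbT.
congr (_ - _ + _ * (_ - _)); apply: eq_Cint => x xab; apply: E => //.
- exact: Or43.
- exact: Or44.
- exact: Or42.
- exact: Or41.
Qed.

Lemma cabs_rint_le (R : realType) (phi : R[i] -> R[i]) a b c d M :
  a <= b -> c <= d -> cder_bd phi a b c d ->
  (forall x y, a <= x <= b -> c <= y <= d ->
    [\/ x = a, x = b, y = c | y = d] -> cabs (phi (Complex x y)) <= M) ->
  cabs (rint phi a b c d) <= 4 * M * ((b - a) + (d - c)).
Proof.
move=> ab cd /cder_bd_Ccont[] // p1 p2 p3 p4 B.
have aa : a <= a <= b by rewrite lexx.
have bb : a <= b <= b by rewrite lexx andbT.
have cc : c <= c <= d by rewrite lexx.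
have dd : c <= d <= d by rewrite lexx andbT.
have b1 : cabs (Cint a b (fun x => phi (Complex x c))) <= 2 * M * (b - a).
  by apply: cabs_Cint_le => // x xab; apply: B => //; exact: Or43.
have b2 : cabs (Cint a b (fun x => phi (Complex x d))) <= 2 * M * (b - a).
  by apply: cabs_Cint_le => // x xab; apply: B => //; exact: Or44.
have b3 : cabs (Cint c d (fun y => phi (Complex a y))) <= 2 * M * (d - c).
  by apply: cabs_Cint_le => // x xab; apply: B => //; exact: Or41.
have b4 : cabs (Cint c d (fun y => phi (Complex b y))) <= 2 * M * (d - c).
  by apply: cabs_Cint_le => // x xab; apply: B => //; exact: Or42.
apply: le_trans (cabsD _ _) _; rewrite cabsM cabs_i mul1r.
apply: le_trans (lerD (cabsB _ _) (cabsB _ _)) _.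
by move: b1 b2 b3 b4; lra.
Qed.

(** The common side at [m] is run through in both directions and cancels. *)
Lemma rint_splith (R : realType) (phi : R[i] -> R[i]) a m b c d :
  a <= m -> m <= b -> c <= d -> cder_bd phi a m c d -> cder_bd phi m b c d ->
  rint phi a b c d = rint phi a m c d + rint phi m b c d.
Proof.
move=> am mb cd H1 H2.
have cc : c <= c <= d by rewrite lexx.
have dd : c <= d <= d by rewrite lexx andbT.
have Cc : Ccont a b (fun x => phi (Complex x c)).
  apply: Ccont_hor => x /andP[ax xb]; have [xm|/ltW xm] := leP x m.
    by apply: H1 => //; [rewrite ax xm|exact: Or43].
  by apply: H2 => //; [rewrite xm xb|exact: Or43].
have Cd : Ccont a b (fun x => phi (Complex x d)).
  apply: Ccont_hor => x /andP[ax xb]; have [xm|/ltW xm] := leP x m.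
    by apply: H1 => //; [rewrite ax xm|exact: Or44].
  by apply: H2 => //; [rewrite xm xb|exact: Or44].
by rewrite /rint (Cint_split am mb Cc) (Cint_split am mb Cd); ring.
Qed.

Lemma rint_splitv (R : realType) (phi : R[i] -> R[i]) a b c m d :
  c <= m -> m <= d -> a <= b -> cder_bd phi a b c m -> cder_bd phi a b m d ->
  rint phi a b c d = rint phi a b c m + rint phi a b m d.
Proof.
move=> cm md ab H1 H2.
have aa : a <= a <= b by rewrite lexx.
have bb : a <= b <= b by rewrite lexx andbT.
have Ca : Ccont c d (fun y => phi (Complex a y)).
  apply: Ccont_ver => x /andP[ax xb]; have [xm|/ltW xm] := leP x m.
    by apply: H1 => //; [rewrite ax xm|exact: Or41].
  by apply: H2 => //; [rewrite xm xb|exact: Or41].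
have Cb : Ccont c d (fun y => phi (Complex b y)).
  apply: Ccont_ver => x /andP[ax xb]; have [xm|/ltW xm] := leP x m.
    by apply: H1 => //; [rewrite ax xm|exact: Or42].
  by apply: H2 => //; [rewrite xm xb|exact: Or42].
by rewrite /rint (Cint_split cm md Ca) (Cint_split cm md Cb); ring.
Qed.

Lemma cderivable_affine (R : realType) (k al z : R[i]) :
  cderivable (fun w => k + al * w) z.
Proof.
apply: cderivableD; first exact: cderivable_cst.
by apply: cderivableM; [exact: cderivable_cst|exact: cderivable_id].
Qed.

(** Integrands on opposite sides differ by a constant, so the horizontal and the vertical
    differences are explicit and cancel. This disposes of the linear part in Goursat's argument. *)
Lemma rint_affine (R : realType) (k al : R[i]) a b c d : a <= b -> c <= d ->
  rint (fun w => k + al * w) a b c d = 0.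
Proof.
move=> ab cd.
have [p1 p2 p3 p4] := @cder_bd_Ccont _ (fun w => k + al * w) _ _ _ _ ab cd
  (fun x y _ _ _ => cderivable_affine k al _).
have Ccst (u v : R) (l : R[i]) : Ccont u v (fun=> l).
  by move=> x _ eps e0; exists 1; split=> // y _ _; rewrite subrr cabs0 ltW.
have Eh : Cint a b (fun x => k + al * Complex x c) =
    Cint a b (fun x => k + al * Complex x d) +
    al * Complex 0 (c - d) * real_complex R (b - a).
  rewrite -Cint_cst // -CintD //; apply: eq_Cint => x _.
  rewrite -addrA -mulrDr; congr (_ + _ * _).
  by apply: eq_ReIm; rewrite ?cReD ?cImD /= ?addr0 // addrC subrK.
have Ev : Cint c d (fun y => k + al * Complex b y) =
    Cint c d (fun y => k + al * Complex a y) +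
    al * real_complex R (b - a) * real_complex R (d - c).
  rewrite -Cint_cst // -CintD //; apply: eq_Cint => x _.
  rewrite -addrA -mulrDr; congr (_ + _ * _).
  by apply: eq_ReIm; rewrite ?cReD ?cImD /= ?addr0 // addrC subrK.
have E : Complex 0 (c - d) = - (Complex 0 1 * real_complex R (d - c)) :> R[i].
  by apply: eq_ReIm; rewrite ?(cReN, cImN, cReM, cImM) /=; ring.
by rewrite /rint Eh Ev E; ring.
Qed.

(** * Goursat's theorem on rectangles, by bisection *)

Lemma nested_intervals (R : realType) (a b : nat -> R) :
  (forall k, a k <= a k.+1) -> (forall k, b k.+1 <= b k) ->
  (forall k, a k <= b k) -> exists p, forall k, a k <= p <= b k.
Proof.
move=> ainc bdec ab.
have am : {homo a : m n / (m <= n)%N >-> m <= n} by apply: homo_leq => // ? ? ?; exact: le_trans.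
have bm : {homo b : m n / (m <= n)%N >-> n <= m}.
  by apply: homo_leq => // x y z xy yz; exact: le_trans yz xy.
have ub j : ubound (range a) (b j).
  move=> _ [k _ <-]; apply: le_trans (am _ _ (leq_maxl k j)) _.
  by apply: le_trans (ab _) _; exact: bm (leq_maxr k j).
exists (sup (range a)) => k; apply/andP; split.
  by apply: ub_le_sup; [exists (b 0%N); exact: ub|exists k].
by apply: ge_sup; [exists (a 0%N), 0%N|exact: ub].
Qed.

(** The integral is the sum of the integrals over the four quarters, so one of these has at least a
    quarter of its modulus. *)
Lemma goursat_step (R : realType) (phi : R[i] -> R[i]) a b c d :
  a <= b -> c <= d -> cder_on phi a b c d ->
  exists q : R * R * R * R, let: (a', b', c', d') := q in
  [/\ [/\ a <= a', a' <= b' & b' <= b], [/\ c <= c', c' <= d' & d' <= d],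
    b' - a' = (b - a) / 2, d' - c' = (d - c) / 2 &
    cabs (rint phi a b c d) <= 4 * cabs (rint phi a' b' c' d')].
Proof.
move=> ab cd H; pose m := (a + b) / 2; pose n := (c + d) / 2.
have [am mb] : a <= m /\ m <= b by rewrite /m; split; lra.
have [cn nd] : c <= n /\ n <= d by rewrite /n; split; lra.
have sub a' b' c' d' : a <= a' -> b' <= b -> c <= c' -> d' <= d ->
    cder_bd phi a' b' c' d'.
  move=> aa bb cc dd; apply: cder_on_bd => x y /andP[x1 x2] /andP[y1 y2].
  by apply: H; apply/andP; split; [apply: le_trans x1|apply: le_trans bb
    |apply: le_trans y1|apply: le_trans dd].
have E : rint phi a b c d = rint phi a m c n + rint phi a m n d +
   (rint phi m b c n + rint phi m b n d).
  rewrite (@rint_splith _ _ _ m) //; try exact: sub.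
  by congr (_ + _); apply: rint_splitv => //; exact: sub.
have [m1 m2] : m - a = (b - a) / 2 /\ b - m = (b - a) / 2 by rewrite /m; split; lra.
have [n1 n2] : n - c = (d - c) / 2 /\ d - n = (d - c) / 2 by rewrite /n; split; lra.
have B := le_trans (cabsD _ _) (lerD (cabsD _ _) (cabsD _ _)).
have {}B : cabs (rint phi a b c d) <= cabs (rint phi a m c n) +
  cabs (rint phi a m n d) + (cabs (rint phi m b c n) + cabs (rint phi m b n d)).
  by rewrite E; exact: B.
have [h1|h1] := leP (cabs (rint phi a b c d)) (4 * cabs (rint phi a m c n)).
  by exists (a, m, c, n).
have [h2|h2] := leP (cabs (rint phi a b c d)) (4 * cabs (rint phi a m n d)).
  by exists (a, m, n, d).
have [h3|h3] := leP (cabs (rint phi a b c d)) (4 * cabs (rint phi m b c n)).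
  by exists (m, b, c, n).
exists (m, b, n, d); split=> //.
move: h1 h2 h3 B; move: (cabs _) (cabs _) (cabs _) (cabs _) (cabs _).
by clear=> *; lra.
Qed.

Definition rect_ok (R : realType) (phi : R[i] -> R[i]) (q : R * R * R * R) :=
  let: (a, b, c, d) := q in [/\ a <= b, c <= d & cder_on phi a b c d].

Lemma goursat_seq (R : realType) (phi : R[i] -> R[i]) a b c d :
  a <= b -> c <= d -> cder_on phi a b c d ->
  exists s : nat -> R * R * R * R, s 0%N = (a, b, c, d) /\ forall k,
   let: (a1, b1, c1, d1) := s k in let: (a2, b2, c2, d2) := s k.+1 in
   [/\ [/\ a1 <= a2, a2 <= b2 & b2 <= b1], [/\ c1 <= c2, c2 <= d2 & d2 <= d1],
    b2 - a2 = (b1 - a1) / 2, d2 - c2 = (d1 - c1) / 2 &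
    cabs (rint phi a1 b1 c1 d1) <= 4 * cabs (rint phi a2 b2 c2 d2)].
Proof.
move=> ab cd H.
(* The implication from [rect_ok] makes the statement total, so that [choice] yields a function on
   all quadruples, which can be iterated. *)
have stepP (q : R * R * R * R) : exists q' : R * R * R * R, rect_ok phi q ->
   rect_ok phi q' /\
   let: (a1, b1, c1, d1) := q in let: (a2, b2, c2, d2) := q' in
   [/\ [/\ a1 <= a2, a2 <= b2 & b2 <= b1], [/\ c1 <= c2, c2 <= d2 & d2 <= d1],
    b2 - a2 = (b1 - a1) / 2, d2 - c2 = (d1 - c1) / 2 &
    cabs (rint phi a1 b1 c1 d1) <= 4 * cabs (rint phi a2 b2 c2 d2)].
  have [|nok] := pselect (rect_ok phi q); last by exists q => /nok.
  case: q => [[[a1 b1] c1] d1] [h1 h2 h3].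
  have [[[[a2 b2] c2] d2] [[u1 u2 u3] [v1 v2 v3] ? ? ?]] := goursat_step h1 h2 h3.
  exists (a2, b2, c2, d2) => _; split=> //; split=> // x y /andP[x1 x2] /andP[y1 y2].
  by apply: h3; apply/andP; split; [apply: le_trans x1|apply: le_trans u3
    |apply: le_trans y1|apply: le_trans v3].
have [nx nxP] := choice stepP.
exists (fun k => iter k nx (a, b, c, d)); split=> // k.
have ok : rect_ok phi (iter k nx (a, b, c, d)).
  by elim: k => [|k /nxP[]] //=.
by have [_ /=] := nxP _ ok.
Qed.

(** The final estimate uses the linear approximation at the one point (p, q) common to all chosen
    rectangles; the affine part integrates to zero. *)
Lemma goursat (R : realType) (phi : R[i] -> R[i]) a b c d :
  a <= b -> c <= d -> cder_on phi a b c d -> rint phi a b c d = 0.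
Proof.
move=> ab cd H; have [s [s0 sP]] := goursat_seq ab cd H.
pose A k := (s k).1.1.1; pose B k := (s k).1.1.2.
pose C k := (s k).1.2; pose D k := (s k).2.
have st k : [/\ [/\ A k <= A k.+1, A k.+1 <= B k.+1 & B k.+1 <= B k],
    [/\ C k <= C k.+1, C k.+1 <= D k.+1 & D k.+1 <= D k],
    B k.+1 - A k.+1 = (B k - A k) / 2, D k.+1 - C k.+1 = (D k - C k) / 2 &
    cabs (rint phi (A k) (B k) (C k) (D k)) <=
      4 * cabs (rint phi (A k.+1) (B k.+1) (C k.+1) (D k.+1))].
  by move: (sP k); rewrite /A /B /C /D; case: (s k) => [[[? ?] ?] ?];
    case: (s k.+1) => [[[? ?] ?] ?].
have [A0 B0 C0 D0] : [/\ A 0%N = a, B 0%N = b, C 0%N = c & D 0%N = d].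
  by rewrite /A /B /C /D s0.
have AB k : A k <= B k by case: k => [|k]; [rewrite A0 B0|case: (st k) => -[]].
have CD k : C k <= D k by case: k => [|k]; [rewrite C0 D0|case: (st k) => _ []].
have [p pP] : exists p, forall k, A k <= p <= B k.
  by apply: nested_intervals => // k; case: (st k) => -[].
have [q qP] : exists q, forall k, C k <= q <= D k.
  by apply: nested_intervals => // k; case: (st k) => _ [].
have inA k : a <= A k /\ B k <= b.
  elim: k => [|k [h1 h2]]; first by rewrite A0 B0.
  have [[u1 _ u2] _ _ _ _] := st k.
  by split; [apply: le_trans u1|apply: le_trans h2].
have inC k : c <= C k /\ D k <= d.
  elim: k => [|k [h1 h2]]; first by rewrite C0 D0.
  have [_ [u1 _ u2] _ _ _] := st k.
  by split; [apply: le_trans u1|apply: le_trans h2].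
pose w := b - a + (d - c).
have wk k : B k - A k + (D k - C k) = w / 2 ^+ k.
  elim: k => [|k IH]; first by rewrite A0 B0 C0 D0 expr0 divr1.
  have [_ _ -> -> _] := st k.
  by rewrite -mulrDl IH exprS invfM mulrA mulrAC.
have Ik k : cabs (rint phi a b c d) <=
    4 ^+ k * cabs (rint phi (A k) (B k) (C k) (D k)).
  elim: k => [|k IH]; first by rewrite A0 B0 C0 D0 expr0 mul1r.
  have [_ _ _ _ h] := st k.
  by rewrite (le_trans IH) // exprSr -mulrA ler_wpM2l.
have w0 : 0 <= w by rewrite /w; lra.
have [al alP] : cderivable phi (Complex p q).
  by apply: H; [move: (pP 0%N)|move: (qP 0%N)]; rewrite ?A0 ?B0 ?C0 ?D0.
apply/eqP; rewrite -cabs_eq0 eq_le cabs_ge0 andbT.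
apply/ler_addgt0Pr => e e0; rewrite add0r.
(* At level k the remainder contributes at most 4 eps (w / 2^k)^2, and the factor 4^k of the
   bisections cancels the powers of 2. So 4 w^2 eps <= e suffices; the [+ 1] covers w = 0. *)
have eps0 : 0 < e / (4 * w ^+ 2 + 1).
  by rewrite divr_gt0 // ltr_wpDl // mulr_ge0 // sqr_ge0.
have [del [del0 delP]] := alP _ eps0.
have [k kP] : exists k, w / 2 ^+ k < del.
  exists (Num.bound (w / del)); rewrite ltr_pdivrMr ?exprn_gt0 // mulrC.
  rewrite -ltr_pdivrMr // (lt_trans (archi_boundP _)) ?divr_ge0 ?(ltW del0) //.
  by rewrite -natrX ltr_nat ltn_expl.
(* [h0 + - al * z] is the negative of the linearization of [phi] at (p, q): adding it leaves the
   integral unchanged and turns the integrand into the remainder. *)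
pose h0 := - phi (Complex p q) + al * Complex p q.
have Hk : cder_bd phi (A k) (B k) (C k) (D k).
  apply: cder_on_bd => x y /andP[x1 x2] /andP[y1 y2].
  have [[a1 a2] [c1 c2]] := (inA k, inC k).
  by apply: H; apply/andP; split; [apply: le_trans x1|apply: le_trans a2
    |apply: le_trans y1|apply: le_trans c2].
have Ha : cder_bd (fun z => h0 + - al * z) (A k) (B k) (C k) (D k).
  by move=> x y _ _ _; exact: cderivable_affine.
have Er : rint phi (A k) (B k) (C k) (D k) =
    rint (fun z => phi z + (h0 + - al * z)) (A k) (B k) (C k) (D k).
  by rewrite rintD // rint_affine // addr0.
have rb : cabs (rint phi (A k) (B k) (C k) (D k)) <=
    4 * (e / (4 * w ^+ 2 + 1) * (w / 2 ^+ k)) * (w / 2 ^+ k).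
  rewrite Er -(wk k); apply: cabs_rint_le => //.
    by move=> x y xab ycd bd; apply: cderivableD; [exact: Hk|exact: Ha].
  move=> x y /andP[x1 x2] /andP[y1 y2] _.
  have hb : cabs (Complex x y - Complex p q) <= B k - A k + (D k - C k).
    apply: le_trans (cabs_le_ReIm _) _; rewrite cReD cImD cReN cImN /=.
    have [/andP[p1 p2] /andP[q1 q2]] := (pP k, qP k).
    by rewrite lerD // ler_norml; apply/andP; split;
      move: x1 x2 y1 y2 p1 p2 q1 q2; clear; lra.
  have := delP (Complex x y - Complex p q).
  rewrite (le_lt_trans hb) ?wk // => /(_ isT).
  rewrite [X in phi X]addrC subrK => /le_trans; rewrite /h0.
  have -> : phi (Complex x y) + (- phi (Complex p q) + al * Complex p q
      + - al * Complex x y) = phi (Complex x y) - phi (Complex p q)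
      - al * (Complex x y - Complex p q) by ring.
  by apply; rewrite ler_wpM2l ?(ltW eps0) // -wk.
apply: le_trans (Ik k) _; apply: le_trans (ler_wpM2l _ rb) _; first exact: exprn_ge0.
rewrite [leLHS](_ : _ = 4 * w ^+ 2 / (4 * w ^+ 2 + 1) * e); last first.
  rewrite (_ : 4 = 2 ^+ 2 :> R); last by rewrite -natrX.
  rewrite -exprM mulnC exprM; field; rewrite expf_neq0 //=.
  by rewrite gt_eqF // ltr_wpDl // mulr_ge0 // sqr_ge0.
rewrite ler_piMl ?(ltW e0) // ler_pdivrMr ?mul1r ?lerDl //.
by rewrite ltr_wpDl // mulr_ge0 // sqr_ge0.
Qed.

(** * Cauchy's formula on a square *)

(** The region between the two contours is cut into four rectangles that avoid (p, q), and Goursat's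
    theorem kills each of them. *)
Lemma rint_hole (R : realType) (phi : R[i] -> R[i]) a b c d p q e : 0 < e ->
  a <= p - e -> p + e <= b -> c <= q - e -> q + e <= d ->
  (forall x y, a <= x <= b -> c <= y <= d -> (x != p) || (y != q) ->
    cderivable phi (Complex x y)) ->
  rint phi a b c d = rint phi (p - e) (p + e) (q - e) (q + e).
Proof.
move=> e0 ap pb cq qd H.
have bd a' b' c' d' : a <= a' -> a' < p -> p < b' -> b' <= b ->
    c <= c' -> c' < q -> q < d' -> d' <= d -> cder_bd phi a' b' c' d'.
  move=> h1 h2 h3 h4 h5 h6 h7 h8 x y /andP[x1 x2] /andP[y1 y2] B.
  apply: H; [apply/andP; split; lra|apply/andP; split; lra|].
  case: B => ->; first by rewrite lt_eqF.
  - by rewrite gt_eqF.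
  - by rewrite orbC lt_eqF.
  - by rewrite orbC gt_eqF.
have on a' b' c' d' : a <= a' -> b' <= b -> c <= c' -> d' <= d ->
    [\/ b' < p, p < a', d' < q | q < c'] -> cder_on phi a' b' c' d'.
  move=> h1 h2 h3 h4 B x y /andP[x1 x2] /andP[y1 y2].
  apply: H; [apply/andP; split; lra|apply/andP; split; lra|].
  case: B => h.
  - by rewrite lt_eqF // (le_lt_trans x2).
  - by rewrite gt_eqF // (lt_le_trans h).
  - by rewrite orbC lt_eqF // (le_lt_trans y2).
  - by rewrite orbC gt_eqF // (lt_le_trans h).
have L1 : cder_on phi a (p - e) c d by apply: on; try lra; apply: Or41; lra.
have L2 : cder_on phi (p + e) b c d by apply: on; try lra; apply: Or42; lra.
have L3 : cder_on phi (p - e) (p + e) c (q - e) by apply: on; try lra; apply: Or43; lra.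
have L4 : cder_on phi (p - e) (p + e) (q + e) d by apply: on; try lra; apply: Or44; lra.
have B1 : cder_bd phi (p - e) b c d by apply: bd; lra.
have B2 : cder_bd phi (p - e) (p + e) c d by apply: bd; lra.
have B3 : cder_bd phi (p - e) (p + e) (q - e) d by apply: bd; lra.
have B4 : cder_bd phi (p - e) (p + e) (q - e) (q + e) by apply: bd; lra.
have [u1 u2 u3 u4] : [/\ p - e <= b, p - e <= p + e, q - e <= d & q - e <= q + e].
  by split; lra.
have cd : c <= d by lra.
rewrite (@rint_splith _ _ a (p - e)) //; last exact: cder_on_bd.
rewrite (goursat _ _ L1) // add0r.
rewrite (@rint_splith _ _ (p - e) (p + e)) //; last exact: cder_on_bd.
rewrite (goursat _ _ L2) // addr0.
rewrite (@rint_splitv _ _ _ _ c (q - e)) //; last exact: cder_on_bd.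
rewrite (goursat _ _ L3) // add0r.
rewrite (@rint_splitv _ _ _ _ (q - e) (q + e)) //; last exact: cder_on_bd.
by rewrite (goursat _ _ L4) // addr0.
Qed.

Lemma cRe_inv (R : realType) (x y : R) :
  complex.Re ((Complex x y)^-1) = x / (x ^+ 2 + y ^+ 2).
Proof. by []. Qed.

Lemma cIm_inv (R : realType) (x y : R) :
  complex.Im ((Complex x y)^-1) = - y / (x ^+ 2 + y ^+ 2).
Proof. by rewrite /= mulNr. Qed.

Lemma Complex_neq0 (R : realType) (x y : R) :
  (Complex x y != 0) = (x != 0) || (y != 0).
Proof. by rewrite eq_complex /= negb_and. Qed.

Lemma cderivable_inv0 (R : realType) (z : R[i]) : z != 0 ->
  cderivable (fun w => w^-1) z.
Proof.
move=> z0; have -> : (fun w => w^-1) = (fun w => (w - 0)^-1) :> (R[i] -> R[i]).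
  by apply/funext => w; rewrite subr0.
exact: cderivable_inv.
Qed.

Lemma Rintegral_ge_cst (R : realType) (a b M : R) (f : R -> R) : a <= b ->
  lebesgue_measure.-integrable `[a, b] (EFin \o f) ->
  (forall x, a <= x <= b -> M <= f x) ->
  M * (b - a) <= \int[lebesgue_measure]_(x in `[a, b]) f x.
Proof.
move=> ab fi fM; rewrite -Rintegral_itv_cst //.
by apply: le_Rintegral => //; exact: integrable_itv_cst.
Qed.

(* A lower bound suffices below: the value [2 pi i] cancels out of the Taylor
   coefficients, only its being nonzero matters. *)
Lemma residue_square (R : realType) (e : R) : 0 < e ->
  4 <= complex.Im (rint (fun z : R[i] => z^-1) (- e) e (- e) e).
Proof.
move=> e0; have ne : - e <= e by lra.
have bd : cder_bd (fun z : R[i] => z^-1) (- e) e (- e) e.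
  move=> x y _ _ B; apply: cderivable_inv0; rewrite Complex_neq0.
  by case: B => ->; rewrite ?oppr_eq0 (gt_eqF e0) ?orbT.
have [c1 c2 c3 c4] := cder_bd_Ccont ne ne bd.
(* On every side x^2 + e^2 <= 2 e^2, so each of the four sides, of length 2 e, contributes at least
   1 to the imaginary part. *)
have K (x : R) : - e <= x <= e -> (2 * e)^-1 <= e / (x ^+ 2 + e ^+ 2).
  move=> /andP[x1 x2]; have x2e2 : x ^+ 2 <= e ^+ 2.
    rewrite -subr_ge0 subr_sqr mulr_ge0 //; lra.
  have ee : 0 < e ^+ 2 by rewrite exprn_gt0.
  rewrite ler_pdivlMr ?ltr_wpDl ?sqr_ge0 // ler_pdivrMl ?mulr_gt0 //.
  by rewrite -mulrA -expr2; lra.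
have one : (2 * e)^-1 * (e - - e) = 1 by rewrite opprK; field; rewrite gt_eqF.
rewrite /rint cImD cImD cImN cImM cReD cReN /= !mul0r !mul1r !add0r.
have I1 : 1 <= complex.Im (Cint (- e) e (fun x => (Complex x (- e))^-1)).
  rewrite -[X in X <= _]one; apply: Rintegral_ge_cst => //; first exact: Ccont_intIm.
  by move=> x /K; rewrite cIm_inv opprK sqrrN.
have I2 : 1 <= - complex.Im (Cint (- e) e (fun x => (Complex x e)^-1)).
  rewrite -mulN1r -RintegralZl //; last exact: Ccont_intIm.
  rewrite -[X in X <= _]one; apply: Rintegral_ge_cst => //.
    by apply: Ccont_integrableZ; exact: Ccont_intIm.
  by move=> x /K; rewrite cIm_inv mulN1r mulNr opprK.
have I3 : 1 <= complex.Re (Cint (- e) e (fun y => (Complex e y)^-1)).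
  rewrite -[X in X <= _]one; apply: Rintegral_ge_cst => //; first exact: Ccont_intRe.
  by move=> x /K; rewrite cRe_inv addrC.
have I4 : 1 <= - complex.Re (Cint (- e) e (fun y => (Complex (- e) y)^-1)).
  rewrite -mulN1r -RintegralZl //; last exact: Ccont_intRe.
  rewrite -[X in X <= _]one; apply: Rintegral_ge_cst => //.
    by apply: Ccont_integrableZ; exact: Ccont_intRe.
  by move=> x /K; rewrite cRe_inv mulN1r mulNr opprK sqrrN addrC.
by move: I1 I2 I3 I4 => /=; lra.
Qed.

Lemma residue_shift (R : realType) (e p q : R) : 0 < e ->
  rint (fun z : R[i] => (z - Complex p q)^-1) (p - e) (p + e) (q - e) (q + e) =
  rint (fun z : R[i] => z^-1) (- e) e (- e) e.
Proof.
move=> e0; have ne : - e <= e by lra.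
have bd : cder_bd (fun z : R[i] => (z - Complex p q)^-1) (- e + p) (e + p) (- e + q) (e + q).
  move=> x y _ _ B; apply: cderivable_inv; rewrite eq_complex /= negb_and.
  case: B => ->; apply/orP; [left|left|right|right];
   by rewrite -subr_eq0 addrK ?oppr_eq0 gt_eqF.
rewrite ![_ - e]addrC ![_ + e]addrC /rint.
have [|| c1 c2 c3 c4] := cder_bd_Ccont _ _ bd; rewrite ?lerD2r //.
rewrite !Cint_shift //.
congr (_ - _ + _ * (_ - _)); apply: eq_Cint => x _; congr (_^-1);
 by apply: eq_ReIm; rewrite ?cReD ?cImD ?cReN ?cImN /= ?addrK ?subrr.
Qed.

(** The integrand splits into (phi w - phi z) / (w - z), which integrates to 0, and phi z / (w - z).
    For the latter the contour shrinks to the square of half side s / 4 around z, which fits because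
    |p|, |q| <= s / 2. The remaining factor is then the same for all z. *)
Lemma cauchy_square (R : realType) (phi : R[i] -> R[i]) (s p q : R) : 0 < s ->
  cder_on phi (- s) s (- s) s -> `|p| <= s / 2 -> `|q| <= s / 2 ->
  rint (fun w => phi w * (w - Complex p q)^-1) (- s) s (- s) s =
  phi (Complex p q) * rint (fun z => z^-1) (- (s / 4)) (s / 4) (- (s / 4)) (s / 4).
Proof.
move=> s0 H pP qP; set z := Complex p q.
have [p1 p2] : - (s / 2) <= p /\ p <= s / 2 by move: pP; rewrite ler_norml => /andP[].
have [q1 q2] : - (s / 2) <= q /\ q <= s / 2 by move: qP; rewrite ler_norml => /andP[].
have D1 x y : (x != p) || (y != q) -> cderivable (fun w => (w - z)^-1) (Complex x y).
  by move=> xy; apply: cderivable_inv; rewrite eq_complex negb_and.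
have D2 x y : - s <= x <= s -> - s <= y <= s -> (x != p) || (y != q) ->
    cderivable (fun w => (phi w - phi z) * (w - z)^-1) (Complex x y).
  move=> xs ys xy; apply: cderivableM; last exact: D1.
  by apply: cderivableD; [exact: H|exact: cderivable_cst].
have bdne x y : [\/ x = - s, x = s, y = - s | y = s] -> (x != p) || (y != q).
  case=> ->; apply/orP; [left|left|right|right];
    by [rewrite lt_eqF //; lra|rewrite gt_eqF //; lra].
(* The difference quotient is bounded near [z], so shrinking the contour to [z]
   gives [0]. *)
have Z : rint (fun w => (phi w - phi z) * (w - z)^-1) (- s) s (- s) s = 0.
  apply/eqP; rewrite -cabs_eq0 eq_le cabs_ge0 andbT.
  apply/ler_addgt0Pr => eps eps0; rewrite add0r.
  have [al /(_ 1 ltr01)[d [d0 dP]]] : cderivable phi z.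
    by apply: H; apply/andP; split; lra.
  have a1 : 0 < 1 + cabs al by rewrite ltr_pwDl // cabs_ge0.
  (* [d / 4] keeps the small square within the range of the differential estimate, [s / 2] keeps it
     inside the large one, and the last bound matches 4 (1 + |al|) 4 e <= eps. *)
  pose e := Num.min (d / 4) (Num.min (s / 2) (eps / (16 * (1 + cabs al)))).
  have e0 : 0 < e by rewrite !lt_min !divr_gt0 // mulr_gt0.
  have [e1 e2 e3] : [/\ e <= d / 4, e <= s / 2 & e <= eps / (16 * (1 + cabs al))].
    by split; rewrite /e !ge_min lexx ?orbT.
  rewrite (@rint_hole _ _ _ _ _ _ p q e) //; try lra.
  have := @cabs_rint_le _ (fun w => (phi w - phi z) * (w - z)^-1)
    (p - e) (p + e) (q - e) (q + e) (1 + cabs al).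
  have B x y : [\/ x = p - e, x = p + e, y = q - e | y = q + e] ->
      (x != p) || (y != q).
    case=> ->; apply/orP; [left|left|right|right];
      by [rewrite lt_eqF //; lra|rewrite gt_eqF //; lra].
  move=> /(_ _ _ _ _)/le_trans; apply; try lra.
  - move=> x y /andP[x1 x2] /andP[y1 y2] xy; apply: D2; last exact: B.
      by apply/andP; split; lra.
    by apply/andP; split; lra.
  - move=> x y /andP[x1 x2] /andP[y1 y2] /B xy.
    have zn : 0 < cabs (Complex x y - z).
      by rewrite lt_neqAle eq_sym cabs_eq0 subr_eq0 eq_complex negb_and xy cabs_ge0.
    rewrite cabsM cabsV ler_pdivrMr //.
    have h1 : cabs (Complex x y - z) < d.
      apply: le_lt_trans (cabs_le_ReIm _) _; rewrite cReD cImD cReN cImN /=.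
      have xe : `|x - p| <= e by rewrite ler_norml; apply/andP; split; lra.
      have ye : `|y - q| <= e by rewrite ler_norml; apply/andP; split; lra.
      by lra.
    have := dP _ h1; rewrite [X in phi X]addrC subrK mul1r => h2.
    rewrite -(subrK (al * (Complex x y - z)) (_ - _)) (le_trans (cabsD _ _)) //.
    by rewrite cabsM mulrDl mul1r lerD2r.
  - rewrite (_ : _ - _ + _ = 4 * e); last by ring.
    by move: e3; rewrite ler_pdivlMr ?mulr_gt0 //; lra.
have bdphi : cder_bd phi (- s) s (- s) s by exact: cder_on_bd.
have bdi : cder_bd (fun w => (w - z)^-1) (- s) s (- s) s.
  by move=> x y xs ys /bdne; exact: D1.
have ns : - s <= s by lra.
rewrite (_ : rint _ _ _ _ _ =
  rint (fun w => (phi w - phi z) * (w - z)^-1 + phi z * (w - z)^-1) (- s) s (- s) s); last first.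
  by apply: eq_rint => // x y _ _ _; ring.
rewrite rintD //; last 2 first.
- by move=> x y xs ys /bdne; exact: D2.
- by move=> x y xs ys b; apply: cderivableM; [exact: cderivable_cst|exact: bdi].
rewrite Z add0r rintZ //; congr (_ * _).
have s4 : 0 < s / 4 by lra.
have [v1 v2 v3 v4] : [/\ - s <= p - s / 4, p + s / 4 <= s,
  - s <= q - s / 4 & q + s / 4 <= s] by split; lra.
rewrite (@rint_hole _ _ _ _ _ _ p q (s / 4)) //; first exact: residue_shift.
by move=> x y _ _; exact: D1.
Qed.

(** * Taylor expansion of order two, from Cauchy's formula *)

Lemma cauchy_kernel_expansion (K : fieldType) (f w z : K) :
  w != 0 -> w - z != 0 ->
  f * (w - z)^-1 = f * w^-1 ^+ 1 + z * (f * w^-1 ^+ 2) + z ^+ 2 * (f * w^-1 ^+ 3)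
    + z ^+ 3 * (f * w^-1 ^+ 3 * (w - z)^-1).
Proof. by move=> w0 wz0; field; rewrite w0 wz0. Qed.

(** The finite geometric expansion of 1 / (w - z) in powers of z / w, with its exact remainder, is
    integrated term by term along the boundary of the square. Dividing by the residue integral [c]
    gives the coefficients. *)
Lemma taylor3_square (R : realType) (phi : R[i] -> R[i]) (s M : R) : 0 < s ->
  cder_on phi (- s) s (- s) s ->
  (forall x y, - s <= x <= s -> - s <= y <= s -> cabs (phi (Complex x y)) <= M) ->
  exists c0 c1 c2 : R[i], forall p q, `|p| <= s / 2 -> `|q| <= s / 2 ->
    cabs (phi (Complex p q) - (c0 + c1 * Complex p q + c2 * Complex p q ^+ 2))
    <= 8 * M / s ^+ 3 * cabs (Complex p q) ^+ 3.
Proof.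
move=> s0 H B.
have M0 : 0 <= M.
  by apply: le_trans (cabs_ge0 _) (B 0 0 _ _); apply/andP; split; lra.
have ns : - s <= s by lra.
pose c := rint (fun z : R[i] => z^-1) (- (s / 4)) (s / 4) (- (s / 4)) (s / 4).
have c4 : 4 <= cabs c.
  by apply: le_trans (le_trans (ler_norm _) (ler_normIm _)); apply: residue_square; lra.
have c0 : c != 0 by rewrite -cabs_eq0 gt_eqF // (lt_le_trans _ c4).
have bd0 x y : [\/ x = - s, x = s, y = - s | y = s] -> s <= cabs (Complex x y).
  by case=> ->; [have := ler_normRe (Complex (- s) y)|have := ler_normRe (Complex s y)
   |have := ler_normIm (Complex x (- s))|have := ler_normIm (Complex x s)];
  rewrite /= ?normrN gtr0_norm.
have nz x y : [\/ x = - s, x = s, y = - s | y = s] -> Complex x y != 0.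
  by move=> /bd0; rewrite -cabs_eq0 => h; rewrite gt_eqF // (lt_le_trans s0).
have Di k : cder_bd (fun w => phi w * (w^-1) ^+ k) (- s) s (- s) s.
  move=> x y xs ys /nz b; apply: cderivableM; first exact: H.
  elim: k => [|k IH]; first exact: cderivable_cst.
  under eq_fun do rewrite exprS.
  by apply: cderivableM => //; exact: cderivable_inv0.
pose A k := rint (fun w => phi w * (w^-1) ^+ k) (- s) s (- s) s.
exists (A 1%N / c), (A 2%N / c), (A 3%N / c) => p q pP qP; set z := Complex p q.
have [p1 p2] : - (s / 2) <= p /\ p <= s / 2 by move: pP; rewrite ler_norml => /andP[].
have [q1 q2] : - (s / 2) <= q /\ q <= s / 2 by move: qP; rewrite ler_norml => /andP[].
have bdz x y : [\/ x = - s, x = s, y = - s | y = s] -> s / 2 <= cabs (Complex x y - z).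
  by case=> ->; [have := ler_normRe (Complex (- s) y - z)
   |have := ler_normRe (Complex s y - z)
   |have := ler_normIm (Complex x (- s) - z)|have := ler_normIm (Complex x s - z)];
  rewrite ?cReD ?cReN ?cImD ?cImN /=; apply: le_trans; rewrite ler_normr; lra.
have nzz x y : [\/ x = - s, x = s, y = - s | y = s] -> Complex x y - z != 0.
  by move=> /bdz; rewrite -cabs_eq0 => h; rewrite gt_eqF //; lra.
pose rem w := phi w * (w^-1) ^+ 3 * (w - z)^-1.
have Dr : cder_bd rem (- s) s (- s) s.
  move=> x y xs ys b; apply: cderivableM; first exact: Di.
  by apply: cderivable_inv; rewrite -subr_eq0; exact: nzz.
have DZ k l : cder_bd (fun w => l * (phi w * (w^-1) ^+ k)) (- s) s (- s) s.
  move=> x y xs ys b; apply: cderivableM; first exact: cderivable_cst.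
  exact: Di.
have E : phi z * c = A 1%N + z * A 2%N + z ^+ 2 * A 3%N + z ^+ 3 * rint rem (- s) s (- s) s.
  rewrite -cauchy_square // -!rintZ // -!rintD //; last 3 first.
  - move=> x y xs ys b; apply: cderivableD; last exact: DZ.
    by apply: cderivableD; [exact: Di|exact: DZ].
  - move=> x y xs ys b; apply: cderivableM; first exact: cderivable_cst.
    exact: Dr.
  - by move=> x y xs ys b; apply: cderivableD; [exact: Di|exact: DZ].
  apply: eq_rint => // x y _ _ b; rewrite /rem.
  by apply: cauchy_kernel_expansion; [exact: nz|exact: nzz].
(* On the contour |w| >= s and |w - z| >= s / 2, so |rem| <= 2 M / s^4, and the contour bound
   multiplies this by 16 s. Division by |c| >= 4 turns 32 into the 8 of the statement. *)
have rb : cabs (rint rem (- s) s (- s) s) <= 32 * M / s ^+ 3.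
  have -> : 32 * M / s ^+ 3 = 4 * (M * s^-1 ^+ 3 * (s / 2)^-1) * (s - - s + (s - - s)).
    by field; rewrite gt_eqF.
  apply: cabs_rint_le => // x y xs ys b; rewrite /rem 2!cabsM cabsX 2!cabsV.
  have h0 : 0 < s / 2 by lra.
  have i1 : (cabs (Complex x y))^-1 <= s^-1.
    by rewrite lef_pV2 ?posrE ?bd0 // (lt_le_trans s0) ?bd0.
  have i2 : (cabs (Complex x y - z))^-1 <= (s / 2)^-1.
    by rewrite lef_pV2 ?posrE ?bdz // (lt_le_trans h0) ?bdz.
  have cg := @cabs_ge0 R.
  apply: ler_pM => //; rewrite ?mulr_ge0 ?exprn_ge0 ?invr_ge0 //.
  apply: ler_pM => //; rewrite ?exprn_ge0 ?invr_ge0 //; first exact: B.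
  by apply: lerXn2r; rewrite ?nnegrE ?invr_ge0 // ltW.
have -> : phi z - (A 1%N / c + A 2%N / c * z + A 3%N / c * z ^+ 2) =
    z ^+ 3 * rint rem (- s) s (- s) s / c.
  by apply: (mulIf c0); rewrite mulrBl E; field.
rewrite [cabs (_ / c)]cabsM cabsV [cabs (_ * _)]cabsM cabsX -mulrA mulrC ler_wpM2r ?exprn_ge0 ?cabs_ge0 //.
rewrite ler_pdivrMr ?(lt_le_trans _ c4) // (le_trans rb) //.
have : 0 <= 8 * M / s ^+ 3 by apply: divr_ge0; [exact: mulr_ge0|apply: exprn_ge0; exact: ltW].
rewrite (_ : 32 * M / s ^+ 3 = 8 * M / s ^+ 3 * 4); last by ring.
by move=> h; rewrite ler_wpM2l.
Qed.

(** * Euclidean vectors and the complex strip *)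

Lemma dotvC (R : realType) n (u v : 'rV[R]_n) : dotv u v = dotv v u.
Proof. by apply: eq_bigr => i _; rewrite mulrC. Qed.

Lemma dotvDl (R : realType) n (u v w : 'rV[R]_n) :
  dotv (u + v) w = dotv u w + dotv v w.
Proof. by rewrite -big_split; apply: eq_bigr => i _; rewrite mxE mulrDl. Qed.

Lemma dotvZl (R : realType) n k (u v : 'rV[R]_n) : dotv (k *: u) v = k * dotv u v.
Proof. by rewrite mulr_sumr; apply: eq_bigr => i _; rewrite mxE mulrA. Qed.

Lemma dotvNl (R : realType) n (u v : 'rV[R]_n) : dotv (- u) v = - dotv u v.
Proof. by rewrite -scaleN1r dotvZl mulN1r. Qed.

Lemma dotvDr (R : realType) n (u v w : 'rV[R]_n) :
  dotv u (v + w) = dotv u v + dotv u w.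
Proof. by rewrite dotvC dotvDl !(dotvC u). Qed.

Lemma dotvZr (R : realType) n k (u v : 'rV[R]_n) : dotv u (k *: v) = k * dotv u v.
Proof. by rewrite dotvC dotvZl dotvC. Qed.

Lemma dotvNr (R : realType) n (u v : 'rV[R]_n) : dotv u (- v) = - dotv u v.
Proof. by rewrite dotvC dotvNl dotvC. Qed.

Lemma dotv_sumr (R : realType) n (I : Type) (s : seq I) (u : 'rV[R]_n) (v : I -> 'rV[R]_n) :
  dotv u (\sum_(i <- s) v i) = \sum_(i <- s) dotv u (v i).
Proof.
elim: s => [|i s IH]; rewrite ?big_nil ?big_cons ?dotvDr ?IH //.
by rewrite -(scale0r (0 : 'rV[R]_n)) dotvZr mul0r.
Qed.

Lemma dotv_ge0 (R : realType) n (u : 'rV[R]_n) : 0 <= dotv u u.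
Proof. by apply: sumr_ge0 => i _; rewrite -expr2 sqr_ge0. Qed.

Lemma enorm_ge0 (R : realType) n (u : 'rV[R]_n) : 0 <= enorm u.
Proof. exact: sqrtr_ge0. Qed.

Lemma enorm_sqr (R : realType) n (u : 'rV[R]_n) : enorm u ^+ 2 = dotv u u.
Proof. by rewrite sqr_sqrtr // dotv_ge0. Qed.

Lemma enormZ (R : realType) n k (u : 'rV[R]_n) : enorm (k *: u) = `|k| * enorm u.
Proof. by rewrite /enorm dotvZl dotvZr mulrA -expr2 sqrtrM ?sqr_ge0 // sqrtr_sqr. Qed.

Lemma enormN (R : realType) n (u : 'rV[R]_n) : enorm (- u) = enorm u.
Proof. by rewrite -scaleN1r enormZ normrN1 mul1r. Qed.

Lemma dotv_eq0 (R : realType) n (u : 'rV[R]_n) : dotv u u = 0 -> u = 0.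
Proof.
move=> /eqP; rewrite psumr_eq0 => [/allP u0|i _]; last by rewrite -expr2 sqr_ge0.
apply/rowP => i; rewrite mxE; have := u0 i; rewrite mem_index_enum -expr2 => /(_ isT).
by rewrite sqrf_eq0 => /eqP.
Qed.

Lemma ler_normr_dotv (R : realType) n (u v : 'rV[R]_n) :
  `|dotv u v| <= enorm u * enorm v.
Proof.
have [v0|v0] := eqVneq (dotv v v) 0.
  rewrite (dotv_eq0 v0) -(scale0r (0 : 'rV[R]_n)) dotvZr mul0r normr0.
  by rewrite mulr_ge0 ?enorm_ge0.
have vp : 0 < dotv v v by rewrite lt_neqAle eq_sym v0 dotv_ge0.
rewrite -sqrtr_sqr /enorm -sqrtrM ?dotv_ge0 // ler_wsqrtr //.
have := dotv_ge0 (dotv v v *: u - dotv u v *: v).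
rewrite !(dotvDl, dotvDr, dotvNl, dotvNr, dotvZl, dotvZr) (dotvC v u).
rewrite (_ : _ + _ = dotv v v * (dotv u u * dotv v v - dotv u v ^+ 2)); last by ring.
by rewrite pmulr_rge0 // subr_ge0.
Qed.

Lemma enorm_triangle (R : realType) n (u v : 'rV[R]_n) :
  enorm (u + v) <= enorm u + enorm v.
Proof.
rewrite -ler_sqr ?nnegrE ?addr_ge0 ?enorm_ge0 // enorm_sqr sqrrD !enorm_sqr.
rewrite !(dotvDl, dotvDr) (dotvC v u).
have := le_trans (ler_norm _) (ler_normr_dotv u v).
by rewrite mulr2n; lra.
Qed.

Lemma ler_coord_enorm (R : realType) n (u : 'rV[R]_n) i : `|u 0 i| <= enorm u.
Proof.
rewrite -sqrtr_sqr ler_wsqrtr // /dotv (bigD1 i) //= -expr2 lerDl.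
by apply: sumr_ge0 => j _; rewrite -expr2 sqr_ge0.
Qed.

(** The topology of row vectors comes from the sup norm, whereas the algorithm is Euclidean; this
    and the next lemmas pass from one norm to the other. *)
Lemma ler_coord_norm (R : realType) n (u : 'rV[R]_n) i : `|u 0 i| <= `|u|.
Proof.
rewrite /Num.norm /= mx_normrE.
by apply: (le_bigmax_cond _ (fun i => `|u i.1 i.2|) (erefl true : (fun=> true) (0 : 'I_1, i))).
Qed.

Lemma ler_norm_coord (R : realType) n (u : 'rV[R]_n) (e : R) : 0 <= e ->
  (forall i, `|u 0 i| <= e) -> `|u| <= e.
Proof.
move=> e0 ue; rewrite /Num.norm /= mx_normrE; apply: bigmax_le => // -[i j] _ /=.
by rewrite (ord1 i).
Qed.

Lemma ler_enorm_norm (R : realType) n (u : 'rV[R]_n) : enorm u <= n%:R * `|u|.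
Proof.
rewrite -ler_sqr ?nnegrE ?mulr_ge0 ?enorm_ge0 // enorm_sqr.
have nn : (n%:R : R) <= n%:R ^+ 2.
  by rewrite -natrX ler_nat; case: n {u} => // n; rewrite expnS leq_pmulr // expn_gt0.
apply: (@le_trans _ _ (n%:R * `|u| ^+ 2)); last first.
  by rewrite exprMn ler_wpM2r // sqr_ge0.
rewrite mulr_natl -[X in _ *+ X]card_ord -sumr_const ler_sum // => i _.
by rewrite -expr2 -real_normK ?num_real // lerXn2r ?nnegrE // ler_coord_norm.
Qed.

Lemma norm_le_enorm (R : realType) n (u : 'rV[R]_n) : `|u| <= enorm u.
Proof. by apply: ler_norm_coord; [exact: enorm_ge0|exact: ler_coord_enorm]. Qed.

Lemma openP_norm (R : realType) n (D : set 'rV[R]_n) x : open D -> D x ->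
  exists e, 0 < e /\ forall y, `|y - x| < e -> D y.
Proof.
move=> oD Dx; have /nbhs_ballP[e /= e0 eD] := open_nbhs_nbhs (conj oD Dx).
by exists e; split=> // y yx; apply: eD; rewrite -ball_normE /= distrC.
Qed.

Lemma cnorm_cpt (R : realType) n (x y : 'rV[R]_n) : cnorm (cpt x y) <= enorm x + enorm y.
Proof.
rewrite -ler_sqr ?nnegrE ?addr_ge0 ?enorm_ge0 ?sqrtr_ge0 // sqr_sqrtr; last first.
  by apply: sumr_ge0 => i _; rewrite sqr_ge0.
apply: (@le_trans _ _ (dotv x x + dotv y y)); last first.
  rewrite sqrrD !enorm_sqr addrAC lerDl pmulrn_lge0 //.
  by rewrite mulr_ge0 ?enorm_ge0.
rewrite -big_split ler_sum // => i _; rewrite mxE sqr_sqrtr ?addr_ge0 ?sqr_ge0 //=.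
Qed.

Lemma cptD (R : realType) n (x y x' y' : 'rV[R]_n) :
  cpt (x + x') (y + y') = cpt x y + cpt x' y'.
Proof. by apply/rowP => i; rewrite !mxE. Qed.

(** Continuity in the pair of real and imaginary parts, for the sup norm: the form that compactness
    and measurability arguments use. *)
Lemma cdifferentiable_continuous (R : realType) n (F : 'rV[R[i]]_n -> R[i]) x y :
  cdifferentiable_at F (cpt x y) -> forall eps, 0 < eps -> exists d, 0 < d /\
  forall x' y', `|x' - x| < d -> `|y' - y| < d ->
    cabs (F (cpt x' y') - F (cpt x y)) <= eps.
Proof.
move=> [a /(_ 1 ltr01)[d [d0 dP]]] eps eps0.
pose A := \sum_j cabs (a 0 j).
have A0 : 0 <= A by apply: sumr_ge0 => j _; exact: cabs_ge0.
have n0 : 0 <= (n%:R : R) by [].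
pose e := Num.min d (eps / (A + 1)) / (2 * n%:R + 1).
have m0 : 0 < Num.min d (eps / (A + 1)) by rewrite lt_min d0 divr_gt0 // ltr_wpDl.
have e0 : 0 < e by rewrite divr_gt0 // ltr_wpDl // mulr_ge0.
exists e; split=> // x' y' xe ye.
pose h := cpt (x' - x) (y' - y).
have hE : cpt x y + h = cpt x' y' by rewrite -cptD !(addrC _ (_ - _)) !subrK.
have hn : cnorm h < Num.min d (eps / (A + 1)).
  apply: le_lt_trans (cnorm_cpt _ _) _.
  apply: le_lt_trans (lerD (ler_enorm_norm _) (ler_enorm_norm _)) _.
  apply: (@le_lt_trans _ _ (2 * n%:R * e)).
    rewrite mulr2n mulrDl mul1r mulrDl lerD // ler_wpM2l // ltW //.
  rewrite /e mulrA ltr_pdivrMr ?ltr_wpDl ?mulr_ge0 // mulrC ltr_pM2l //.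
  by rewrite ltrDl.
move: hn; rewrite lt_min => /andP[/dP + hn]; rewrite mul1r hE => h1.
rewrite -(subrK (\sum_(j < n) a 0 j * h 0 j) (_ - _)) (le_trans (cabsD _ _)) //.
have cs (I : Type) (s : seq I) (g : I -> R[i]) :
    cabs (\sum_(i <- s) g i) <= \sum_(i <- s) cabs (g i).
  elim: s => [|i s IH]; rewrite ?big_nil ?cabs0 // !big_cons.
  by rewrite (le_trans (cabsD _ _)) // lerD2l.
have h2 : cabs (\sum_(j < n) a 0 j * h 0 j) <= A * cnorm h.
  apply: le_trans (cs _ _ _) _; rewrite mulr_suml ler_sum // => j _.
  rewrite cabsM ler_wpM2l ?cabs_ge0 // -[leLHS]ger0_norm ?cabs_ge0 //.
  rewrite -sqrtr_sqr ler_wsqrtr // (bigD1 j) //= lerDl.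
  by apply: sumr_ge0 => i _; rewrite sqr_ge0.
apply: le_trans (lerD h1 h2) _; rewrite -[X in X + _]mul1r -mulrDl addrC.
by move: hn; rewrite ltr_pdivlMr ?ltr_wpDl // mulrC => /ltW.
Qed.

Lemma cstrip_cpt (R : realType) n (D : set 'rV[R]_n) b x y :
  cstrip D b (cpt x y) <-> D x /\ forall j, `|y 0 j| < b.
Proof.
rewrite /cstrip /=; have -> : \row_j complex.Re (cpt x y 0 j) = x.
  by apply/rowP => j; rewrite !mxE.
by split=> -[Dx h]; split=> // j; have := h j; rewrite mxE.
Qed.

(** * Bias of the oracle *)

(** Compactness of [K] times the cube [-b, b]^n makes the radius and the bound on |F| uniform. Both
    parts may move by [r] beyond these sets: openness of [D] and the strict inequality [b < dbar]
    leave the room. *)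
Lemma strip_uniform_bound (R : realType) n (D : set 'rV[R]_n) (F : 'rV[R[i]]_n -> R[i])
  (K : set 'rV[R]_n) (b dbar : R) : open D -> 0 <= b -> b < dbar ->
  holomorphic_on (cstrip D dbar) F -> compact K -> K `<=` D ->
  exists r M : R, [/\ 0 < r, 0 <= M & forall x y x' y' : 'rV[R]_n, K x -> (forall j, `|y 0 j| <= b) ->
    `|x' - x| <= r -> `|y' - y| <= r ->
    cstrip D dbar (cpt x' y') /\ cabs (F (cpt x' y')) <= M].
Proof.
move=> oD b0 bd hF cK KD.
pose B := [set y : 'rV[R]_n | forall j, `[- b, b]%classic (y 0 j)].
have cB : compact B by exact: (@rV_compact _ n (fun=> `[- b, b]%classic) (fun=> @segment_compact _ _ _)).
have cKB := compact_setX cK cB.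
(* One parameter [i] plays two roles, bound on |F| and inverse of the radius, so that a single
   near-covering along [+oo] yields both constants. *)
pose Pr (i : R) (p : 'rV[R]_n * 'rV[R]_n) := forall x' y',
  `|x' - p.1| <= i^-1 -> `|y' - p.2| <= i^-1 ->
  cstrip D dbar (cpt x' y') /\ cabs (F (cpt x' y')) <= i.
have := (compact_near_coveringP _).1 cKB R +oo%R Pr _.
case=> [[x y] [/= Kx By]|M [Mr MP]].
  have [e1 [e10 e1P]] := openP_norm oD (KD _ Kx).
  have st : cstrip D dbar (cpt x y).
    apply/cstrip_cpt; split; first exact: KD.
    by move=> j; have := By j; rewrite /= in_itv /= -ler_norml => /le_lt_trans; exact.
  have [e2 [e20 e2P]] := cdifferentiable_continuous (hF _ st) ltr01.
  pose e := Num.min (Num.min e1 e2) (dbar - b) / 2.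
  have e0 : 0 < e by rewrite divr_gt0 // !lt_min e10 e20 subr_gt0.
  exists (ball x e `*` ball y e, [set i | Num.max e^-1 (cabs (F (cpt x y)) + 1) < i]).
    split; last by exists (Num.max e^-1 (cabs (F (cpt x y)) + 1)); split=> //; rewrite num_real.
    by exists (ball x e, ball y e) => //=; split; exact: nbhsx_ballx.
  move=> [[x1 y1] i] /= [[]]; rewrite -!ball_normE /= => xx1 yy1.
  rewrite gt_max => /andP[i1 i2] x' y' /= x'x1 y'y1.
  have i0 : 0 < i by rewrite (lt_trans _ i1) // invr_gt0.
  have ie : i^-1 < e by rewrite -[e]invrK ltf_pV2 ?posrE ?invr_gt0.
  have ee : e + e = Num.min (Num.min e1 e2) (dbar - b) by rewrite /e -splitr.
  have dx : `|x' - x| < e + e.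
    rewrite -(subrK x1 x') -addrA (le_lt_trans (ler_normD _ _)) // ler_ltD ?(distrC x1) //.
    by rewrite (le_trans x'x1) // ltW.
  have dy : `|y' - y| < e + e.
    rewrite -(subrK y1 y') -addrA (le_lt_trans (ler_normD _ _)) // ler_ltD ?(distrC y1) //.
    by rewrite (le_trans y'y1) // ltW.
  move: dx dy; rewrite ee !lt_min => /andP[/andP[dx1 dx2] _] /andP[/andP[_ dy2] dy3].
  split.
    apply/cstrip_cpt; split; first exact: e1P.
    move=> j; rewrite -(subrK y y') mxE (le_lt_trans (ler_normD _ _)) //.
    have h1 : `|(y' - y) 0 j| < dbar - b by rewrite (le_lt_trans (ler_coord_norm _ _)).
    have h2 : `|y 0 j| <= b by have := By j; rewrite /= in_itv /= -ler_norml.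
    by lra.
  have h := e2P _ _ dx2 dy2.
  rewrite -(subrK (F (cpt x y)) (F _)) (le_trans (cabsD _ _)) //.
  by move: i2 h; lra.
pose i := Num.max M 0 + 1.
have i0 : 0 < i by rewrite ltr_wpDl // le_max lexx orbT.
have Mi : M < i by rewrite (@le_lt_trans _ _ (Num.max M 0)) ?le_max ?lexx // ltrDl.
exists i^-1, i; split; [by rewrite invr_gt0|exact: ltW|].
move=> x y x' y' Kx yb; apply: (MP i Mi (x, y)); split=> //= j.
by rewrite /= in_itv /= -ler_norml.
Qed.

Lemma eq0_of_le_lin (R : realType) (X C t0 : R) : 0 < t0 ->
  (forall t, 0 < t -> t <= t0 -> `|X| <= C * t) -> X = 0.
Proof.
move=> t00 H; apply/eqP; rewrite -normr_le0; apply/ler_addgt0Pr => e e0; rewrite add0r.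
have C1 : 0 < `|C| + 1 by rewrite ltr_wpDl.
pose t := Num.min t0 (e / (`|C| + 1)).
have tp : 0 < t by rewrite lt_min t00 divr_gt0.
have tt : t <= t0 by rewrite /t ge_min lexx.
apply: le_trans (H t tp tt) _.
apply: (@le_trans _ _ ((`|C| + 1) * t)).
  by rewrite ler_wpM2r ?(ltW tp) // (le_trans (ler_norm _)) // lerDl.
by rewrite mulrC -ler_pdivlMr // /t ge_min lexx orbT.
Qed.

Lemma derive1_eps (R : realType) (g : R -> R) (l : R) :
  (forall eps, 0 < eps -> exists d, 0 < d /\ forall t, `|t| < d ->
    `|g t - g 0 - l * t| <= eps * `|t|) -> derive1 g 0 = l.
Proof.
move=> H; rewrite derive1E /derive; apply: cvg_lim => //.
apply/cvgrPdist_le => eps eps0; have [d [d0 dP]] := H _ eps0.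
near=> t.
have t0 : t != 0 by near: t; exact: nbhs_dnbhs_neq.
rewrite /= addr0 scaler1.
have -> : l - t^-1 *: (g t - g 0) = - (t^-1 * (g t - g 0 - l * t)).
  by rewrite /GRing.scale /=; field.
rewrite normrN normrM normfV ler_pdivrMl ?normr_gt0 // [leRHS]mulrC dP //.
near: t; apply: dnbhs0_lt => //.
Unshelve. all: by end_near. Qed.

(** For a small real increment the point stays in the open set [D], where [F] is [f]; the real part
    of the complex differential is therefore the real directional derivative. *)
Lemma dderiv_holomorphic (R : realType) n (D : set 'rV[R]_n) (f : 'rV[R]_n -> R)
  (F : 'rV[R[i]]_n -> R[i]) (x v : 'rV[R]_n) (a : 'rV[R[i]]_n) : open D -> D x ->
  (forall y, D y -> F (cpt y 0) = real_complex R (f y)) ->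
  (forall eps : R, 0 < eps -> exists d : R, 0 < d /\ forall h, cnorm h < d ->
      cabs (F (cpt x 0 + h) - F (cpt x 0) - \sum_(j < n) a 0 j * h 0 j) <= eps * cnorm h) ->
  dderiv f x v = complex.Re (\sum_(j < n) a 0 j * real_complex R (v 0 j)).
Proof.
move=> oD Dx Ff H; apply: derive1_eps => eps eps0.
have N0 : 0 < enorm v + 1 by rewrite ltr_wpDl // enorm_ge0.
have [d1 [d10 d1P]] := H _ (divr_gt0 eps0 N0).
have [d2 [d20 d2P]] := openP_norm oD Dx.
exists (Num.min d1 d2 / (enorm v + 1)); split.
  by rewrite divr_gt0 // lt_min d10.
move=> t; rewrite ltr_pdivlMr // lt_min mulrDr mulr1 => /andP[t1 t2].
have tv : enorm (t *: v) <= `|t| * enorm v + `|t| by rewrite enormZ lerDl.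
have hc : cpt (x + t *: v) 0 = cpt x 0 + cpt (t *: v) 0 by rewrite -cptD addr0.
have hn : cnorm (cpt (t *: v) 0) <= `|t| * (enorm v + 1).
  apply: le_trans (cnorm_cpt _ _) _.
  by rewrite -(scale0r (0 : 'rV[R]_n)) [enorm (0 *: _)]enormZ normr0 mul0r addr0 mulrDr mulr1.
have Dt : D (x + t *: v).
  by apply: d2P; rewrite addrC addKr (le_lt_trans (norm_le_enorm _)) // (le_lt_trans tv).
have := d1P (cpt (t *: v) 0).
rewrite -hc !Ff // => /(_ _)/le_trans-/(_ _ _ _)/(le_trans (ler_normRe _)).
rewrite !cReD !cReN scale0r addr0.
have -> : complex.Re (\sum_(j < n) a 0 j * cpt (t *: v) 0 0 j) =
   complex.Re (\sum_(j < n) a 0 j * real_complex R (v 0 j)) * t.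
  have -> : \sum_(j < n) a 0 j * cpt (t *: v) 0 0 j =
     (\sum_(j < n) a 0 j * real_complex R (v 0 j)) * real_complex R t.
    rewrite mulr_suml; apply: eq_bigr => j _; rewrite -mulrA -rmorphM /= !mxE.
    by congr (_ * _); apply: eq_ReIm => //=; rewrite mulrC.
  by rewrite cReM /= mulr0 subr0.
move=> /=; apply.
  by apply: le_lt_trans hn _; rewrite mulrDr mulr1.
rewrite -mulrA; apply: ler_wpM2l; first exact: ltW.
by rewrite ler_pdivrMl // mulrC.
Qed.

(** [phi w] is F (x + w u) with x + w u written by real and imaginary parts. An increment [h] of [w]
    moves the argument by h u, of norm |h| because [u] is a unit vector. *)
Lemma cderivable_line (R : realType) n (F : 'rV[R[i]]_n -> R[i]) (x u : 'rV[R]_n) p q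
  (a : 'rV[R[i]]_n) : @sphere R n u ->
  (forall eps : R, 0 < eps -> exists d : R, 0 < d /\ forall h, cnorm h < d ->
      cabs (F (cpt (x + p *: u) (q *: u) + h) - F (cpt (x + p *: u) (q *: u))
        - \sum_(j < n) a 0 j * h 0 j) <= eps * cnorm h) ->
  let phi w := F (cpt (x + complex.Re w *: u) (complex.Im w *: u)) in
  forall eps : R, 0 < eps -> exists d : R, 0 < d /\
    forall h, cabs h < d -> cabs (phi (Complex p q + h) - phi (Complex p q)
      - (\sum_(j < n) a 0 j * real_complex R (u 0 j)) * h) <= eps * cabs h.
Proof.
move=> u1 H phi eps /H[d [d0 dP]]; exists d; split=> // h hd.
pose k := cpt (complex.Re h *: u) (complex.Im h *: u).
have kE j : k 0 j = real_complex R (u 0 j) * h.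
  by rewrite mxE; apply: eq_ReIm; rewrite ?cReM ?cImM !mxE /= ?mul0r ?subr0 ?addr0 mulrC.
have kn : cnorm k = cabs h.
  rewrite /cnorm; under eq_bigr do rewrite kE cabsM cabs_real exprMn real_normK ?num_real //.
  rewrite -mulr_suml (_ : \sum_(i < n) _ = enorm u ^+ 2); last first.
    by rewrite enorm_sqr; apply: eq_bigr => j _; rewrite expr2.
  by rewrite u1 expr1n mul1r sqrtr_sqr ger0_norm ?cabs_ge0.
have := dP k; rewrite kn => /(_ hd).
have -> : \sum_(j < n) a 0 j * k 0 j = (\sum_(j < n) a 0 j * real_complex R (u 0 j)) * h.
  by rewrite mulr_suml; apply: eq_bigr => j _; rewrite kE mulrA.
have E : cpt (x + complex.Re (Complex p q + h) *: u) (complex.Im (Complex p q + h) *: u)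
    = cpt (x + p *: u) (q *: u) + k by rewrite cReD cImD !scalerDl addrA cptD.
by rewrite /phi E.
Qed.

(** Taylor's expansion is applied on each complex line x + w u; [s] and [C] are built from [r] and
    [M] alone, hence serve all [x] and [u]. *)
Lemma gradient_bias (R : realType) n (D : set 'rV[R]_n) (f : 'rV[R]_n -> R)
  (F : 'rV[R[i]]_n -> R[i]) (K : set 'rV[R]_n) (b dbar : R) : open D -> 0 <= b -> b < dbar ->
  holomorphic_extension D f dbar F -> compact K -> K `<=` D ->
  exists s C : R, [/\ 0 < s, 0 <= C & forall x u del, K x -> @sphere R n u ->
    0 < del -> del <= s ->
    `|complex.Im (F (cpt x (del *: u))) - del * dotv (grad f x) u| <= C * del ^+ 3].
Proof.
move=> oD b0 bd [hF Ff] cK KD.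
have [r [M [r0 M0 B]]] := strip_uniform_bound oD b0 bd hF cK KD.
exists (r / 2), (8 * M / r ^+ 3); split; first exact: divr_gt0.
  by apply: divr_ge0; [exact: mulr_ge0|apply: exprn_ge0; exact: ltW].
move=> x u del Kx u1 d0 ds.
pose phi w := F (cpt (x + complex.Re w *: u) (complex.Im w *: u)).
have u_le p : - r <= p <= r -> `|p *: u| <= r.
  rewrite -ler_norml => pr; apply: le_trans (norm_le_enorm _) _.
  by rewrite enormZ (u1 : enorm u = 1) mulr1.
have B' p q : - r <= p <= r -> - r <= q <= r ->
    cstrip D dbar (cpt (x + p *: u) (q *: u)) /\ cabs (F (cpt (x + p *: u) (q *: u))) <= M.
  move=> pr qr; apply: (B x 0) => //.
  - by move=> j; rewrite mxE normr0.
  - by rewrite addrC addKr u_le.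
  - by rewrite subr0 u_le.
have der p q : - r <= p <= r -> - r <= q <= r -> cderivable phi (Complex p q).
  move=> pr qr; have [st _] := B' p q pr qr.
  have [a aP] := hF _ st.
  by exists (\sum_(j < n) a 0 j * real_complex R (u 0 j)); exact: cderivable_line.
have [c0 [c1 [c2 T]]] := taylor3_square r0 der (fun p q pr qr => (B' p q pr qr).2).
set C := 8 * M / r ^+ 3 in T *.
have C0 : 0 <= C.
  by apply: divr_ge0; [exact: mulr_ge0|apply: exprn_ge0; exact: ltW].
have r2 : 0 < r / 2 by rewrite divr_gt0.
have st0 : cstrip D dbar (cpt x 0).
  apply/cstrip_cpt; split; first exact: KD.
  by move=> j; rewrite mxE normr0 (le_lt_trans b0).
have [a aP] := hF _ st0.
have aP' : forall eps : R, 0 < eps -> exists d : R, 0 < d /\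
    forall h, cnorm h < d -> cabs (F (cpt (x + 0 *: u) (0 *: u) + h) -
      F (cpt (x + 0 *: u) (0 *: u)) - \sum_(j < n) a 0 j * h 0 j) <= eps * cnorm h.
  by rewrite scale0r addr0.
pose A := \sum_(j < n) a 0 j * real_complex R (u 0 j).
have Ad := cderivable_line u1 aP'.
have gE : dotv (grad f x) u = complex.Re A.
  have -> : complex.Re A = \sum_j complex.Re (a 0 j * real_complex R (u 0 j)).
    by apply: (big_morph _ (@cReD R) (erefl : complex.Re 0 = 0)).
  apply: eq_bigr => j _; rewrite mxE.
  rewrite (dderiv_holomorphic (evec R j) oD (KD _ Kx) Ff aP).
  rewrite (bigD1 j) //= big1 ?addr0 => [|k kj]; last first.
    by rewrite mxE eq_sym (negbTE kj) mulr0.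
  by rewrite mxE eqxx mulr1 cReM /= mulr0 subr0.
have Treal t : `|t| <= r / 2 ->
    cabs (phi (real_complex R t) - (c0 + c1 * real_complex R t + c2 * real_complex R t ^+ 2))
      <= C * `|t| ^+ 3.
  move=> tr; have := T t 0 tr; rewrite normr0 => /(_ (ltW r2)).
  by rewrite complexr0 cabs_real.
have phiR t : `|t| <= r / 2 -> complex.Im (phi (real_complex R t)) = 0.
  move=> tr; have tr' : - r <= t <= r by rewrite -ler_norml (le_trans tr) //; lra.
  have r00 : - r <= 0 <= r by rewrite lerNl oppr0 (ltW r0).
  have [/cstrip_cpt[Dt _] _] := B' t 0 tr' r00.
  by rewrite /phi /= scale0r Ff.
(* [phi] is real on the reals, hence [c0] and [c2] are real and only the odd
   coefficient [c1] contributes to [Im (phi (i del))]. *)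
have Imc0 : complex.Im c0 = 0.
  have := Treal 0; rewrite normr0 => /(_ (ltW r2)).
  rewrite expr0n /= mulr0 => /(le_trans (ler_normIm _)).
  rewrite cImD cImN !cImD phiR ?normr0 ?(ltW r2) // expr0n /= !mulr0 !addr0 add0r normrN.
  by rewrite normr_le0 => /eqP.
(* Adding the estimates at [t] and [- t] cancels the linear term and leaves |Im c2| t^2 <= C t^3. *)
have Imc2 : complex.Im c2 = 0.
  apply: (@eq0_of_le_lin _ _ C (r / 2)) => // t t0 tr.
  have tr' : `|t| <= r / 2 by rewrite gtr0_norm.
  have tr'' : `|- t| <= r / 2 by rewrite normrN.
  have := le_trans (ler_normIm _) (Treal _ tr').
  have := le_trans (ler_normIm _) (Treal _ tr'').
  rewrite !(cImD, cImN) !phiR // Imc0 !add0r !normrN (gtr0_norm t0).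
  have E1 (z : R[i]) (l : R) : complex.Im (z * real_complex R l) = complex.Im z * l.
    by rewrite cImM /= mulr0 add0r.
  rewrite -!rmorphXn /= !E1 sqrrN mulrN.
  set X := complex.Im c1 * t; set Y := complex.Im c2 * _.
  move=> h1 h2; have : `|Y| <= C * t ^+ 3.
    have : `|(- X + Y) + (X + Y)| <= C * t ^+ 3 + C * t ^+ 3.
      by apply: le_trans (ler_normD _ _) (lerD h1 h2).
    rewrite (_ : - X + Y + (X + Y) = 2 * Y); last by ring.
    by rewrite normrM ger0_norm //; lra.
  rewrite /Y normrM (ger0_norm (exprn_ge0 _ (ltW t0))) (_ : C * t ^+ 3 = C * t * t ^+ 2); last by ring.
  by rewrite ler_pM2r ?exprn_gt0 // .
(* Both [c1] and the differential [A] approximate [phi] to first order along the reals; comparing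
   them as t tends to 0 identifies Re c1 with the directional derivative. *)
have Rec1 : complex.Re (c1 - A) = 0.
  apply/eqP; rewrite -normr_le0; apply/ler_addgt0Pr => e e0; rewrite add0r.
  have e2 : 0 < e / 2 by rewrite divr_gt0.
  have [d1 [d10 d1P]] := Ad _ e2.
  pose L := cabs c2 + C * r.
  have L0 : 0 < L + 1 by rewrite ltr_wpDl // addr_ge0 ?cabs_ge0 // mulr_ge0 // ltW.
  (* The three bounds give the differential estimate, the Taylor estimate, and at most [e / 2] for
     the quadratic and cubic remainders divided by [t]. *)
  pose t := Num.min (Num.min (d1 / 2) (r / 2)) (e / 2 / (L + 1)).
  have t0 : 0 < t by rewrite !lt_min !divr_gt0.
  have [t1 t2 t3] : [/\ t <= d1 / 2, t <= r / 2 & t <= e / 2 / (L + 1)].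
    by split; rewrite /t !ge_min lexx ?orbT.
  have ta : `|t| <= r / 2 by rewrite gtr0_norm.
  have h1 := Treal t ta.
  have h2 : cabs (phi (real_complex R t) - phi 0 - A * real_complex R t) <= e / 2 * t.
    have := d1P (real_complex R t); rewrite cabs_real gtr0_norm //.
    rewrite (_ : Complex 0 0 + real_complex R t = real_complex R t).
      by apply; lra.
    by apply: eq_ReIm; rewrite ?cReD ?cImD /= add0r.
  have c0E : phi 0 = c0.
    apply/eqP; rewrite -subr_eq0 -cabs_eq0 eq_le cabs_ge0 andbT.
    have := Treal 0; rewrite normr0 => /(_ (ltW r2)).
    by rewrite rmorph0 !expr0n /= !mulr0 !addr0.
  have h3 : cabs ((c1 - A) * real_complex R t) <= e / 2 * t + C * t ^+ 3 + cabs c2 * t ^+ 2.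
    have -> : (c1 - A) * real_complex R t =
      (phi (real_complex R t) - phi 0 - A * real_complex R t) -
      (phi (real_complex R t) - (c0 + c1 * real_complex R t + c2 * real_complex R t ^+ 2))
      - c2 * real_complex R t ^+ 2 by rewrite c0E; ring.
    apply: le_trans (cabsB _ _) _; apply: lerD.
      by apply: le_trans (cabsB _ _) _; apply: lerD => //; rewrite gtr0_norm // in h1.
    by rewrite cabsM cabsX cabs_real gtr0_norm.
  move: h3; rewrite cabsM cabs_real gtr0_norm // -ler_pdivlMr // => h3.
  apply: le_trans (ler_normRe _) (le_trans h3 _).
  have -> : (e / 2 * t + C * t ^+ 3 + cabs c2 * t ^+ 2) / t =
      e / 2 + (C * t + cabs c2) * t by field; rewrite gt_eqF.
  have h4 : (C * t + cabs c2) * t <= (L + 1) * t.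
    rewrite ler_wpM2r ?(ltW t0) // /L.
    have : C * t <= C * r by rewrite ler_wpM2l //; lra.
    by lra.
  by move: t3; rewrite ler_pdivlMr // [t * _]mulrC; move: h4; lra.
have := T 0 del; rewrite normr0 gtr0_norm // => /(_ (ltW r2) ds).
move=> /(le_trans (ler_normIm _)).
have zE : Complex 0 del = Complex 0 1 * real_complex R del.
  by apply: eq_ReIm; rewrite ?cReM ?cImM /=; ring.
have -> : cabs (Complex 0 del) = del by rewrite zE cabsM cabs_i cabs_real mul1r gtr0_norm.
have Ei : complex.Im (c1 * Complex 0 del) = complex.Re c1 * del.
  by rewrite cImM /= mulr0 addr0.
have E2 : complex.Im (c2 * Complex 0 del ^+ 2) = 0.
  have -> : Complex 0 del ^+ 2 = real_complex R (- del ^+ 2).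
    by rewrite expr2; apply: eq_ReIm; rewrite ?cReM ?cImM /=; ring.
  by rewrite cImM /= mulr0 Imc2 mul0r addr0.
rewrite cImD cImN !cImD Imc0 Ei E2 add0r addr0 /phi /= scale0r addr0 gE.
by move: Rec1; rewrite cReD cReN => /eqP; rewrite subr_eq0 => /eqP <-; rewrite mulrC.
Qed.

(** * Measurability, independence and moments on the sphere *)

Lemma bigcup_countType_measurable d (T : measurableType d) (C : countType)
  (A : C -> set T) : (forall c, measurable (A c)) -> measurable (\bigcup_c A c).
Proof.
move=> mA; have -> : \bigcup_c A c = \bigcup_k oapp A set0 (choice.unpickle k).
  apply/seteqP; split=> [x [c _ Ac]|x [k _]]; first by exists (choice.pickle c) => //; rewrite choice.pickleK.
  by case: (choice.unpickle k) => //= c Ac; exists c.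
apply: bigcupT_measurable => k.
by case: (choice.unpickle k) => [c|] /=; [exact: mA|exact: measurable0].
Qed.

(** [vecB] is generated by the open sets, whereas the iterates are handled coordinate by coordinate.
    A countable union of cubes with rational centres bridges the two. *)
Lemma open_bigcup_rat_box (R : realType) n (U : set 'rV[R]_n) : open U ->
  U = \bigcup_(c : {ffun 'I_n -> rat} * nat)
    [set x | (forall i, `|x 0 i - ratr (c.1 i)| < c.2.+1%:R^-1) /\
      forall y : 'rV[R]_n, (forall i, `|y 0 i - ratr (c.1 i)| < c.2.+1%:R^-1) -> U y].
Proof.
move=> oU; apply/seteqP; split=> [x Ux|x [c _ [xc]]]; last exact.
have [e [e0 eU]] := openP_norm oU Ux.
have [k ke] : exists k, (k.+1%:R^-1 : R) < e / 2.
  exists (Num.bound (e / 2)^-1); rewrite invf_plt ?posrE ?divr_gt0 //.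
  apply: lt_trans (archi_boundP _) _; first by rewrite invr_ge0 divr_ge0 // ltW.
  by rewrite ltr_nat.
have qP i : exists q : rat, `|x 0 i - ratr q| < k.+1%:R^-1.
  have k0 : 0 < (k.+1%:R^-1 : R) by rewrite invr_gt0.
  move: k0; move: (k.+1%:R^-1) => r r0.
  have /rat_in_itvoo[q] : x 0 i - r < x 0 i + r by lra.
  rewrite in_itv /= => /andP[q1 q2]; exists q; rewrite ltr_norml; apply/andP; split; lra.
have [q {}qP] := choice qP.
exists (finfun q, k) => //=; split=> [i|y yq]; first by rewrite ffunE.
have k0 : 0 < (k.+1%:R^-1 : R) by rewrite invr_gt0.
move: (k.+1%:R^-1) ke k0 qP yq => r ke k0 qP yq.
apply: eU; apply: (@le_lt_trans _ _ (2 * r)); last by lra.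
apply: ler_norm_coord => [|i]; first by rewrite mulr_ge0 // ltW.
rewrite !mxE; have := yq i; rewrite ffunE => h1; have h2 := qP i.
rewrite (_ : y 0 i - x 0 i = (y 0 i - ratr (q i)) - (x 0 i - ratr (q i))); last by ring.
by apply: le_trans (ler_normB _ _) _; lra.
Qed.

Lemma measurable_preimage_open_rV d (T : measurableType d) (R : realType) n
  (X : T -> 'rV[R]_n) : (forall i, measurable_fun setT (fun w => X w 0 i)) ->
  forall U, open U -> measurable (X @^-1` U).
Proof.
move=> mX U oU; rewrite (open_bigcup_rat_box oU) preimage_bigcup.
apply: bigcup_countType_measurable => c /=.
have [cU|ncU] := pselect (forall y : 'rV[R]_n,
    (forall i, `|y 0 i - ratr (c.1 i)| < c.2.+1%:R^-1) -> U y); last first.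
  by rewrite (_ : _ @^-1` _ = set0) //; apply/seteqP; split=> // x [_ /ncU].
rewrite (_ : _ @^-1` _ = \bigcap_i [set w | `|X w 0 i - ratr (c.1 i)| < c.2.+1%:R^-1]).
  apply: fin_bigcap_measurable => // i _.
  have := measurable_funB (mX i) (measurable_cst (ratr (c.1 i) : R)).
  move=> /(measurableT_comp (@normr_measurable R setT)).
  move=> /(_ measurableT `]-oo, c.2.+1%:R^-1[%classic (measurable_itv _)).
  by rewrite setTI; congr measurable; apply/seteqP; split=> w; rewrite /= in_itv.
by apply/seteqP; split=> w /= => [[h _] i _|h]; [exact: h|split=> // i; exact: h].
Qed.

Lemma measurable_vecB d (T : measurableType d) (R : realType) n
  (X : T -> 'rV[R]_n) : (forall i, measurable_fun setT (fun w => X w 0 i)) ->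
  measurable_fun setT (X : T -> vecB R n).
Proof.
move=> mX; apply: (@measurability _ _ _ (vecB R n) _ _ (fun A : set 'rV[R]_n => open A)) => //.
by move=> _ [U oU <-]; rewrite setTI; exact: measurable_preimage_open_rV.
Qed.

Lemma measurable_coord_vecB (R : realType) n i :
  measurable_fun setT (fun v : vecB R n => (v : 'rV[R]_n) 0 i).
Proof.
apply: (measurability _ (RGenOpens.measurableE R)).
move=> _ [_ [a [b ->] <-]]; rewrite setTI; apply: sub_sigma_algebra.
have := (@coord_continuous R 1 n 0 i); move/continuousP; apply.
exact: interval_open.
Qed.

Lemma measurable_vecB_coord d (T : measurableType d) (R : realType) n
  (X : T -> 'rV[R]_n) i : measurable_fun setT (X : T -> vecB R n) ->
  measurable_fun setT (fun w => X w 0 i).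
Proof.
move=> mX; apply: (measurability _ (RGenOpens.measurableE R)).
move=> _ [B [a [b BE]] <-].
have := @measurable_coord_vecB R n i measurableT B; rewrite BE.
move=> /(_ (measurable_itv _)); rewrite setTI => /(mX measurableT).
by rewrite !setTI.
Qed.

Lemma measurable_continuous_comp d (T : measurableType d) (R : realType) n
  (X : T -> 'rV[R]_n) (S : set 'rV[R]_n) (g : 'rV[R]_n -> R) :
  (forall i, measurable_fun setT (fun w => X w 0 i)) -> (forall w, S (X w)) ->
  (forall x, S x -> forall eps, 0 < eps -> exists e, 0 < e /\ forall y, S y ->
    `|y - x| < e -> `|g y - g x| <= eps) ->
  measurable_fun setT (g \o X).
Proof.
move=> mX SX gc; apply: (measurability _ (RGenOpens.measurableE R)).
move=> _ [_ [a [b ->] <-]]; rewrite setTI.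
(* [g] is continuous only relative to [S]. The implication admits every point outside [S], so this
   open set has the same trace on [S] as the preimage of ]a, b[. *)
pose U := interior [set x | S x -> a < g x < b].
rewrite (_ : _ @^-1` _ = X @^-1` U).
  by apply: measurable_preimage_open_rV => //; exact: open_interior.
apply/seteqP; split=> w /=; last first.
  move=> h; have h' : [set x | S x -> a < g x < b] (X w) by exact: nbhs_singleton.
  by rewrite in_itv /=; exact: (h' (SX w)).
rewrite in_itv /= => /andP[ag gb].
pose eps := Num.min (g (X w) - a) (b - g (X w)) / 2.
have eps0 : 0 < eps by rewrite divr_gt0 // lt_min !subr_gt0 ag.
have [e [e0 eP]] := gc _ (SX w) _ eps0.
rewrite /U /interior /=; apply/nbhs_ballP; exists e => //= y.
rewrite -ball_normE /= distrC => ye Sy; have := eP _ Sy ye.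
have e1 : eps <= (g (X w) - a) / 2 by rewrite ler_pM2r // ge_min lexx.
have e2 : eps <= (b - g (X w)) / 2 by rewrite ler_pM2r // ge_min lexx orbT.
by rewrite ler_norml => /andP[h1 h2]; apply/andP; split; lra.
Qed.

Lemma measurable_continuous_comp2 d (T : measurableType d) (R : realType) n
  (X Y : T -> 'rV[R]_n) (S S' : set 'rV[R]_n) (g : 'rV[R]_n -> 'rV[R]_n -> R) :
  (forall i, measurable_fun setT (fun w => X w 0 i)) ->
  (forall i, measurable_fun setT (fun w => Y w 0 i)) ->
  (forall w, S (X w)) -> (forall w, S' (Y w)) ->
  (forall x y, S x -> S' y -> forall eps, 0 < eps -> exists e, 0 < e /\
    forall x' y', S x' -> S' y' -> `|x' - x| < e -> `|y' - y| < e ->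
    `|g x' y' - g x y| <= eps) ->
  measurable_fun setT (fun w => g (X w) (Y w)).
Proof.
move=> mX mY SX SY gc.
pose Z w := row_mx (X w) (Y w).
have -> : (fun w => g (X w) (Y w)) = (fun z => g (lsubmx z) (rsubmx z)) \o Z.
  by apply/funext => w /=; rewrite row_mxKl row_mxKr.
apply: (@measurable_continuous_comp _ _ _ _ _ [set z | S (lsubmx z) /\ S' (rsubmx z)]).
- move=> i; rewrite /Z; case: (split_ordP i) => j ->.
    by under eq_fun do rewrite row_mxEl; exact: mX.
  by under eq_fun do rewrite row_mxEr; exact: mY.
- by move=> w; rewrite /Z /= row_mxKl row_mxKr.
- move=> z [Sz Sz'] eps /(gc _ _ Sz Sz')[e [e0 eP]]; exists e; split=> // y [Sy Sy'] yz.
  apply: eP => //; apply: le_lt_trans yz; apply: ler_norm_coord => // j.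
    by have := ler_coord_norm (y - z) (lshift n j); rewrite !mxE.
  by have := ler_coord_norm (y - z) (rshift n j); rewrite !mxE.
Qed.

(** Independence passes from the families to the sigma-algebra they generate: A |-> P (A [&] B) and
    A |-> P A * P B are finite measures that agree on a generating pi-system. *)
Lemma mutually_independent_generated d (T : measurableType d) (R : realType)
  (P : probability T R) (I : choiceType) (E : I -> set (set T)) (J : set I) (i : I) :
  mutually_independent P E ->
  (forall j, E j setT) -> (forall j, setI_closed (E j)) ->
  (forall j, E j `<=` measurable) -> ~ J i ->
  forall A B, <<s \bigcup_(j in J) E j >> A -> E i B -> P (A `&` B) = (P A * P B)%E.
Proof.
move=> indep ET EI Em Ji A B GA EB.
have mB : measurable B by exact: Em EB.
(* The finite intersections of events [E j], [j] in [J], form a pi-system. *)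
pose Pi := [set A | exists (S : {fset I}) (a : I -> set T),
  [/\ forall j, j \in S -> J j, forall j, j \in S -> E j (a j) &
   A = \bigcap_(j in [set` S]) a j]].
have mPi : Pi `<=` measurable.
  move=> _ [S [a [SJ Ea ->]]]; apply: fin_bigcap_measurable => [|j jS]; first exact: finite_fset.
  by apply: (Em j); exact: Ea.
have PiI : setI_closed Pi.
  move=> _ _ [S1 [a1 [SJ1 Ea1 ->]]] [S2 [a2 [SJ2 Ea2 ->]]].
  (* Padding with [setT] gives both families the same index set, so the intersection is again of the
     required shape. *)
  pose b1 j := if j \in S1 then a1 j else setT.
  pose b2 j := if j \in S2 then a2 j else setT.
  exists (S1 `|` S2)%fset, (fun j => b1 j `&` b2 j); split.
  - by move=> j; rewrite in_fsetU => /orP[/SJ1|/SJ2].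
  - move=> j _; apply: EI; rewrite /b1 /b2.
      by case: ifP => [/Ea1|_] //; exact: ET.
    by case: ifP => [/Ea2|_] //; exact: ET.
  - apply/seteqP; split=> w /= => [[h1 h2] j _|h].
      by rewrite /b1 /b2; split; case: ifPn => // jS; [exact: h1|exact: h2].
    split=> j /= jS; have /= := h j; rewrite in_fsetU jS ?orbT => /(_ isT);
      by rewrite /b1 /b2 jS => -[].
have sub : <<s \bigcup_(j in J) E j >> `<=` <<s Pi >>.
  apply: sub_sigma_algebra2 => C [j Jj EC]; exists [fset j]%fset, (fun=> C); split.
  - by move=> k; rewrite inE => /eqP ->.
  - by move=> k; rewrite inE => /eqP ->.
  - apply/seteqP; split=> [w Cw k _ //|w /= h]; apply: (h j); exact: fset11.
have PB0 : 0 <= fine (P B) by rewrite fine_ge0.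
have PBf : (fine (P B))%:E = P B by rewrite fineK // fin_num_measure.
have := @g_sigma_algebra_measure_unique _ R T Pi mPi (fun=> setT) _ _
  (mrestr P mB) (mscale (NngNum PB0) P) PiI _ _ A (sub _ GA).
rewrite /= /mscale /= /mrestr PBf muleC; apply.
- by move=> _; exists fset0, (fun=> setT); split=> //; apply/seteqP; split.
- by apply/seteqP; split=> // w _; exists 0%N.
- move=> _ [S [a [SJ Ea ->]]].
  have iS : i \notin S by apply/negP => /SJ.
  pose b j := if j == i then B else a j.
  have bi : b i = B by rewrite /b eqxx.
  have bE j : j \in S -> b j = a j.
    by move=> jS; rewrite /b; case: eqP => // ji; rewrite -ji jS in iS.
  have -> : \bigcap_(j in [set` S]) a j `&` B = \bigcap_(j in [set` (i |` S)%fset]) b j.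
    apply/seteqP; split=> w /= => [[h Bw] j|h].
      by rewrite /= in_fset1U => /orP[/eqP ->|jS]; rewrite ?bi // bE //; exact: h.
    split=> [j /= jS|]; first by rewrite -bE //; apply: h; rewrite /= in_fset1U jS orbT.
    by rewrite -bi; apply: h; rewrite /= in_fset1U eqxx.
  rewrite (indep _ b) => [|j]; last first.
    rewrite in_fset1U => /orP[/eqP ->|jS]; first by rewrite bi.
    by rewrite bE //; exact: Ea.
  rewrite (indep _ a) // big_fsetU1 //= bi; congr (_ * _)%E.
  by apply: eq_big_seq => j jS; rewrite bE.
- by move=> _; rewrite /= setTI (le_lt_trans (probability_le1 _ _)) // ltry.
Qed.

(** Independence identifies the joint law with the product of the two laws; by Fubini the inner
    integral at x is x times the mean of [Y], that is 0. Boundedness of [X] makes the product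
    integrable. *)
Lemma probability_indep_Rintegral_mul0 d (T : measurableType d) (R : realType)
  (P : probability T R) (X Y : T -> R) (M : R) :
  measurable_fun setT X -> measurable_fun setT Y -> (forall w, `|X w| <= M) ->
  P.-integrable setT (EFin \o Y) -> \int[P]_w Y w = 0 ->
  (forall A B, measurable A -> measurable B ->
    P (X @^-1` A `&` Y @^-1` B) = (P (X @^-1` A) * P (Y @^-1` B))%E) ->
  P.-integrable setT (EFin \o (fun w => X w * Y w)) /\ \int[P]_w (X w * Y w) = 0.
Proof.
move=> mX mY XM iY Y0 ind.
have iXY : P.-integrable setT (EFin \o (fun w => X w * Y w)).
  have := integrableZl measurableT M iY; apply: le_integrable => //.
    by apply/measurable_EFinP; exact: measurable_funM.
  move=> w _ /=; rewrite lee_fin !normrM ler_wpM2r //.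
  exact: le_trans (XM w) (ler_norm _).
split=> //.
pose X' : {mfun T >-> R} := HB.pack X (isMeasurableFun.Build _ _ _ _ X mX).
pose Y' : {mfun T >-> R} := HB.pack Y (isMeasurableFun.Build _ _ _ _ Y mY).
have mXY : measurable_fun setT (fun w => (X w, Y w)) by exact: measurable_fun_pair.
pose XY : {mfun T >-> (R * R)%type} := HB.pack (fun w => (X w, Y w))
  (isMeasurableFun.Build _ _ _ _ (fun w => (X w, Y w)) mXY).
have U := @product_measure_unique _ _ _ _ _ (distribution P X') (distribution P Y')
  (distribution P XY) (fun A B mA mB => ind A B mA mB).
pose f (z : R * R) := (z.1 * z.2)%:E.
have mf : measurable_fun setT f.
  by apply/measurable_EFinP; apply: measurable_funM; [exact: measurable_fst|exact: measurable_snd].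
have if12 : (distribution P XY).-integrable setT f by apply: integrable_pushforward.
have if' : (distribution P X' \x distribution P Y')%E.-integrable setT f.
  apply/integrableP; split=> //; move/integrableP : if12 => [_].
  by rewrite (eq_measure_integral (distribution P X' \x distribution P Y')%E) // => A mA _; rewrite -U.
have E1 : (\int[P]_w (X w * Y w)%:E = \int[distribution P XY]_z f z)%E.
  by rewrite integral_pushforward.
rewrite /Rintegral E1 (eq_measure_integral (distribution P X' \x distribution P Y')%E); last first.
  by move=> A mA _; rewrite -U.
rewrite -integral12_prod_meas1 // integral0_eq // => x _ /=.
rewrite /fubini_F integral_pushforward //=; last 2 first.
- by rewrite /f; apply/measurable_EFinP/measurable_funM; [exact: measurable_cst|exact: measurable_id].
- by have := integrableZl measurableT x iY; apply: eq_integrable.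
rewrite preimage_setT.
under eq_integral do rewrite /f /= EFinM.
rewrite integralZl // -[X in (_ * X)%E]fineK; last exact: integrable_fin_num.
by move: Y0; rewrite /Rintegral => ->; rewrite mule0.
Qed.

(** The invariance is given on events; passing to the two image measures turns it into an identity
    of integrals. Both vectors stay on the sphere, where the bound on [g] holds. *)
Lemma uniform_on_sphere_integral_eq d (T : measurableType d) (R : realType)
  (P : probability T R) n (X : T -> 'rV[R]_n) (Q : 'M[R]_n) (g : vecB R n -> R) (M : R) :
  measurable_fun setT (X : T -> vecB R n) -> uniform_on_sphere P X -> orthogonal_mx Q ->
  measurable_fun setT g -> (forall x, @sphere R n x -> `|g x| <= M) ->
  \int[P]_w g (X w) = \int[P]_w g (X w *m Q^T).
Proof.
move=> mX [SX UX] oQ mg gM.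
have mXi i : measurable_fun setT (fun w => X w 0 i).
  exact: measurable_vecB_coord.
have mY : measurable_fun setT ((fun w => X w *m Q^T) : T -> vecB R n).
  apply: measurable_vecB => i; under eq_fun do rewrite mxE.
  apply: measurable_sum => j; apply: measurable_funM; first exact: mXi.
  exact: measurable_cst.
have SY w : @sphere R n (X w *m Q^T).
  have := SX w; rewrite /sphere /= /enorm => <-; congr Num.sqrt.
  have dE (x : 'rV[R]_n) : dotv x x = (x *m x^T) 0 0.
    by rewrite mxE; apply: eq_bigr => j _; rewrite mxE.
  rewrite !dE trmx_mul trmxK mulmxA -[_ *m Q^T *m Q]mulmxA.
  by rewrite (mulmx1C oQ) mulmx1.
pose X' : {mfun T >-> vecB R n} := HB.pack (X : T -> vecB R n) (isMeasurableFun.Build _ _ _ _ (X : T -> vecB R n) mX).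
pose Y' : {mfun T >-> vecB R n} := HB.pack ((fun w => X w *m Q^T) : T -> vecB R n)
  (isMeasurableFun.Build _ _ _ _ ((fun w => X w *m Q^T) : T -> vecB R n) mY).
have bi (Z : T -> vecB R n) : measurable_fun setT Z -> (forall w, @sphere R n (Z w)) ->
    P.-integrable setT (EFin \o g \o Z).
  move=> mZ SZ; have := @measurable_bounded_integrable _ _ _ P (g \o Z) setT measurableT.
  rewrite /= probability_setT ltry => /(_ isT) h; apply: h; first exact: measurableT_comp.
  exists M; split; first by rewrite num_real.
  by move=> M' MM' w _ /=; rewrite (le_trans (gM _ (SZ w))) // ltW.
have mEg : measurable_fun setT (EFin \o g) by exact/measurable_EFinP.
congr fine.
have -> : (\int[P]_w (g (X w))%:E = \int[distribution P X']_x (g x)%:E)%E.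
  by rewrite integral_pushforward //; exact: bi.
have -> : (\int[P]_w (g (X w *m Q^T))%:E = \int[distribution P Y']_x (g x)%:E)%E.
  by rewrite integral_pushforward //; exact: bi.
apply: eq_measure_integral => A mA _.
exact: UX.
Qed.

Lemma uniform_on_sphere_moment2 d (T : measurableType d) (R : realType)
  (P : probability T R) n (X : T -> 'rV[R]_n) (i j : 'I_n) :
  measurable_fun setT (X : T -> vecB R n) -> uniform_on_sphere P X ->
  \int[P]_w (X w 0 i * X w 0 j) = (i == j)%:R / n%:R.
Proof.
move=> mX uX; have [SX _] := uX.
have mXi k : measurable_fun setT (fun w => X w 0 k).
  exact: measurable_vecB_coord.
have gM k l (x : 'rV[R]_n) : @sphere R n x -> `|x 0 k * x 0 l| <= 1.
  move=> Sx; rewrite normrM -[1]mulr1 ler_pM // -(Sx : enorm x = 1); exact: ler_coord_enorm.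
have mg k l : measurable_fun setT (fun x : vecB R n => (x : 'rV[R]_n) 0 k * (x : 'rV[R]_n) 0 l).
  by apply: measurable_funM; exact: measurable_coord_vecB.
have iX k l : P.-integrable setT (EFin \o (fun w => X w 0 k * X w 0 l)).
  have := @measurable_bounded_integrable _ _ _ P (fun w => X w 0 k * X w 0 l) setT measurableT.
  rewrite /= probability_setT ltry => /(_ isT) h; apply: h; first exact: measurable_funM.
  exists 1; split; first by rewrite num_real.
  by move=> M' MM' w _ /=; rewrite (le_trans (gM _ _ _ (SX w))) // ltW.
have [<-|ij] := eqVneq i j.
  have n0 : n%:R != 0 :> R by rewrite pnatr_eq0; case: n i {SX mXi gM mg iX j X mX uX} => // -[].
  (* Transpositions make the diagonal moments equal; their sum is the mean of |X|^2 = 1. *)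
  have E k : \int[P]_w (X w 0 k * X w 0 k) = \int[P]_w (X w 0 i * X w 0 i).
    have oQ : orthogonal_mx (perm_mx (tperm i k) : 'M[R]_n).
      by rewrite /orthogonal_mx tr_perm_mx -perm_mxM mulgV perm_mx1.
    rewrite (uniform_on_sphere_integral_eq mX uX oQ (mg k k) (gM k k)).
    apply: eq_Rintegral => w _; rewrite tr_perm_mx -col_permE !mxE.
    by rewrite tpermR.
  apply: (mulIf n0); rewrite mul1r mulVf //.
  have : \sum_(k < n) \int[P]_w (X w 0 k * X w 0 k) = 1.
    transitivity (\int[P]_w (1 : R)); last by rewrite /Rintegral integral_cst //= probability_setT mule1.
    have S (s : seq 'I_n) : \sum_(k <- s) \int[P]_w (X w 0 k * X w 0 k) =
        \int[P]_w (\sum_(k <- s) X w 0 k * X w 0 k) /\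
        P.-integrable setT (EFin \o (fun w => \sum_(k <- s) X w 0 k * X w 0 k)).
      elim: s => [|k s [IH1 IH2]].
        rewrite big_nil; split.
          by under eq_Rintegral do rewrite big_nil; rewrite Rintegral_cst // mul0r.
        by under eq_fun do rewrite big_nil; exact: integrable0.
      rewrite big_cons IH1 -RintegralD //; split.
        by apply: eq_Rintegral => w _; rewrite big_cons.
      have := integrableD measurableT (iX k k) IH2.
      by apply: eq_integrable => // w _ /=; rewrite big_cons.
    rewrite (S _).1; apply: eq_Rintegral => w _.
    have := SX w; rewrite /sphere /= => h; rewrite -/(dotv (X w) (X w)) -enorm_sqr h.
    by rewrite expr1n.
  under eq_bigr do rewrite E.
  by rewrite sumr_const card_ord mulr_natr.
rewrite mul0r.
(* Reflection of the coordinate [i] alone: it changes the sign of the mixed moment, which therefore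
   vanishes. *)
pose e : 'rV[R]_n := \row_k (if k == i then -1 else 1).
have oQ : orthogonal_mx (diag_mx e).
  rewrite /orthogonal_mx tr_diag_mx mulmx_diag; apply/matrixP => k l; rewrite !mxE.
  by case: ifP => _; rewrite ?mulrNN ?mulr1.
have := uniform_on_sphere_integral_eq mX uX oQ (mg i j) (gM i j).
have -> : \int[P]_w ((X w *m (diag_mx e)^T) 0 i * (X w *m (diag_mx e)^T) 0 j) =
   \int[P]_w (-1 * (X w 0 i * X w 0 j)).
  apply: eq_Rintegral => w _; rewrite tr_diag_mx !mul_mx_diag !mxE eqxx eq_sym (negbTE ij).
  by ring.
by rewrite RintegralZl // => h; lra.
Qed.

(** * Projection, averages and one step of the iteration *)

Lemma convex_set_comb (R : realType) n (K : set 'rV[R]_n) (t : R) x y :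
  convex_set K -> K x -> K y -> 0 <= t <= 1 -> K (t *: x + (1 - t) *: y).
Proof.
move=> cK Kx Ky /andP[t0 t1].
have := cK x y (Itv01 t0 t1) (mem_set Kx) (mem_set Ky).
by move/set_mem.
Qed.

(** * Euclidean projection onto a compact convex set, and convex averages *)

Lemma ler_enorm_dist (R : realType) n (u v : 'rV[R]_n) :
  `|enorm u - enorm v| <= enorm (u - v).
Proof.
have h1 := enorm_triangle (u - v) v; have h2 := enorm_triangle (v - u) u.
rewrite subrK in h1; rewrite subrK -(enormN (v - u)) opprB in h2.
by rewrite ler_norml; apply/andP; split; lra.
Qed.

(** [proj] is a choice with default [x]; a minimizer of the distance exists by compactness, so the
    value chosen is one. *)
Lemma projP (R : realType) n (K : set 'rV[R]_n) (x : 'rV[R]_n) : compact K -> K !=set0 ->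
  K (Defs.proj K x) /\ forall q, K q -> enorm (x - Defs.proj K x) <= enorm (x - q).
Proof.
move=> cK K0.
have [p Kp pP] : exists2 p, p \in K & forall q, q \in K -> enorm (x - p) <= enorm (x - q).
  apply: (@EVT_min_rV _ _ (fun q => enorm (x - q))) => //.
  apply/subspace_continuousP => q _; apply/cvgrPdist_le => eps eps0; rewrite near_withinE.
  have n0 : 0 < (n%:R + 1 : R) by rewrite ltr_wpDl.
  near=> q' => _; apply: le_trans (ler_enorm_dist _ _) _.
  have -> : x - q - (x - q') = q' - q by apply/rowP => i; rewrite !mxE; ring.
  apply: le_trans (ler_enorm_norm _) _.
  have : `|q' - q| <= eps / (n%:R + 1).
    rewrite distrC; near: q'; apply: cvgr_dist_le => //; exact: divr_gt0.
  rewrite ler_pdivlMr // => h; apply: le_trans h.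
  by rewrite mulrC ler_wpM2l // lerDl.
rewrite /Defs.proj; case: xgetP => [q -> //|/(_ p)].
by case; split; [exact/set_mem|move=> q Kq; apply: pP; exact/mem_set].
Unshelve. all: by end_near. Qed.

Lemma dotv_subZ (R : realType) n (a c : 'rV[R]_n) (t : R) :
  dotv (a - t *: c) (a - t *: c) = dotv a a - 2 * t * dotv a c + t ^+ 2 * dotv c c.
Proof. by rewrite !(dotvDl, dotvDr, dotvNl, dotvNr, dotvZl, dotvZr) (dotvC c a); ring. Qed.

Lemma proj_variational (R : realType) n (K : set 'rV[R]_n) (x q : 'rV[R]_n) : compact K ->
  convex_set K -> K q -> dotv (x - Defs.proj K x) (q - Defs.proj K x) <= 0.
Proof.
move=> cK cvK Kq; have [Kp pP] := @projP _ _ K x cK (ex_intro _ q Kq).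
set p := Defs.proj K x in Kp pP *.
rewrite leNgt; apply/negP => h.
pose N := dotv (q - p) (q - p).
have N0 : 0 <= N := dotv_ge0 _.
(* Minimality against p + t (q - p) gives 2 <x - p, q - p> <= t N, while this [t] satisfies t (N +
   1) <= <x - p, q - p>; together they contradict positivity. *)
pose t := Num.min 1 (dotv (x - p) (q - p) / (N + 1)).
have t0 : 0 < t by rewrite lt_min ltr01 divr_gt0 // ltr_wpDl.
have t1 : t <= 1 by rewrite /t ge_min lexx.
have t2 : t * (N + 1) <= dotv (x - p) (q - p).
  by rewrite -ler_pdivlMr ?ltr_wpDl // /t ge_min lexx orbT.
have Kt : K (t *: q + (1 - t) *: p) by apply: convex_set_comb; rewrite ?(ltW t0).
have := pP _ Kt; rewrite -ler_sqr ?nnegrE ?enorm_ge0 // !enorm_sqr.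
have -> : x - (t *: q + (1 - t) *: p) = (x - p) - t *: (q - p).
  by apply/rowP => i; rewrite !mxE; ring.
have E : dotv (x - p - t *: (q - p)) (x - p - t *: (q - p)) =
    dotv (x - p) (x - p) - 2 * t * dotv (x - p) (q - p) + t ^+ 2 * N.
  exact: dotv_subZ.
rewrite E => h1.
have h2 : 2 * dotv (x - p) (q - p) <= t * N.
  by rewrite -(ler_pM2l t0); move: h1; rewrite expr2; lra.
by move: h2 t2 h; nra.
Qed.

(** The variational inequalities at the two projections, each tested with the other, add up to |p -
    q|^2 <= <x - y, p - q>; Cauchy-Schwarz concludes. *)
Lemma proj_nonexpansive (R : realType) n (K : set 'rV[R]_n) (x y : 'rV[R]_n) :
  compact K -> convex_set K -> K !=set0 -> enorm (Defs.proj K x - Defs.proj K y) <= enorm (x - y).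
Proof.
move=> cK cvK K0.
have [Kp _] := projP x cK K0; have [Kq _] := projP y cK K0.
have h1 := proj_variational x cK cvK Kq; have h2 := proj_variational y cK cvK Kp.
move: (Defs.proj K x) (Defs.proj K y) h1 h2 {Kp Kq} => p q h1 h2.
have h3 : dotv (p - q) (p - q) <= dotv (x - y) (p - q).
  move: h1 h2; rewrite !(dotvDl, dotvDr, dotvNl, dotvNr) (dotvC q p); lra.
have h4 := le_trans h3 (le_trans (ler_norm _) (ler_normr_dotv _ _)).
move: h4; rewrite -enorm_sqr expr2.
have [->|e0] := eqVneq (enorm (p - q)) 0; first by rewrite enorm_ge0.
by rewrite ler_pM2r // lt_neqAle eq_sym e0 enorm_ge0.
Qed.

Lemma proj_id (R : realType) n (K : set 'rV[R]_n) (x : 'rV[R]_n) :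
  compact K -> K x -> Defs.proj K x = x.
Proof.
move=> cK Kx; have [_ /(_ _ Kx)] := projP x cK (ex_intro _ x Kx).
rewrite subrr -(scale0r (0 : 'rV[R]_n)) [leRHS]enormZ normr0 mul0r => h.
apply/esym/eqP; rewrite -subr_eq0; apply/eqP/dotv_eq0.
by rewrite -enorm_sqr; apply/eqP; rewrite sqrf_eq0 eq_le h enorm_ge0.
Qed.

Lemma convex_set_average (R : realType) n (K : set 'rV[R]_n) (x : nat -> 'rV[R]_n) N :
  convex_set K -> (forall k, K (x k)) -> K (N.+1%:R^-1 *: \sum_(k < N.+1) x k).
Proof.
move=> cK Kx; elim: N => [|N IH]; first by rewrite big_ord1 invr1 scale1r.
have -> : N.+2%:R^-1 *: \sum_(k < N.+2) x k =
   (N.+1%:R / N.+2%:R) *: (N.+1%:R^-1 *: \sum_(k < N.+1) x k) + (1 - N.+1%:R / N.+2%:R) *: x N.+1.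
  rewrite big_ord_recr /= scalerDr scalerA; congr (_ *: _ + _ *: _).
    by rewrite mulrAC mulfV ?mul1r // pnatr_eq0.
  have E : N.+2%:R = N.+1%:R + 1 :> R by rewrite natr1.
  have : N.+1%:R + 1 != 0 :> R by rewrite natr1 pnatr_eq0.
  by rewrite E; move: (N.+1%:R : R) => a a0; field.
apply: convex_set_comb => //.
by rewrite divr_ge0 //= ler_pdivrMr // mul1r ler_nat.
Qed.

(** Jensen's inequality from the tangent at the average: in the sum of the gradient inequalities
    there, the linear terms cancel. *)
Lemma strongly_convex_average (R : realType) n (D K : set 'rV[R]_n) (f : 'rV[R]_n -> R)
  (tau : R) (x : nat -> 'rV[R]_n) N : strongly_convex_on D f tau -> 0 <= tau ->
  convex_set K -> K `<=` D -> (forall k, K (x k)) ->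
  f (N.+1%:R^-1 *: \sum_(k < N.+1) x k) <= N.+1%:R^-1 * \sum_(k < N.+1) f (x k).
Proof.
move=> sc tau0 cK KD Kx; set xb := _ *: _.
have Kxb : K xb by exact: (@convex_set_average _ _ K x N).
have h k : f xb + dotv (grad f xb) (x k - xb) <= f (x k).
  apply: le_trans (sc _ _ (KD _ Kxb) (KD _ (Kx k))).
  by rewrite lerDl mulr_ge0 ?sqr_ge0 // divr_ge0.
rewrite ler_pdivlMl //.
have -> : N.+1%:R * f xb = \sum_(k < N.+1) (f xb + dotv (grad f xb) (x k - xb)).
  rewrite big_split /= sumr_const card_ord -dotv_sumr.
  rewrite sumrB sumr_const card_ord (_ : \sum_(k < N.+1) x k = xb *+ N.+1).
    by rewrite subrr -(scale0r (0 : 'rV[R]_n)) dotvZr mul0r addr0 mulr_natl.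
  by rewrite /xb -scaler_nat scalerA mulfV ?scale1r // pnatr_eq0.
by apply: ler_sum => k _; exact: h.
Qed.

(** The bias estimate holds for radii up to some [s], whereas the algorithm may use radii up to [b].
    Between [s] and [b] the crude bounds are divided by a power of [s], which costs only a larger
    constant. *)
Lemma oracle_bounds (R : realType) n (D : set 'rV[R]_n) (f : 'rV[R]_n -> R)
  (F : 'rV[R[i]]_n -> R[i]) (K : set 'rV[R]_n) (b dbar : R) : open D -> 0 < b -> b < dbar ->
  holomorphic_extension D f dbar F -> compact K -> K `<=` D ->
  exists2 C : R, 0 <= C & forall x u del, K x -> @sphere R n u -> 0 < del -> del <= b ->
    [/\ `|complex.Im (F (cpt x (del *: u))) - del * dotv (grad f x) u| <= C * del ^+ 3,
     `|complex.Im (F (cpt x (del *: u)))| <= C * del & `|dotv (grad f x) u| <= C].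
Proof.
move=> oD b0 bd hF cK KD.
have [s [C0 [s0 C00 H]]] := gradient_bias oD (ltW b0) bd hF cK KD.
have [r [M [r0 M0 B]]] := strip_uniform_bound oD (ltW b0) bd hF.1 cK KD.
have ImM x u del : K x -> @sphere R n u -> 0 < del -> del <= b ->
    `|complex.Im (F (cpt x (del *: u)))| <= M.
  move=> Kx Su d0 db; apply: le_trans (ler_normIm _) _.
  apply: (B x (del *: u) _ _ Kx _ _ _).2; rewrite ?subrr ?normr0 ?(ltW r0) // => j.
  rewrite mxE normrM gtr0_norm // -[b]mulr1 ler_pM // ?(ltW d0) //.
  by rewrite -(Su : enorm u = 1) ler_coord_enorm.
pose t := Num.min s b.
have t0 : 0 < t by rewrite lt_min s0.
have [ts tb] : t <= s /\ t <= b by rewrite /t !ge_min !lexx orbT.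
(* The bias estimate read backwards at the fixed radius [t]: it bounds the directional derivative by
   oracle values. *)
pose G := (M + C0 * t ^+ 3) / t.
have G0 : 0 <= G by rewrite divr_ge0 ?(ltW t0) // addr_ge0 // mulr_ge0 // exprn_ge0 // ltW.
have GP x u : K x -> @sphere R n u -> `|dotv (grad f x) u| <= G.
  move=> Kx Su; rewrite /G ler_pdivlMr // mulrC -{1}(gtr0_norm t0) -normrM.
  have h1 := H x u t Kx Su t0 ts; have h2 := ImM x u t Kx Su t0 tb.
  have := ler_normB (complex.Im (F (cpt x (t *: u))))
    (complex.Im (F (cpt x (t *: u))) - t * dotv (grad f x) u).
  by rewrite opprB addrC subrK; lra.
have p1 : 0 <= (M + b * G) / s ^+ 3.
  by rewrite divr_ge0 ?exprn_ge0 ?(ltW s0) // addr_ge0 // mulr_ge0 // ltW.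
have p2 : 0 <= C0 * b ^+ 2 by rewrite mulr_ge0 ?sqr_ge0.
have p3 : 0 <= M / s by rewrite divr_ge0 // ltW.
exists (C0 + (M + b * G) / s ^+ 3 + G + C0 * b ^+ 2 + M / s); first by rewrite !addr_ge0.
move=> x u del Kx Su d0 db.
have g := GP x u Kx Su; have im := ImM x u del Kx Su d0 db.
have d3 : 0 < del ^+ 3 by rewrite exprn_gt0.
split; last by lra.
- have [ds|sd] := leP del s.
    apply: le_trans (H x u del Kx Su d0 ds) _; rewrite ler_pM2r //; lra.
  apply: (@le_trans _ _ (M + b * G)).
    apply: le_trans (ler_normB _ _) _; apply: lerD => //.
    by rewrite normrM gtr0_norm // ler_pM // ltW.
  apply: (@le_trans _ _ ((M + b * G) / s ^+ 3 * del ^+ 3)); last by rewrite ler_pM2r //; lra.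
  have q0 : 0 <= M + b * G by rewrite addr_ge0 // mulr_ge0 // ltW.
  rewrite -mulrA ler_peMr //.
  rewrite mulrC ler_pdivlMr ?exprn_gt0 // mul1r.
  by apply: lerXn2r; rewrite ?nnegrE ltW.
- have [ds|sd] := leP del s.
    have h := H x u del Kx Su d0 ds.
    apply: (@le_trans _ _ (del * G + C0 * b ^+ 2 * del)).
      rewrite -(subrK (del * dotv (grad f x) u) (complex.Im _)) addrC.
      apply: le_trans (ler_normD _ _) _; apply: lerD.
        by rewrite normrM gtr0_norm // ler_pM2l.
      apply: le_trans h _; rewrite exprSr mulrA ler_pM2r // ler_wpM2l //.
      by apply: lerXn2r => //; rewrite nnegrE ltW.
    by rewrite [del * G]mulrC -mulrDl ler_pM2r //; lra.
  apply: (@le_trans _ _ (M / s * del)); last by rewrite ler_pM2r //; lra.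
  apply: le_trans im _; rewrite -mulrA ler_peMr // mulrC ler_pdivlMr // mul1r ltW //.
Qed.

(** Nonexpansiveness of the projection bounds the new squared distance by its expansion, which is
    solved for the inner product of estimator and error. The terms of mean zero are kept exactly,
    since absolute values would destroy the cancellation. *)
Lemma zo_step_descent (R : realType) n (D K : set 'rV[R]_n) (f : 'rV[R]_n -> R)
  (F : 'rV[R[i]]_n -> R[i]) (tau C k del xi : R) (x xs u y : 'rV[R]_n) :
  strongly_convex_on D f tau -> 0 < tau -> compact K -> convex_set K -> K `<=` D ->
  K x -> K xs -> @sphere R n u -> 0 < del -> 0 < k -> 0 <= C ->
  `|complex.Im (F (cpt x (del *: u))) - del * dotv (grad f x) u| <= C * del ^+ 3 ->
  `|complex.Im (F (cpt x (del *: u)))| <= C * del ->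
  y = zo_step F K (2 / (tau * k)) del x u xi ->
  f x - f xs <= tau / 4 * ((k - 1) * dotv (x - xs) (x - xs))
    - tau / 4 * (k * dotv (y - xs) (y - xs))
    + ((n%:R * C * del ^+ 2) ^+ 2 / tau
      + 2 * n%:R ^+ 2 / (tau * k) * (C ^+ 2 + xi ^+ 2 / del ^+ 2))
    - (n%:R * dotv (grad f x) u * dotv u (x - xs) - dotv (grad f x) (x - xs)
       + n%:R / del * (dotv u (x - xs) * xi)).
Proof.
move=> sc tau0 cK cvK KD Kx Ks u1 d0 k0 C0 hE hI yE.
set I := complex.Im _ in hE hI *; set G := dotv (grad f x) u in hE *.
set s := dotv u _; set p := dotv (grad f x) (x - xs); set r := dotv (x - xs) _.
set r' := dotv (y - xs) _; set N : R := n%:R.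
have aux (a b c m g : R) : 0 < m -> b <= a - 2 * m * c + m ^+ 2 * g ->
    c <= (a - b + m ^+ 2 * g) / (2 * m).
  by clear=> m0 h; rewrite ler_pdivlMr ?mulr_gt0 //; lra.
have N0 : 0 <= N by [].
have tk0 : 0 < tau * k by rewrite mulr_gt0.
pose mu := 2 / (tau * k); pose gg := N / del * (I + xi).
have mu0 : 0 < mu by rewrite divr_gt0.
have scx : f x - f xs <= p - tau / 2 * r.
  have := sc _ _ (KD _ Kx) (KD _ Ks); rewrite enorm_sqr.
  have -> : xs - x = - (x - xs) by rewrite opprB.
  by rewrite dotvNl dotvNr dotvNr opprK -/p -/r; lra.
have uu : dotv u u = 1 by rewrite -enorm_sqr (u1 : enorm u = 1) expr1n.
have hr : r' <= r - 2 * mu * (gg * s) + mu ^+ 2 * gg ^+ 2.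
  have := @proj_nonexpansive _ _ K (x - mu *: (gg *: u)) xs cK cvK (ex_intro _ x Kx).
  rewrite (proj_id cK Ks) /r' yE -ler_sqr ?nnegrE ?enorm_ge0 // !enorm_sqr => /le_trans; apply.
  have -> : x - mu *: (gg *: u) - xs = (x - xs) - (mu * gg) *: u.
    by rewrite scalerA addrAC.
  by rewrite dotv_subZ uu (dotvC (x - xs) u) -/r -/s; lra.
have rE : r = enorm (x - xs) ^+ 2 by rewrite enorm_sqr.
have sb : `|s| <= enorm (x - xs).
  by apply: le_trans (ler_normr_dotv _ _) _; rewrite (u1 : enorm u = 1) mul1r.
pose E := I - del * G.
(* The estimator against the error: true gradient, fluctuation of the direction, noise, and the bias
   [E]. *)
have hg : gg * s = p + (N * G * s - p + N / del * (s * xi)) + N / del * E * s.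
  by rewrite /gg /E; field; rewrite gt_eqF.
have hB : - (N * C * del ^+ 2 * enorm (x - xs)) <= N / del * E * s.
  have : `|N / del * E * s| <= N * C * del ^+ 2 * enorm (x - xs).
    rewrite normrM; apply: ler_pM => //.
    rewrite normrM ger0_norm ?divr_ge0 ?(ltW d0) //.
    have -> : N * C * del ^+ 2 = N / del * (C * del ^+ 3) by field; rewrite gt_eqF.
    by rewrite ler_wpM2l // divr_ge0 // ltW.
  by rewrite ler_norml => /andP[].
(* Young's inequality with this weight spends half of the [tau / 2 * r] that strong convexity
   provides. *)
have amgm : N * C * del ^+ 2 * enorm (x - xs) <= (N * C * del ^+ 2) ^+ 2 / tau + tau / 4 * r.
  rewrite rE; move: (N * C * del ^+ 2) (enorm (x - xs)) => b e.
  have -> : b ^+ 2 / tau + tau / 4 * e ^+ 2 = (b - tau / 2 * e) ^+ 2 / tau + b * e.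
    by field; rewrite gt_eqF.
  by rewrite lerDr divr_ge0 ?sqr_ge0 // ltW.
have hgg : gg ^+ 2 <= 2 * N ^+ 2 * (C ^+ 2 + xi ^+ 2 / del ^+ 2).
  have I2 : I ^+ 2 <= C ^+ 2 * del ^+ 2.
    by rewrite -exprMn -(real_normK (num_real I)) lerXn2r // nnegrE mulr_ge0 // ltW.
  have Ix : (I + xi) ^+ 2 <= 2 * (C ^+ 2 * del ^+ 2 + xi ^+ 2).
    have : 0 <= (I - xi) ^+ 2 := sqr_ge0 _.
    by rewrite !expr2 in I2 *; lra.
  rewrite /gg exprMn.
  have -> : 2 * N ^+ 2 * (C ^+ 2 + xi ^+ 2 / del ^+ 2) =
     (N / del) ^+ 2 * (2 * (C ^+ 2 * del ^+ 2 + xi ^+ 2)) by field; rewrite gt_eqF.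
  by rewrite ler_wpM2l // sqr_ge0.
have hgs : gg * s <= tau * k / 4 * (r - r') + 1 / (tau * k) * gg ^+ 2.
  have -> : tau * k / 4 * (r - r') + 1 / (tau * k) * gg ^+ 2 =
     (r - r' + mu ^+ 2 * gg ^+ 2) / (2 * mu).
    by rewrite /mu; field; rewrite !gt_eqF.
  exact: aux.
have hgg2 : 1 / (tau * k) * gg ^+ 2 <= 2 * N ^+ 2 / (tau * k) * (C ^+ 2 + xi ^+ 2 / del ^+ 2).
  have -> : 2 * N ^+ 2 / (tau * k) * (C ^+ 2 + xi ^+ 2 / del ^+ 2) =
     1 / (tau * k) * (2 * N ^+ 2 * (C ^+ 2 + xi ^+ 2 / del ^+ 2)).
    by field; rewrite !gt_eqF.
  by rewrite ler_wpM2l // divr_ge0 // ltW.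
move: scx hg hB amgm hgs hgg2.
set eta := N * G * s - p + _; set X1 := N / del * E * s; set X2 := N * C * del ^+ 2 * _.
set X3 := _ ^+ 2 / tau; set X4 := 2 * N ^+ 2 / _ * _; set X5 := 1 / _ * _.
have -> : tau / 4 * ((k - 1) * r) - tau / 4 * (k * r') = tau * k / 4 * (r - r') - tau / 4 * r.
  by ring.
have : tau / 2 * r = 2 * (tau / 4 * r) by field.
move: (tau * k / 4 * (r - r')) (tau / 4 * r) (tau / 2 * r) => Y1 Y2 Y3.
move: (f x) (f xs) p eta (gg * s) X1 X2 X3 X4 X5 => fx fs p' eta' gs x1 x2 x3 x4 x5.
by lra.
Qed.

(** * Measurability of the iterates and bounds in expectation *)

Lemma enorm_evec (R : realType) n (i : 'I_n) : enorm (evec R i) = 1.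
Proof.
rewrite /enorm /dotv (bigD1 i) //= big1 ?addr0 => [|j ji].
  by rewrite !mxE eqxx mulr1 sqrtr1.
by rewrite !mxE eq_sym (negbTE ji) mul0r.
Qed.

Lemma dotv_evec (R : realType) n (v : 'rV[R]_n) i : dotv v (evec R i) = v 0 i.
Proof.
rewrite /dotv (bigD1 i) //= big1 ?addr0 => [|j ji].
  by rewrite !mxE eqxx mulr1.
by rewrite !mxE eq_sym (negbTE ji) mulr0.
Qed.

Lemma measurable_oracle d (T : measurableType d) (R : realType) n (D K : set 'rV[R]_n)
  (F : 'rV[R[i]]_n -> R[i]) (b dbar del : R) (X U : T -> 'rV[R]_n) : b < dbar ->
  holomorphic_on (cstrip D dbar) F -> K `<=` D ->
  0 < del -> del <= b ->
  (forall i, measurable_fun setT (fun w => X w 0 i)) ->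
  (forall i, measurable_fun setT (fun w => U w 0 i)) ->
  (forall w, K (X w)) -> (forall w, @sphere R n (U w)) ->
  measurable_fun setT (fun w => complex.Im (F (cpt (X w) (del *: U w)))).
Proof.
move=> bd hF KD d0 db mX mU KX SU.
apply: (@measurable_continuous_comp2 _ _ _ _ X U K (@sphere R n)
  (fun x u => complex.Im (F (cpt x (del *: u))))) => // x u Kx Su eps eps0.
have st : cstrip D dbar (cpt x (del *: u)).
  apply/cstrip_cpt; split; first exact: KD.
  move=> j; apply: le_lt_trans bd; rewrite mxE normrM gtr0_norm // -[b]mulr1.
  by apply: ler_pM => //; [exact: ltW|rewrite -(Su : enorm u = 1) ler_coord_enorm].
have [e [e0 eP]] := cdifferentiable_continuous (hF _ st) eps0.
exists (Num.min e (e / del)); split; first by rewrite lt_min e0 divr_gt0.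
move=> x' u' _ _; rewrite !lt_min => /andP[xe _] /andP[_ ue].
rewrite -cImN -cImD; apply: le_trans (ler_normIm _) (eP _ _ xe _).
rewrite -scalerBr normrZ gtr0_norm // mulrC -ltr_pdivlMr //.
Qed.

Lemma measurable_objective d (T : measurableType d) (R : realType) n (D K : set 'rV[R]_n)
  (f : 'rV[R]_n -> R) (F : 'rV[R[i]]_n -> R[i]) (dbar : R) (X : T -> 'rV[R]_n) : 0 < dbar ->
  holomorphic_extension D f dbar F -> K `<=` D ->
  (forall i, measurable_fun setT (fun w => X w 0 i)) -> (forall w, K (X w)) ->
  measurable_fun setT (fun w => f (X w)).
Proof.
move=> bd [hF Ff] KD mX KX.
apply: (@measurable_continuous_comp _ _ _ _ X K f) => // x Kx eps eps0.
have st : cstrip D dbar (cpt x 0).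
  by apply/cstrip_cpt; split; [exact: KD|move=> j; rewrite mxE normr0].
have [e [e0 eP]] := cdifferentiable_continuous (hF _ st) eps0.
exists e; split=> // y Ky yx; have := eP y 0 yx; rewrite subrr normr0 => /(_ e0).
rewrite !Ff; [|exact: KD|exact: KD].
by rewrite -rmorphB cabs_real.
Qed.

Lemma measurable_grad d (T : measurableType d) (R : realType) n (D K : set 'rV[R]_n)
  (f : 'rV[R]_n -> R) (F : 'rV[R[i]]_n -> R[i]) (b dbar C : R) (X : T -> 'rV[R]_n) i :
  0 < b -> b < dbar -> 0 <= C ->
  holomorphic_on (cstrip D dbar) F -> K `<=` D ->
  (forall x u del, K x -> @sphere R n u -> 0 < del -> del <= b ->
    `|complex.Im (F (cpt x (del *: u))) - del * dotv (grad f x) u| <= C * del ^+ 3) ->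
  (forall i, measurable_fun setT (fun w => X w 0 i)) -> (forall w, K (X w)) ->
  measurable_fun setT (fun w => grad f (X w) 0 i).
Proof.
move=> b0 bd C0 hF KD H mX KX.
pose t m : R := b / m.+1%:R.
have t0 m : 0 < t m by rewrite divr_gt0.
have tb m : t m <= b.
  by rewrite ler_pdivrMr // ler_peMr ?(ltW b0) // ler1n.
(* The gradient is the pointwise limit of oracle values as the radius tends to [0]. *)
pose h m w := (t m)^-1 * complex.Im (F (cpt (X w) (t m *: evec R i))).
apply: (@measurable_fun_cvg _ _ _ setT h).
  move=> m; apply: measurable_funM; first exact: measurable_cst.
  apply: (@measurable_oracle _ _ _ _ D K F b dbar (t m) X (fun=> evec R i)) => //.
  by move=> _; exact: enorm_evec.
move=> w _; apply/cvgrPdist_le => eps eps0; near=> m.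
have := H (X w) (evec R i) (t m) (KX w) (enorm_evec R i) (t0 m) (tb m).
rewrite dotv_evec => h1.
have -> : grad f (X w) 0 i - h m w = - ((t m)^-1 *
    (complex.Im (F (cpt (X w) (t m *: evec R i))) - t m * grad f (X w) 0 i)).
  by rewrite /h; field; rewrite gt_eqF.
rewrite normrN normrM gtr0_norm ?invr_gt0 // ler_pdivrMl //.
apply: le_trans h1 _; rewrite mulrC [_ ^+ 3]exprS -mulrA ler_pM2l //.
apply: (@le_trans _ _ (b * t m * C)).
  by rewrite ler_wpM2r // expr2 ler_wpM2r // ltW.
have cb : 0 <= C * b * b by rewrite !mulr_ge0 // ltW.
rewrite /t (_ : b * (b / m.+1%:R) * C = C * b * b / m.+1%:R); last by ring.
rewrite ler_pdivrMr // -ler_pdivrMl //.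
apply: ltW; apply: lt_le_trans (archi_boundP _) _.
  by rewrite mulr_ge0 // invr_ge0 ltW.
rewrite ler_nat; apply: leqW; near: m; exact: nbhs_infty_ge.
Unshelve. all: by end_near. Qed.

Lemma measurable_proj d (T : measurableType d) (R : realType) n (K : set 'rV[R]_n)
  (V : T -> 'rV[R]_n) i : compact K -> convex_set K -> K !=set0 ->
  (forall i, measurable_fun setT (fun w => V w 0 i)) ->
  measurable_fun setT (fun w => Defs.proj K (V w) 0 i).
Proof.
move=> cK cvK K0 mV.
apply: (@measurable_continuous_comp _ _ _ _ V setT (fun v => Defs.proj K v 0 i)) => //.
move=> x _ eps eps0; have n1 : 0 < (n%:R + 1 : R) by rewrite ltr_wpDl.
exists (eps / (n%:R + 1)); split; first exact: divr_gt0.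
move=> y _; rewrite ltr_pdivlMr // => yx.
have := ler_coord_enorm (Defs.proj K y - Defs.proj K x) i; rewrite !mxE => /le_trans; apply.
apply: le_trans (proj_nonexpansive _ _ cK cvK K0) _.
apply: le_trans (ler_enorm_norm _) _; apply: le_trans (ltW yx).
by rewrite mulrC ler_wpM2l // lerDl.
Qed.

Lemma zo_iterates_in (R : realType) n T (F : 'rV[R[i]]_n -> R[i]) (K : set 'rV[R]_n) x1
  (mu del : nat -> R) (u : nat -> T -> 'rV[R]_n) (xi : nat -> T -> R) k w :
  compact K -> K x1 -> K (zo_iterates F K x1 mu del u xi k w).
Proof.
move=> cK Kx1; case: k => [|k] //=.
by exact: (projP _ cK (ex_intro _ x1 Kx1)).1.
Qed.

(** Only the variables of rounds 1 to [k] are assumed measurable, over an arbitrary [T]; the lemma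
    thus applies also with the sigma-algebra generated by the past. *)
Lemma measurable_zo_iterates d (T : measurableType d) (R : realType) n (D K : set 'rV[R]_n)
  (F : 'rV[R[i]]_n -> R[i]) (b dbar : R) x1 (mu del : nat -> R)
  (u : nat -> T -> 'rV[R]_n) (xi : nat -> T -> R) k : b < dbar ->
  holomorphic_on (cstrip D dbar) F -> K `<=` D -> compact K -> convex_set K -> K x1 ->
  (forall j, 0 < del j.+1 <= b) -> (forall j w, @sphere R n (u j w)) ->
  (forall j, (0 < j <= k)%N -> measurable_fun setT (xi j) /\
     forall i, measurable_fun setT (fun w => u j w 0 i)) ->
  forall i, measurable_fun setT (fun w => zo_iterates F K x1 mu del u xi k w 0 i).
Proof.
move=> bd hF KD cK cvK Kx1 delb Su; elim: k => [|k IH] m i; first exact: measurable_cst.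
have {}IH : forall i, measurable_fun setT (fun w => zo_iterates F K x1 mu del u xi k w 0 i).
  by apply: IH => j /andP[j0 jk]; apply: m; rewrite j0 /= leqW.
have [mxi mu'] := m k.+1 (leqnn _).
have /andP[d0 db] := delb k.
apply: measurable_proj => //; first by exists x1.
move=> j; under eq_fun do rewrite !mxE.
apply: measurable_funB; first exact: IH.
apply: measurable_funM; first exact: measurable_cst.
apply: measurable_funM; last exact: mu'.
apply: measurable_funM; first exact: measurable_cst.
apply: measurable_funD => //.
apply: (@measurable_oracle _ _ _ _ D K F b dbar) => //.
by move=> w; exact: zo_iterates_in.
Qed.

(** * Summation of the rate k^(-2/3) *)

Lemma cube_gap (R : realFieldType) (a c : R) : 0 < a -> 0 <= c -> c <= a ->
  a ^+ 3 - c ^+ 3 = 1 -> (a ^+ 2)^-1 <= 3 * (a - c).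
Proof.
move=> a0 c0 ca ac; rewrite -[leLHS]mul1r ler_pdivrMr ?exprn_gt0 //.
apply: (@le_trans _ _ (a ^+ 3 - c ^+ 3)); first by rewrite ac.
have -> : a ^+ 3 - c ^+ 3 = (a - c) * (a ^+ 2 + a * c + c ^+ 2) by ring.
rewrite [3 * (a - c)]mulrC -mulrA ler_wpM2l ?subr_ge0 //.
have h1 : a * c <= a ^+ 2 by rewrite expr2 ler_pM2l.
have h2 : c ^+ 2 <= a ^+ 2 by rewrite lerXn2r ?nnegrE // ltW.
by lra.
Qed.

(** Consecutive cube roots c < a satisfy a^3 - c^3 = 1, hence a^(-2) <= 3 (a - c), and the
    right-hand sides telescope. *)
Lemma sum_powR_le (R : realType) N :
  \sum_(k < N) (k.+1%:R : R) `^ (- (2 / 3)) <= 3 * N%:R `^ (3^-1).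
Proof.
have cube (m : nat) : (m%:R `^ (3^-1) : R) ^+ 3 = m%:R.
  by rewrite -powR_mulrn ?powR_ge0 // -powRrM mulVf ?powRr1.
elim: N => [|N IH]; first by rewrite big_ord0 mulr_ge0 // powR_ge0.
rewrite big_ord_recr /=; apply: le_trans (lerD IH (lexx _)) _.
have -> : (N.+1%:R : R) `^ (- (2 / 3)) = ((N.+1%:R `^ (3^-1)) ^+ 2)^-1.
  by rewrite powRN -powR_mulrn ?powR_ge0 // -powRrM mulrC.
have a0 : 0 < (N.+1%:R : R) `^ (3^-1) by rewrite powR_gt0.
have b0 : 0 <= (N%:R : R) `^ (3^-1) by rewrite powR_ge0.
have ba : (N%:R : R) `^ (3^-1) <= N.+1%:R `^ (3^-1).
  by apply: ge0_ler_powR; rewrite ?nnegrE ?invr_ge0 // ler_nat.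
rewrite -lerBrDl -mulrBr; apply: cube_gap => //.
by rewrite !cube -natr1 addrAC subrr add0r.
Qed.

(** [X] is a function of the variables indexed by [J], [Y] of a further one: this stands in for
    conditioning on the past. *)
Lemma indep_mean_zero d (T : measurableType d) (R : realType) (P : probability T R)
  (I : choiceType) (E : I -> set (set T)) (J : set I) (i : I) (X Y : T -> R) (M : R) :
  mutually_independent P E ->
  (forall j, E j setT) -> (forall j, setI_closed (E j)) ->
  (forall j, E j `<=` measurable) -> ~ J i ->
  measurable_fun setT (X : g_sigma_algebraType (\bigcup_(j in J) E j) -> R) ->
  (forall w, `|X w| <= M) ->
  (forall B, measurable B -> E i (Y @^-1` B)) ->
  P.-integrable setT (EFin \o Y) -> \int[P]_w Y w = 0 ->
  P.-integrable setT (EFin \o (fun w => X w * Y w)) /\ \int[P]_w (X w * Y w) = 0.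
Proof.
move=> indep ET EI Em Ji mX XM EY iY Y0.
have GX B : measurable B -> <<s \bigcup_(j in J) E j >> (X @^-1` B).
  by move=> mB; have := mX measurableT B mB; rewrite setTI.
have mX' : measurable_fun setT X.
  move=> _ B mB; rewrite setTI.
  apply: (smallest_sub (@sigma_algebra_measurable _ T) _ (GX B mB)).
  by move=> A [j _]; exact: Em.
have mY : measurable_fun setT Y.
  by move=> _ B mB; rewrite setTI; apply: (Em i); exact: EY.
apply: (probability_indep_Rintegral_mul0 mX' mY XM iY Y0) => A B mA mB.
by apply: (mutually_independent_generated indep ET EI Em Ji); [exact: GX|exact: EY].
Qed.

(** * Integrable variables with a bound on the mean *)

Lemma bounded_integrable d (T : measurableType d) (R : realType) (P : probability T R)
  (Y : T -> R) (M : R) : measurable_fun setT Y -> (forall w, `|Y w| <= M) ->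
  P.-integrable setT (EFin \o Y).
Proof.
move=> mY YM; have := @measurable_bounded_integrable _ _ _ P Y setT measurableT.
rewrite /= probability_setT ltry => /(_ isT) h; apply: h => //.
exists M; split; first by rewrite num_real.
by move=> M' MM' w _ /=; rewrite (le_trans (YM w)) // ltW.
Qed.

(** Integrability is part of the predicate because the real-valued integral of a non-integrable
    function may be a default 0; with it the bounds add and scale. *)
Definition int_le d (T : measurableType d) (R : realType) (P : probability T R)
  (Z : T -> R) (c : R) : Prop :=
  P.-integrable setT (EFin \o Z) /\ \int[P]_w Z w <= c.

Lemma int_leD d (T : measurableType d) (R : realType) (P : probability T R)
  (Z Z' : T -> R) (c c' : R) : int_le P Z c -> int_le P Z' c' ->
  int_le P (fun w => Z w + Z' w) (c + c').
Proof.
move=> [i h] [i' h']; split; last by rewrite RintegralD // lerD.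
by have := integrableD measurableT i i'; apply: eq_integrable.
Qed.

Lemma int_leZ d (T : measurableType d) (R : realType) (P : probability T R)
  (Z : T -> R) (c a : R) : 0 <= a -> int_le P Z c -> int_le P (fun w => a * Z w) (a * c).
Proof.
move=> a0 [i h]; split; last by rewrite RintegralZl // ler_wpM2l.
by have := integrableZl measurableT a i; apply: eq_integrable.
Qed.

Lemma int_le_cst d (T : measurableType d) (R : realType) (P : probability T R) (c : R) :
  int_le P (fun=> c) c.
Proof.
split; first by apply: (@bounded_integrable _ _ _ _ _ `|c|) => //; exact: measurable_cst.
by rewrite /Rintegral integral_cst //= probability_setT mule1.
Qed.

Lemma int_le_sum d (T : measurableType d) (R : realType) (P : probability T R)
  (I : Type) (s : seq I) (Z : I -> T -> R) (c : I -> R) : (forall k, int_le P (Z k) (c k)) ->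
  int_le P (fun w => \sum_(k <- s) Z k w) (\sum_(k <- s) c k).
Proof.
move=> h; elim: s => [|k s IH].
  by under eq_fun do rewrite big_nil; rewrite big_nil; exact: int_le_cst.
by under eq_fun do rewrite big_cons; rewrite big_cons; exact: int_leD.
Qed.

(** Links the extended-valued expectation of the final claim to [int_le], through a pointwise
    majorant of a nonnegative variable. *)
Lemma expectation_int_le d (T : measurableType d) (R : realType) (P : probability T R)
  (Y Z : T -> R) (c : R) : measurable_fun setT Y -> (forall w, 0 <= Y w) ->
  (forall w, Y w <= Z w) -> int_le P Z c -> ('E_P[Y] <= c%:E)%E.
Proof.
move=> mY Y0 YZ [iZ Zc]; rewrite unlock.
apply: (@le_trans _ _ (\int[P]_w (Z w)%:E)%E).
  apply: ge0_le_integral => //.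
  - by move=> w _; rewrite lee_fin.
  - exact/measurable_EFinP.
  - by case/integrableP : iZ.
  - by move=> w _; rewrite lee_fin.
by rewrite -(fineK (integrable_fin_num measurableT iZ)) lee_fin.
Qed.

Lemma int_le_square d (T : measurableType d) (R : realType) (P : probability T R)
  (X : T -> R) (sigma : R) : measurable_fun setT X ->
  ('E_P[X ^+ 2] <= sigma%:E)%E -> int_le P (fun w => X w ^+ 2) sigma.
Proof.
move=> mX; rewrite unlock => h.
have h' : (\int[P]_w (X w ^+ 2)%:E <= sigma%:E)%E by [].
have iX : P.-integrable setT (EFin \o (fun w => X w ^+ 2)).
  apply/integrableP; split; first by apply/measurable_EFinP; exact: measurable_funX.
  apply: le_lt_trans (ltry sigma); apply: le_trans h'.
  under eq_integral do rewrite /= ger0_norm ?sqr_ge0 //.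
  by [].
split=> //.
by rewrite -lee_fin fineK //; exact: integrable_fin_num.
Qed.

Lemma integrable_of_square d (T : measurableType d) (R : realType) (P : probability T R)
  (X : T -> R) (sigma : R) : measurable_fun setT X ->
  int_le P (fun w => X w ^+ 2) sigma -> P.-integrable setT (EFin \o X).
Proof.
move=> mX [iX _]; have [i1 _] := int_leD (int_le_cst P 1) (conj iX (lexx _)).
apply: le_integrable i1 => //; first exact/measurable_EFinP.
move=> w _ /=; rewrite lee_fin [leRHS]ger0_norm ?addr_ge0 ?sqr_ge0 //.
rewrite -(real_normK (num_real (X w))); move: `|X w| => a.
have : 0 <= (a - 1) ^+ 2 := sqr_ge0 _.
have : 0 <= a ^+ 2 := sqr_ge0 _.
by rewrite sqrrB expr1n mulr1 mulr2n; lra.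
Qed.

(** * Mean-zero terms and the expected gap *)

Lemma dir_noise_events_setT d (T : measurableType d) (R : realType) n
  (u : nat -> T -> 'rV[R]_n) (xi : nat -> T -> R) i : dir_noise_events u xi i setT.
Proof.
case: i => k /=; exists setT; rewrite ?preimage_setT //; exact: measurableT.
Qed.

Lemma dir_noise_events_setI d (T : measurableType d) (R : realType) n
  (u : nat -> T -> 'rV[R]_n) (xi : nat -> T -> R) i : setI_closed (dir_noise_events u xi i).
Proof.
case: i => k A B /= [A' mA <-] [B' mB <-]; exists (A' `&` B'); rewrite ?preimage_setI //;
  exact: measurableI.
Qed.

Lemma dir_noise_events_measurable d (T : measurableType d) (R : realType) n
  (u : nat -> T -> 'rV[R]_n) (xi : nat -> T -> R) i :
  (forall k, measurable_fun setT (u k : T -> vecB R n)) ->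
  (forall k, measurable_fun setT (xi k)) -> dir_noise_events u xi i `<=` measurable.
Proof.
move=> mu mxi; case: i => k A /= [A' mA <-].
  by have := mu k measurableT A' mA; rewrite setTI.
by have := mxi k measurableT A' mA; rewrite setTI.
Qed.

Lemma measurable_dir_generated d (T : measurableType d) (R : realType) n
  (u : nat -> T -> 'rV[R]_n) (xi : nat -> T -> R) (J : set (nat + nat)) j : J (inl j) ->
  measurable_fun setT (u j : g_sigma_algebraType (\bigcup_(i in J) dir_noise_events u xi i)
    -> vecB R n).
Proof.
move=> Jj _ B mB; rewrite setTI; apply: sub_sigma_algebra; exists (inl j) => //=.
by exists B.
Qed.

Lemma measurable_noise_generated d (T : measurableType d) (R : realType) n
  (u : nat -> T -> 'rV[R]_n) (xi : nat -> T -> R) (J : set (nat + nat)) j : J (inr j) ->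
  measurable_fun setT (xi j : g_sigma_algebraType (\bigcup_(i in J) dir_noise_events u xi i)
    -> R).
Proof.
move=> Jj _ B mB; rewrite setTI; apply: sub_sigma_algebra; exists (inr j) => //=.
by exists B.
Qed.

(** Each summand is a function of the past times a centred second moment of the fresh direction, so
    independence applies to it. *)
Lemma gradient_noise_split (R : realType) n (g v e : 'rV[R]_n) :
  n%:R * dotv g v * dotv v e - dotv g e =
  \sum_(p <- enum {: 'I_n * 'I_n}) (g 0 p.1 * e 0 p.2) *
     (n%:R * (v 0 p.1 * v 0 p.2) - (p.1 == p.2)%:R).
Proof.
rewrite big_enum /= -(pair_big xpredT xpredT (fun i j => (g 0 i * e 0 j) *
     (n%:R * (v 0 i * v 0 j) - (i == j)%:R))) /=.
rewrite /dotv -mulrA mulr_suml mulr_sumr -sumrB; apply: eq_bigr => i _.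
rewrite mulr_sumr mulr_sumr.
under [RHS]eq_bigr do rewrite mulrBr.
rewrite sumrB; congr (_ - _); first by apply: eq_bigr => j _; ring.
rewrite (bigD1 i) //= eqxx mulr1 big1 ?addr0 // => j ji.
by rewrite eq_sym (negbTE ji) mulr0.
Qed.

Lemma gap_telescope (R : realType) (S1 S2 g Q Q' A B : R) :
  S2 <= S1 - Q -> g <= Q - Q' + A - B -> S2 + g <= S1 + (A - B) - Q'.
Proof. lra. Qed.

Section NoiseMean.
Variables (R : realType) (n : nat) (D : set 'rV[R]_n) (f : 'rV[R]_n -> R).
Variables (F : 'rV[R[i]]_n -> R[i]) (K : set 'rV[R]_n) (b dbar C : R) (x1 xs : 'rV[R]_n).
Variables (d : measure_display) (T : measurableType d) (P : probability T R).
Variables (u : nat -> T -> 'rV[R]_n) (xi : nat -> T -> R) (mu del : nat -> R) (sigma : R).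
Hypotheses (b0 : 0 < b) (bd : b < dbar) (C0 : 0 <= C).
Hypothesis hF : holomorphic_on (cstrip D dbar) F.
Hypotheses (KD : K `<=` D) (cK : compact K) (cvK : convex_set K) (Kx1 : K x1) (Ks : K xs).
Hypothesis bias : forall x v t, K x -> @sphere R n v -> 0 < t -> t <= b ->
  [/\ `|complex.Im (F (cpt x (t *: v))) - t * dotv (grad f x) v| <= C * t ^+ 3,
     `|complex.Im (F (cpt x (t *: v)))| <= C * t & `|dotv (grad f x) v| <= C].
Hypothesis delb : forall j, 0 < del j.+1 <= b.
Hypothesis mu_ : forall k, measurable_fun setT (u k : T -> vecB R n).
Hypothesis uu : forall k, uniform_on_sphere P (u k).
Hypothesis mxi : forall k, measurable_fun setT (xi k).
Hypothesis xi0 : forall k, \int[P]_w xi k w = 0.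
Hypothesis xi2 : forall k, int_le P (fun w => xi k w ^+ 2) sigma.
Hypothesis ind : mutually_independent P (dir_noise_events u xi).

Local Notation X := (zo_iterates F K x1 mu del u xi).

(** [X k] is the iterate x_{k+1}, determined by the directions and noises of rounds 1 to k; round k
    + 1 brings fresh ones. *)
Definition history k : set (nat + nat) :=
  [set i | match i with inl j => (j <= k)%N | inr j => (j <= k)%N end].

(** Stated for any [J] containing the history: the noise of a round is compared with the past
    together with the direction of that round. *)
Lemma measurable_iterate_generated (J : set (nat + nat)) k : history k `<=` J ->
  forall i, measurable_fun setT ((fun w => X k w 0 i) :
    g_sigma_algebraType (\bigcup_(j in J) dir_noise_events u xi j) -> R).
Proof.
move=> HJ i.
apply: (@measurable_zo_iterates _
  (g_sigma_algebraType (\bigcup_(j in J) dir_noise_events u xi j)) R n D K F b dbar) => //.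
  by move=> j w; case: (uu j).
move=> j /andP[j0 jk]; split; first by apply: measurable_noise_generated; exact: HJ.
move=> m; apply: measurable_vecB_coord; apply: measurable_dir_generated; exact: HJ.
Qed.

Lemma measurable_iterate_diff_generated (J : set (nat + nat)) k : history k `<=` J ->
  forall i, measurable_fun setT ((fun w => (X k w - xs) 0 i) :
    g_sigma_algebraType (\bigcup_(j in J) dir_noise_events u xi j) -> R).
Proof.
move=> HJ i.
have -> : (fun w => (X k w - xs) 0 i) = (fun w => X k w 0 i - xs 0 i) :> (T -> R).
  by apply/funext => w; rewrite !mxE.
by apply: measurable_funB; [exact: measurable_iterate_generated|exact: measurable_cst].
Qed.

Lemma iterate_in k w : K (X k w).
Proof. exact: zo_iterates_in. Qed.

Lemma iterate_dist_bounded : exists B : R, forall k w, enorm (X k w - xs) <= B.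
Proof.
have [M [_ MP]] := compact_bounded cK.
have KM x : K x -> `|x| <= M + 1 by move=> Kx; apply: (MP (M + 1)) => //; rewrite ltrDl.
exists (n%:R * (M + 1 + (M + 1))) => k w.
apply: le_trans (ler_enorm_norm _) _; rewrite ler_wpM2l //.
by apply: le_trans (ler_normB _ _) _; apply: lerD; apply: KM => //; exact: iterate_in.
Qed.

Lemma grad_coord_bounded x i : K x -> `|grad f x 0 i| <= C.
Proof.
move=> Kx; rewrite -dotv_evec.
by have [] := bias Kx (enorm_evec R i) b0 (lexx b).
Qed.

Lemma history_fresh_dir k : ~ history k (inl k.+1).
Proof. by rewrite /history /= ltnn. Qed.

Lemma sphere_moment_centered k i j :
  let Y w := n%:R * (u k w 0 i * u k w 0 j) - (i == j)%:R in
  P.-integrable setT (EFin \o Y) /\ \int[P]_w Y w = 0.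
Proof.
move=> Y; have [Su _] := uu k.
have muc m : measurable_fun setT (fun w => u k w 0 m) by exact: measurable_vecB_coord.
have muu : measurable_fun setT (fun w => u k w 0 i * u k w 0 j) by exact: measurable_funM.
have iuu : P.-integrable setT (EFin \o (fun w => u k w 0 i * u k w 0 j)).
  apply: (@bounded_integrable _ _ _ _ _ 1) => // w.
  rewrite normrM -[1]mulr1 -(Su w : enorm _ = 1).
  by apply: ler_pM => //; exact: ler_coord_enorm.
have inuu : P.-integrable setT (EFin \o (fun w => n%:R * (u k w 0 i * u k w 0 j))).
  by have := integrableZl measurableT n%:R iuu; apply: eq_integrable.
have [ic _] := int_le_cst P ((i == j)%:R : R).
split.
  by have := integrableB measurableT inuu ic; apply: eq_integrable.
rewrite RintegralB // RintegralZl // (uniform_on_sphere_moment2 i j (mu_ k) (uu k)).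
have n0 : n%:R != 0 :> R by case: n i {ic inuu iuu muu muc Y Su j} => [[]//|m] _; rewrite pnatr_eq0.
rewrite /Rintegral integral_cst //= probability_setT mule1.
by rewrite mulrC divfK ?subrr.
Qed.

Lemma gradient_noise_mean0 k :
  let Z w := n%:R * dotv (grad f (X k w)) (u k.+1 w) * dotv (u k.+1 w) (X k w - xs)
     - dotv (grad f (X k w)) (X k w - xs) in
  P.-integrable setT (EFin \o Z) /\ \int[P]_w Z w = 0.
Proof.
move=> Z; have [B BP] := iterate_dist_bounded.
pose A (p : 'I_n * 'I_n) w := grad f (X k w) 0 p.1 * (X k w - xs) 0 p.2.
pose Y (p : 'I_n * 'I_n) w := n%:R * (u k.+1 w 0 p.1 * u k.+1 w 0 p.2) - (p.1 == p.2)%:R.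
have H p : P.-integrable setT (EFin \o (fun w => A p w * Y p w)) /\
    \int[P]_w (A p w * Y p w) = 0.
  have [iY Y0] := sphere_moment_centered k.+1 p.1 p.2.
  apply: (@indep_mean_zero _ _ _ P _ (dir_noise_events u xi) (history k) (inl k.+1)
     (A p) (Y p) (C * B) ind) => //.
  - exact: dir_noise_events_setT.
  - exact: dir_noise_events_setI.
  - by move=> j; exact: dir_noise_events_measurable.
  - exact: history_fresh_dir.
  - apply: measurable_funM.
      apply: (@measurable_grad _ (g_sigma_algebraType
        (\bigcup_(j in history k) dir_noise_events u xi j)) R n D K f F b dbar C) => //.
      + by move=> x v t Kx Sv t0 tb; have [] := bias Kx Sv t0 tb.
      + by move=> i; exact: measurable_iterate_generated.
      + by move=> w; exact: iterate_in.
    exact: measurable_iterate_diff_generated.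
  - move=> w; rewrite normrM; apply: ler_pM => //.
      by apply: grad_coord_bounded; exact: iterate_in.
    exact: le_trans (ler_coord_enorm _ _) (BP k w).
  - move=> S mS /=.
    exists ((fun v : vecB R n => n%:R * ((v : 'rV[R]_n) 0 p.1 * (v : 'rV[R]_n) 0 p.2)
       - (p.1 == p.2)%:R) @^-1` S) => //.
    rewrite -[X in measurable X]setTI.
    have : measurable_fun setT (fun v : vecB R n =>
       n%:R * ((v : 'rV[R]_n) 0 p.1 * (v : 'rV[R]_n) 0 p.2) - (p.1 == p.2)%:R).
      apply: measurable_funB; last exact: measurable_cst.
      apply: measurable_funM; first exact: measurable_cst.
      by apply: measurable_funM; exact: measurable_coord_vecB.
    by apply.
have ZE : Z = (fun w => \sum_(p <- enum {: 'I_n * 'I_n}) A p w * Y p w).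
  by apply/funext => w; rewrite /Z gradient_noise_split.
rewrite ZE; elim: (enum _) => [|p s [IH1 IH2]].
  under eq_fun do rewrite big_nil; split; first exact: (int_le_cst P 0).1.
  by rewrite Rintegral_cst // mul0r.
have [Hp1 Hp2] := H p; split.
  under eq_fun do rewrite big_cons.
  by have := integrableD measurableT Hp1 IH1; apply: eq_integrable.
by under eq_Rintegral do rewrite big_cons; rewrite RintegralD // Hp2 IH2 addr0.
Qed.

(** The noise multiplies the direction of its own round, so [J] is the history enlarged by that
    direction; it still omits the index of the noise. *)
Lemma oracle_noise_mean0 k :
  let Z w := dotv (u k.+1 w) (X k w - xs) * xi k.+1 w in
  P.-integrable setT (EFin \o Z) /\ \int[P]_w Z w = 0.
Proof.
move=> Z; have [B BP] := iterate_dist_bounded.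
pose J := history k `|` [set inl k.+1].
have Su w : @sphere R n (u k.+1 w) by case: (uu k.+1).
apply: (@indep_mean_zero _ _ _ P _ (dir_noise_events u xi) J (inr k.+1)
  (fun w => dotv (u k.+1 w) (X k w - xs)) (xi k.+1) B ind) => //.
- exact: dir_noise_events_setT.
- exact: dir_noise_events_setI.
- by move=> j; exact: dir_noise_events_measurable.
- by rewrite /J /history /= => -[|//]; rewrite ltnn.
- apply: measurable_sum => i; apply: measurable_funM.
    by apply: measurable_vecB_coord; apply: measurable_dir_generated; right.
  by apply: measurable_iterate_diff_generated => j Hj; left.
- move=> w; apply: le_trans (ler_normr_dotv _ _) _.
  by rewrite (Su w : enorm _ = 1) mul1r.
- by move=> S mS /=; exists S.
- exact: integrable_of_square (mxi _) (xi2 _).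
Qed.

(** What the one-step inequality leaves besides the telescoping distances: squared bias and second
    moment, minus the two terms of mean zero. *)
Definition step_excess tau k w :=
  ((n%:R * C * del k.+1 ^+ 2) ^+ 2 / tau
      + 2 * n%:R ^+ 2 / (tau * k.+1%:R) * (C ^+ 2 + xi k.+1 w ^+ 2 / del k.+1 ^+ 2))
    - (n%:R * dotv (grad f (X k w)) (u k.+1 w) * dotv (u k.+1 w) (X k w - xs)
       - dotv (grad f (X k w)) (X k w - xs)
       + n%:R / del k.+1 * (dotv (u k.+1 w) (X k w - xs) * xi k.+1 w)).

Lemma step_excess_int_le tau k : 0 < tau -> int_le P (step_excess tau k)
  ((n%:R * C * del k.+1 ^+ 2) ^+ 2 / tau
      + 2 * n%:R ^+ 2 / (tau * k.+1%:R) * (C ^+ 2 + (del k.+1 ^+ 2)^-1 * sigma)).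
Proof.
move=> tau0; have /andP[dk0 _] := delb k.
have [ig g0] := gradient_noise_mean0 k; have [io o0] := oracle_noise_mean0 k.
(* A variable of mean zero may be scaled by a constant of either sign, whereas [int_leZ] asks for a
   nonnegative factor. *)
have L (Z : T -> R) (c : R) : P.-integrable setT (EFin \o Z) -> \int[P]_w Z w = 0 ->
    int_le P (fun w => c * Z w) 0.
  move=> iZ Z0; split; last by rewrite RintegralZl // Z0 mulr0.
  by have := integrableZl measurableT c iZ; apply: eq_integrable.
have h1 := L _ (-1) ig g0; have h2 := L _ (- (n%:R / del k.+1)) io o0.
have p1 : 0 <= (del k.+1 ^+ 2)^-1 by rewrite invr_ge0 sqr_ge0.
have p2 : 0 <= 2 * n%:R ^+ 2 / (tau * k.+1%:R).
  by rewrite divr_ge0 ?mulr_ge0 ?sqr_ge0 // ltW.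
have h3 := int_leD (int_le_cst P (C ^+ 2)) (int_leZ p1 (xi2 k.+1)).
have := int_leD (int_leD (int_leD (int_le_cst P ((n%:R * C * del k.+1 ^+ 2) ^+ 2 / tau))
  (int_leZ p2 h3)) h1) h2.
rewrite !addr0; congr (int_le P _ _); apply/funext => w; rewrite /step_excess.
by field; rewrite !gt_eqF.
Qed.

Variable tau : R.
Hypotheses (tau0 : 0 < tau) (sc : strongly_convex_on D f tau).
Hypothesis Ff : forall x, D x -> F (cpt x 0) = real_complex R (f x).
Hypothesis fs : forall x, K x -> f xs <= f x.
Hypothesis muE : forall k, mu k.+1 = 2 / (tau * k.+1%:R).

(** The leftover distance is kept with weight [N] so that the induction closes; the weight is 0 at
    the start, hence the initial distance does not appear. *)
Lemma sum_gap_le N w : \sum_(k < N) (f (X k w) - f xs) <=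
  \sum_(k < N) step_excess tau k w - tau / 4 * (N%:R * dotv (X N w - xs) (X N w - xs)).
Proof.
elim: N => [|N IH]; first by rewrite !big_ord0 mul0r mulr0 subr0.
rewrite !big_ord_recr /= -/(zo_iterates F K x1 mu del u xi).
have /andP[d0 db] := delb N; have [Su _] := uu N.+1.
have [h1 h2 _] := bias (iterate_in N w) (Su w) d0 db.
have := @zo_step_descent _ _ D K f F tau C N.+1%:R (del N.+1) (xi N.+1 w) (X N w) xs
  (u N.+1 w) (X N.+1 w) sc tau0 cK cvK KD (iterate_in N w) Ks (Su w) d0 (ltr0Sn _ _) C0 h1 h2.
rewrite /= muE => /(_ erefl).
(* Round N + 1 starts from [X N] with weight (N + 1) - 1, exactly the weight with which the previous
   rounds left that distance. *)
have -> : N.+1%:R - 1 = N%:R :> R by rewrite -natr1 addrK.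
move=> h; exact: (gap_telescope IH h).
Qed.

(** Jensen passes from the average iterate to the average gap, and the negative leftover distance is
    dropped. The sum 3 H (N + 1)^(1/3), divided by N + 1, gives the exponent -2/3. *)
Lemma expected_gap_le N (H : R) :
  (forall k, (n%:R * C * del k.+1 ^+ 2) ^+ 2 / tau
      + 2 * n%:R ^+ 2 / (tau * k.+1%:R) * (C ^+ 2 + (del k.+1 ^+ 2)^-1 * sigma)
      <= H * k.+1%:R `^ (- (2 / 3))) -> 0 <= H ->
  ('E_P[fun w => (f (zo_average F K x1 mu del u xi N.+1 w) - f xs)%R]
    <= (3 * H * N.+1%:R `^ (- (2 / 3)))%:E)%E.
Proof.
move=> HP H0.
have inK w : K (zo_average F K x1 mu del u xi N.+1 w).
  exact: (@convex_set_average _ _ K (fun k => X k w) N cvK (fun k => iterate_in k w)).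
have mX k i : measurable_fun setT (fun w => X k w 0 i).
  apply: (@measurable_zo_iterates _ T R n D K F b dbar) => //.
    by move=> j w; case: (uu j).
  by move=> j _; split=> // m; exact: measurable_vecB_coord.
have nN : 0 <= N.+1%:R^-1 :> R by rewrite invr_ge0.
have [S1 S2] := int_leZ nN (int_le_sum (index_enum 'I_N.+1)
   (fun k : 'I_N.+1 => step_excess_int_le k tau0)).
apply: (@expectation_int_le _ _ _ P _ _ _ _ _ _ (conj S1 _)).
- apply: measurable_funB; last exact: measurable_cst.
  apply: (@measurable_objective _ T R n D K f F dbar) => //; first exact: lt_trans bd.
  move=> i; under eq_fun do rewrite /zo_average mxE summxE.
  apply: measurable_funM; first exact: measurable_cst.
  by apply: measurable_sum => k; exact: mX.
- by move=> w; rewrite subr_ge0 fs.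
- move=> w; have := strongly_convex_average N sc (ltW tau0) cvK KD (fun k => iterate_in k w).
  rewrite -/(zo_average F K x1 mu del u xi N.+1 w) => h.
  apply: (@le_trans _ _ (N.+1%:R^-1 * \sum_(k < N.+1) (f (X k w) - f xs))).
    rewrite sumrB mulrBr sumr_const card_ord -[f xs *+ _]mulr_natl mulKf ?pnatr_eq0 //.
    by rewrite lerD2r.
  rewrite ler_wpM2l ?invr_ge0 //; apply: le_trans (sum_gap_le _ _) _.
  by rewrite gerBl mulr_ge0 ?divr_ge0 ?(ltW tau0) // mulr_ge0 // dotv_ge0.
- apply: le_trans S2 _; rewrite ler_pdivrMl //.
  apply: (@le_trans _ _ (H * (3 * N.+1%:R `^ (3^-1)))).
    apply: (@le_trans _ _ (\sum_(k < N.+1) H * k.+1%:R `^ (- (2 / 3)))).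
      by apply: ler_sum => k _; exact: HP.
    by rewrite -mulr_sumr ler_wpM2l // sum_powR_le.
  rewrite [leRHS](_ : _ = H * (3 * (N.+1%:R `^ 1 * N.+1%:R `^ (- (2 / 3))))); last first.
    by rewrite powRr1 //; ring.
  rewrite -powRD ?pnatr_eq0 ?implybT // (_ : 1 - 2 / 3 = 3^-1 :> R) //.
  by field.
Qed.
End NoiseMean.

(** With r = k^(-1/6), k counted from 1, the squared bias carries r^4, and the noise r^6 from 1 / k
    against r^(-2) from the radius, again r^4. The [C ^+ 2] term carries r^6 and is weakened by r <=
    1. *)
Lemma step_rate_le (R : realType) (N C tau delta sigma del : R) (k : nat) :
  0 < tau -> 0 < delta -> 0 <= C -> 0 <= sigma -> del = delta * k.+1%:R `^ (- 6^-1) ->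
  (N * C * del ^+ 2) ^+ 2 / tau + 2 * N ^+ 2 / (tau * k.+1%:R) * (C ^+ 2 + (del ^+ 2)^-1 * sigma)
  <= ((N * C) ^+ 2 * delta ^+ 4 / tau + 2 * N ^+ 2 / tau * (C ^+ 2 + sigma / delta ^+ 2))
     * k.+1%:R `^ (- (2 / 3)).
Proof.
move=> tau0 d0 C0 s0 ->.
have q0 : 0 < k.+1%:R :> R by [].
have r0 := powR_gt0 (- 6^-1) q0.
have r1 : (k.+1%:R : R) `^ (- 6^-1) <= 1.
  rewrite powRN invf_le1 ?powR_gt0 // -[X in X <= _](powRr0 (k.+1%:R : R)).
  by apply: ler_powR; rewrite ?ler1n ?invr_ge0.
have r4 : (k.+1%:R : R) `^ (- (2 / 3)) = (k.+1%:R `^ (- 6^-1)) ^+ 4.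
  by rewrite -powR_mulrn ?ltW // -powRrM (_ : - 6^-1 * 4%:R = - (2 / 3)) //; field.
have r6 : (k.+1%:R : R)^-1 = (k.+1%:R `^ (- 6^-1)) ^+ 6.
  by rewrite -powR_mulrn ?ltW // -powRrM (_ : - 6^-1 * 6%:R = - 1) ?powR_inv1 //; field.
rewrite r4 [(tau * _)^-1]invfM r6; move: (_ `^ _) r0 r1 => r r0 r1 {r4 r6 q0}.
have -> : (N * C * (delta * r) ^+ 2) ^+ 2 / tau + 2 * N ^+ 2 * (tau^-1 * r ^+ 6) *
    (C ^+ 2 + ((delta * r) ^+ 2)^-1 * sigma) =
  ((N * C) ^+ 2 * delta ^+ 4 / tau + 2 * N ^+ 2 / tau * (C ^+ 2 * r ^+ 2 + sigma / delta ^+ 2))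
     * r ^+ 4.
  by field; rewrite !gt_eqF.
rewrite ler_wpM2r ?exprn_ge0 ?(ltW r0) // lerD2l ler_wpM2l //.
  by rewrite (divr_ge0 _ (ltW tau0)) // mulr_ge0 ?sqr_ge0.
by rewrite lerD2r ler_piMr ?sqr_ge0 // exprn_ile1 // ltW.
Qed.

Lemma sphere_dim_gt0 (R : realType) n (v : 'rV[R]_n) : @sphere R n v -> (0 < n)%N.
Proof.
case: n v => // v; rewrite /sphere /= /enorm /dotv big_ord0 sqrtr0.
by move=> /esym/eqP; rewrite oner_eq0.
Qed.

Unset Implicit Arguments.

Theorem mainTheorem3
  (R : realType) (n : nat)
  (D : set 'rV[R]_n) (f : 'rV[R]_n -> R) (tau dbar : R)
  (F : 'rV[R[i]]_n -> R[i])
  (Kset : set 'rV[R]_n) (L2 : R)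
  (kappa delta sigma : R) (x1 xstar : 'rV[R]_n)
  (d : measure_display) (T : measurableType d) (P : probability T R)
  (u : nat -> T -> 'rV[R]_n) (xi : nat -> {RV P >-> R}) :
  (* f : D -> R real-analytic, tau-strongly convex, on the open set D *)
  open D ->
  real_analytic_on D f ->
  0 < tau -> strongly_convex_on D f tau ->
  (* holomorphic extension assumption *)
  0 < dbar < 1 ->
  holomorphic_extension D f dbar F ->
  (* K compact convex subset of D *)
  compact Kset -> convex_set Kset -> Kset `<=` D ->
  (* Lipschitz Hessian on K with a nonzero constant *)
  0 < L2 -> hessian_lipschitz_on Kset f L2 ->
  (* parameters *)
  0 < kappa < 1 -> 0 < delta <= kappa * dbar ->
  (* initial point and the minimizer of f over K *)
  Kset x1 ->
  Kset xstar -> (forall y, Kset y -> f xstar <= f y) ->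
  (* random directions: independent, uniform on S^{n-1} *)
  (forall k, measurable_fun setT (u k : T -> vecB R n)) ->
  (forall k, uniform_on_sphere P (u k)) ->
  (* stochastic oracle noise *)
  0 < sigma ->
  (forall k, ('E_P[xi k] = 0)%E) ->
  (forall k, ('E_P[((xi k : T -> R) ^+ 2)%R] <= sigma%:E)%E) ->
  mutually_independent P (dir_noise_events u (fun k => (xi k : T -> R))) ->
  let mu := fun k : nat => 2 / (tau * k%:R) in
  let deltak := fun k : nat => delta * (k%:R `^ (- 6^-1)) in
  let xbar := zo_average F Kset x1 mu deltak u (fun k => (xi k : T -> R)) in
  exists C : R, 0 <= C /\ exists p : nat,
    forall K : nat, (0 < K)%N ->
      ('E_P[fun w => (f (xbar K w) - f xstar)%R] <=
       (C * (n%:R ^+ 2 / tau) * delta `^ (- 3^-1) * sigma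
          * K%:R `^ (- (2 / 3)) * (1 + ln K%:R) ^+ p)%:E)%E.
Proof.
move=> oD _ tau0 sc /andP[db0 _] hF cK cvK KD _ _ /andP[ka0 ka1] /andP[d0 dk] Kx1 Ks fs.
move=> mu_ uu s0 xi0 xi2 ind mu deltak xbar.
have n0 : (0 < n)%N.
  by have [Su _] := uu 0%N; exact: sphere_dim_gt0 (Su point).
(* The bound b = kappa dbar dominates all radii and stays strictly inside the strip, as the
   compactness argument requires. *)
have b0 : 0 < kappa * dbar by rewrite mulr_gt0.
have bd : kappa * dbar < dbar by rewrite gtr_pMl.
have [C C0 bias] := oracle_bounds oD b0 bd hF cK KD.
have delb k : 0 < deltak k.+1 <= kappa * dbar.
  rewrite /deltak mulr_gt0 ?powR_gt0 //=; apply: le_trans dk.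
  rewrite ler_piMr ?(ltW d0) // powRN invf_le1 ?powR_gt0 // -[X in X <= _](powRr0 (k.+1%:R : R)).
  by apply: ler_powR; rewrite ?ler1n ?invr_ge0.
have mxi k : measurable_fun setT (xi k : T -> R) by exact: measurable_funP.
have xi2' k : int_le P (fun w => xi k w ^+ 2) sigma by apply: int_le_square => //; exact: xi2.
have xi0' k : \int[P]_w xi k w = 0 by have := xi0 k; rewrite unlock /Rintegral => ->.
pose H := (n%:R * C) ^+ 2 * delta ^+ 4 / tau + 2 * n%:R ^+ 2 / tau * (C ^+ 2 + sigma / delta ^+ 2).
have H0 : 0 <= H.
  rewrite addr_ge0 //; first by rewrite divr_ge0 ?(ltW tau0) // mulr_ge0 ?sqr_ge0 // exprn_ge0 // ltW.
  rewrite mulr_ge0 ?divr_ge0 ?mulr_ge0 ?sqr_ge0 ?(ltW tau0) //.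
  by rewrite addr_ge0 ?sqr_ge0 // divr_ge0 ?sqr_ge0 // ltW.
have w0 : 0 < n%:R ^+ 2 / tau * delta `^ (- 3^-1) * sigma.
  by rewrite !mulr_gt0 ?powR_gt0 ?invr_gt0 ?exprn_gt0 ?ltr0n.
(* The constant may depend on everything but [K], so the prefactor of the
   announced rate is divided out. *)
exists (3 * H / (n%:R ^+ 2 / tau * delta `^ (- 3^-1) * sigma)); split.
  by rewrite divr_ge0 ?(ltW w0) // mulr_ge0.
(* Power 0 of the logarithmic factor; [K] becomes [N.+1], which excludes the empty average. *)
exists 0%N => -[//|N] _.
have -> : 3 * H / (n%:R ^+ 2 / tau * delta `^ (- 3^-1) * sigma) * (n%:R ^+ 2 / tau) *
   delta `^ (- 3^-1) * sigma * N.+1%:R `^ (- (2 / 3)) * (1 + ln N.+1%:R) ^+ 0 =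
   3 * H * N.+1%:R `^ (- (2 / 3)).
  rewrite expr0 mulr1; congr (_ * _).
  by rewrite -[LHS]mulrA -[LHS]mulrA [_ / tau * (_ * _)]mulrA divfK ?gt_eqF.
case: hF => hF Ff.
have step k : (n%:R * C * deltak k.+1 ^+ 2) ^+ 2 / tau + 2 * n%:R ^+ 2 / (tau * k.+1%:R) *
    (C ^+ 2 + (deltak k.+1 ^+ 2)^-1 * sigma) <= H * k.+1%:R `^ (- (2 / 3)).
  by apply: step_rate_le => //; exact: ltW.
exact: (@expected_gap_le _ _ _ _ _ _ _ _ _ _ _ _ _ P u (fun k => xi k : T -> R) mu deltak sigma
  b0 bd C0 hF KD cK cvK Kx1 Ks bias delb mu_ uu mxi xi0' xi2' ind tau tau0 sc Ff fs
  (fun k => erefl) N H step H0).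
Qed.
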